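(* There exists an absolute constant $c_1>0$ such that the following holds. Let $X$ be a real random variable with mean $\mu$ and standard deviation $\sigma>0$, and let $\delta>0$. Suppose that the characteristic function $f_X$ of $X$ is entire, satisfies $$\liminf_{r\to\infty}\frac{\log^+\log M(r,f_X)}{r}=0,\qquad M(r,f_X)=\max_{|z|=r}|f_X(z)|,$$ and has no zeros in the strip $\{z\in\mathbf{C}:|\mathrm{Re}\,z|<\delta\}$. Then the distribution function $F_{X^*}$ of the random variable $X^*=(X-\mu)/\sigma$ satisfies $$\sup_{t\in\mathbf{R}}|F_{X^*}(t)-F_N(t)|\le\frac{c_1}{\sigma\delta},$$ where $F_N$ is the distribution function of the standard normal distribution $N$, whose characteristic function is $f_N(z)=\exp(-z^2/2)$.
   Context: The characteristic function of $X$ is $f_X(t)=\mathbf{E}\,e^{itX}$, $t\in\mathbf{R}$; saying that it is entire means that it extends to an entire function on $\mathbf{C}$, still denoted $f_X$. The distribution function of a random variable $Y$ is $F_Y(t)=\mathbf{P}(Y\le t)$. Here $\log^+ s=\max\{\log s,0\}$ for $s>0$ and $\log^+ 0=0$. ''Absolute constant'' means that $c_1$ does not depend on $X$ or $\delta$. *)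

(* Defs.v *)
From HB Require Import structures.
From mathcomp Require Import all_boot all_order all_algebra.
From mathcomp Require Import complex.
From mathcomp Require Import all_classical all_reals all_analysis measurable_realfun.

Set Implicit Arguments.
Unset Strict Implicit.
Unset Printing Implicit Defensive.

Import Order.TTheory GRing.Theory Num.Theory.
Import numFieldNormedType.Exports.

Local Open Scope classical_set_scope.
Local Open Scope ring_scope.
Local Open Scope complex_scope.

Section complex_functions.
Variable R : realType.

(* The library norm on R[i] is valued in R[i]; this is its real value. *)
Definition cmod (z : R[i]) : R := complex.Re `|z|.

(* Scalars and increments range over R[i], so this is differentiability in the
   complex sense at every point. *)
Definition entire (f : R[i] -> R[i]) : Prop :=
  forall z : R[i], derivable (f : R[i]^o -> R[i]^o) z 1.

(* For r >= 0 and f continuous the circle is compact and nonempty, so this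
   supremum is attained. *)
Definition max_modulus (r : R) (f : R[i] -> R[i]) : R :=
  sup [set cmod (f z) | z in [set z | cmod z = r]].

(* Total: ln s = 0 for s <= 0 in the library, hence logplus 0 = 0. *)
Definition logplus (s : R) : R := Num.max (ln s) 0.

(* exp(i x) for real x. *)
Definition expi (x : R) : R[i] := cos x +i* sin x.

End complex_functions.

Section random_variables.
Context d (T : measurableType d) (R : realType) (P : probability T R).

(* Both parts are integrable for the bounded integrand used below. *)
Definition complex_expectation (Z : T -> R[i]) : R[i] :=
  fine 'E_P[fun w => complex.Re (Z w)] +i* fine 'E_P[fun w => complex.Im (Z w)].

Definition char_fun (X : {RV P >-> R}) (t : R) : R[i] :=
  complex_expectation (fun w => expi (t * X w)).

Definition standardize (X : {RV P >-> R}) (mu sigma : R) : T -> R :=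
  fun w => (X w - mu) / sigma.

Lemma measurable_standardize (X : {RV P >-> R}) (mu sigma : R) :
  measurable_fun setT (standardize X mu sigma).
Proof.
by apply: measurable_funM => //; apply: measurable_funB.
Qed.

HB.instance Definition _ (X : {RV P >-> R}) (mu sigma : R) :=
  isMeasurableFun.Build _ _ _ _ (standardize X mu sigma)
    (measurable_standardize X mu sigma).

End random_variables.

(* normal_prob m s has mean m and standard deviation s. *)
Definition std_normal_cdf (R : realType) (t : R) : \bar R :=
  normal_prob (0 : R) 1 `]-oo, t].

(* Main.v *)
Require Import Defs.
From HB Require Import structures.
From mathcomp Require Import all_boot all_order all_algebra.
From mathcomp Require Import complex ring lra.
From mathcomp Require Import all_classical all_reals all_analysis measurable_realfun.

Set Implicit Arguments.
Unset Strict Implicit.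
Unset Printing Implicit Defensive.

Import Order.TTheory GRing.Theory Num.Theory.
Import numFieldNormedType.Exports.

Local Open Scope classical_set_scope.
Local Open Scope ring_scope.
Local Open Scope complex_scope.

Local Notation ii := (Complex 0 1).

(* Write F(w) = E exp(wX) = f(-iw).  The even moments of X are bounded by
   iterated central differences of f at 0, hence by its Taylor remainders, so
   an entire f forces all exponential moments of X to be finite.  In the strip
   |Im w| < delta write F = exp H.  The ridge property |F(x+iy)| <= F(x) and
   F(conj w) = conj F(w) make Re (H(w - ia) - H(w + ia)) nonnegative on the
   lines Im w = 0 and Im w = a; by the growth hypothesis and the
   Phragmen-Lindelof principle it is nonnegative in between, so, dividing by a
   and letting a tend to 0, H' is real on the real line with Im H' >= 0 above
   it.  Such a function differs from its linear part at 0 by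
   O(sigma^2 |w|^2 / delta), which gives
   F(it) = exp(i mu t - sigma^2 t^2 / 2 + O(sigma^2 t^3 / delta)) for
   t <= delta / 8.  A smoothing inequality turns this into the bound on the
   distribution functions. *)

(** * Modulus, derivatives and exponential *)

(** No bound for H' on a circle is available that depends on the variance alone, yet its Taylor
    remainder must be controlled by H''(0), which is the variance. Positivity achieves this: if a
    function is real on the real axis and has nonnegative imaginary part above it, then Im times sin
    t on a circle is a positive density whose mass is a multiple of the derivative at 0. The liminf
    in the growth hypothesis provides good radii arbitrarily far out, not all large radii. This
    suffices because the Phragmen-Lindelof step is a minimum principle on a single rectangle, whose
    vertical sides can be placed near such a radius; the lower bound of Re H needed there comes from
    Harnack's inequality and Jensen's bound F(x) >= exp(mu x). In the smoothing inequality the error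
    of replacing a step by a band-limited function is dominated by Fejer kernels, whose expectations
    are again read off from characteristic functions, so that no density bound enters. The complex
    analysis rests on one form of Goursat's theorem, for the cone over a curve. Constants are not
    sharp: real and imaginary parts are estimated separately, at the price of a factor 2. *)

Section modulus.
Variable R : realType.
Implicit Types z w : R[i].

Lemma cmodE z : cmod z = Num.sqrt (complex.Re z ^+ 2 + complex.Im z ^+ 2).
Proof. by rewrite /cmod normc_def. Qed.

Lemma cmod_normE z : (cmod z)%:C = `|z|.
Proof. by rewrite /cmod normc_def. Qed.

Lemma cmodM z w : cmod (z * w) = cmod z * cmod w.
Proof. by apply: complexI; rewrite rmorphM /= !cmod_normE normrM. Qed.

Lemma cmodD z w : cmod (z + w) <= cmod z + cmod w.
Proof. by rewrite -lecR rmorphD /= !cmod_normE ler_normD. Qed.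

Lemma cmodN z : cmod (- z) = cmod z.
Proof. by rewrite /cmod normrN. Qed.

Lemma cmodB z w : cmod (z - w) <= cmod z + cmod w.
Proof. by rewrite -(cmodN w) cmodD. Qed.

Lemma cmodBC z w : cmod (z - w) = cmod (w - z).
Proof. by rewrite -cmodN opprB. Qed.

Lemma cmod_ge0 z : 0 <= cmod z.
Proof. by rewrite cmodE sqrtr_ge0. Qed.

Lemma cmod0 : cmod (0 : R[i]) = 0.
Proof. by rewrite /cmod normr0. Qed.

Lemma cmodi : cmod (ii : R[i]) = 1.
Proof. by rewrite cmodE /= expr0n add0r expr1n sqrtr1. Qed.

Lemma cmod_eq0 z : (cmod z == 0) = (z == 0).
Proof. by rewrite -(inj_eq (@complexI R)) cmod_normE normr_eq0. Qed.

Lemma cmod_gt0 z : (0 < cmod z) = (z != 0).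
Proof. by rewrite lt_neqAle cmod_ge0 andbT eq_sym cmod_eq0. Qed.

Lemma cmodR (x : R) : cmod x%:C = `|x|.
Proof. by rewrite cmodE /= expr0n addr0 sqrtr_sqr. Qed.

Lemma cmodV z : cmod z^-1 = (cmod z)^-1.
Proof. by apply: complexI; rewrite cmod_normE normfV -cmod_normE fmorphV. Qed.

Lemma cmodX z n : cmod (z ^+ n) = cmod z ^+ n.
Proof. by apply: complexI; rewrite cmod_normE normrX -cmod_normE rmorphXn. Qed.

Lemma sqr_cmod z : cmod z ^+ 2 = complex.Re z ^+ 2 + complex.Im z ^+ 2.
Proof. by rewrite cmodE sqr_sqrtr// addr_ge0 ?sqr_ge0. Qed.

Lemma Re_le_cmod z : `|complex.Re z| <= cmod z.
Proof. by rewrite cmodE -sqrtr_sqr ler_sqrt ?addr_ge0 ?sqr_ge0// lerDl sqr_ge0. Qed.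

Lemma Im_le_cmod z : `|complex.Im z| <= cmod z.
Proof. by rewrite cmodE -sqrtr_sqr ler_sqrt ?addr_ge0 ?sqr_ge0// lerDr sqr_ge0. Qed.

Lemma cmod_le_ReIm z : cmod z <= `|complex.Re z| + `|complex.Im z|.
Proof.
rewrite {1}(complexE z) (le_trans (cmodD _ _))// cmodM cmodi mul1r !cmodR.
exact: lexx.
Qed.

Lemma conjcE z : (conjc z) = complex.Re z -i* complex.Im z.
Proof. by case: z. Qed.

Lemma cmodJ z : cmod (conjc z) = cmod z.
Proof. by rewrite !cmodE; case: z => a b /=; rewrite sqrrN. Qed.

Lemma cReJ z : complex.Re (conjc z) = complex.Re z.
Proof. by case: z. Qed.

Lemma cImJ z : complex.Im (conjc z) = - complex.Im z.
Proof. by case: z. Qed.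

Lemma mulcJ z : z * (conjc z) = (cmod z ^+ 2)%:C.
Proof. by rewrite sqr_cmod; case: z => a b; simpc; congr (_ +i* _); ring. Qed.

Lemma cReD z w : complex.Re (z + w : R[i]) = complex.Re z + complex.Re w.
Proof. by case: z w => [a b] [c d]. Qed.
Lemma cImD z w : complex.Im (z + w : R[i]) = complex.Im z + complex.Im w.
Proof. by case: z w => [a b] [c d]. Qed.
Lemma cReN z : complex.Re (- z : R[i]) = - complex.Re z.
Proof. by case: z. Qed.
Lemma cImN z : complex.Im (- z : R[i]) = - complex.Im z.
Proof. by case: z. Qed.
Lemma cReM z w : complex.Re (z * w : R[i]) =
  complex.Re z * complex.Re w - complex.Im z * complex.Im w.
Proof. by case: z w => [a b] [c d]. Qed.
Lemma cImM z w : complex.Im (z * w : R[i]) =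
  complex.Re z * complex.Im w + complex.Im z * complex.Re w.
Proof. by case: z w => [a b] [c d]. Qed.

Lemma conjcM z w : (conjc (z * w)) = (conjc z) * (conjc w).
Proof. exact: rmorphM. Qed.
Lemma conjcB z w : (conjc (z - w)) = (conjc z) - (conjc w).
Proof. exact: rmorphB. Qed.

Lemma conjcV z : (conjc (z^-1)) = ((conjc z))^-1.
Proof. exact: conjc_inv. Qed.

Lemma cmod_le0 z : cmod z <= 0 -> z = 0.
Proof. by move=> z0; apply/eqP; rewrite -cmod_eq0 eq_le z0 cmod_ge0. Qed.

(** Integrals and coefficients are shown to vanish in this form: an arbitrary [e] times one fixed
    [M]. Since [M] may be 0, the proof divides by [M + 1]. *)
Lemma cmod_small z M : 0 <= M -> (forall e : R, 0 < e -> cmod z <= e * M) -> z = 0.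
Proof.
move=> M0 zM; apply: cmod_le0; apply/ler_addgt0Pr => e e0.
have M1 : 0 < M + 1 by rewrite ltr_wpDl.
rewrite add0r (le_trans (zM (e / (M + 1)) _)) ?divr_gt0//.
by rewrite -mulrA ler_piMr ?(ltW e0)// mulrC ler_pdivrMr// mul1r lerDl.
Qed.

End modulus.

Section differentiability.
Variable R : realType.
Local Notation C := R[i].

(* [V] is either C itself (complex derivative) or R (derivative of a curve);
   [emb] is the inclusion of [V] in C. *)
Definition tdiff (V : zmodType) (emb : V -> C) (f : V -> C) (z : V) (d : C) :=
  forall e : R, 0 < e -> exists2 k : R, 0 < k & forall h : V, cmod (emb h) < k ->
    cmod (f (z + h) - f z - d * emb h) <= e * cmod (emb h).

Definition tcont (V : zmodType) (emb : V -> C) (f : V -> C) (z : V) :=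
  forall e : R, 0 < e -> exists2 k : R, 0 < k & forall h : V, cmod (emb h) < k ->
    cmod (f (z + h) - f z) <= e.

Definition cdiff := @tdiff C id.
Definition rdiff := @tdiff R (real_complex R).
Definition ccont := @tcont C id.
Definition rcont := @tcont R (real_complex R).

Section generic.
Variables (V : zmodType) (emb : V -> C).
Local Notation td := (tdiff emb).
Local Notation tc := (tcont emb).
Implicit Types f g : V -> C.

Lemma tdiff_cont f z d : td f z d -> tc f z.
Proof.
move=> fd e e0; have [k k0 H] := fd 1 ltr01.
have D0 : 0 < 1 + cmod d by rewrite ltr_wpDr ?cmod_ge0.
exists (Num.min k (e / (1 + cmod d))); first by rewrite lt_min k0 divr_gt0.
move=> h; rewrite lt_min => /andP[hk he].
have -> : f (z + h) - f z = (f (z + h) - f z - d * emb h) + d * emb h by ring.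
rewrite (le_trans (cmodD _ _))// (le_trans (lerD (H _ hk) (lexx _)))//.
by rewrite cmodM -mulrDl mulrC -ler_pdivlMr// ltW.
Qed.

Lemma tcont_bound f z : tc f z -> exists2 k : R, 0 < k &
  forall h, cmod (emb h) < k -> cmod (f (z + h)) <= cmod (f z) + 1.
Proof.
move=> /(_ 1 ltr01)[k k0 H]; exists k => // h /H hk.
have -> : f (z + h) = f z + (f (z + h) - f z) by ring.
by rewrite (le_trans (cmodD _ _))// lerD2l.
Qed.

Lemma tdiff_cst c z : td (fun=> c) z 0.
Proof.
by move=> e e0; exists 1 => // h _; rewrite mul0r !subr0 subrr cmod0 mulr_ge0 ?cmod_ge0 ?ltW.
Qed.

Lemma tdiffD f g z d d' : td f z d -> td g z d' -> td (fun x => f x + g x) z (d + d').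
Proof.
move=> fd gd e e0; have e2 : 0 < e / 2 by rewrite divr_gt0.
have [k k0 H] := fd _ e2; have [k' k'0 H'] := gd _ e2.
exists (Num.min k k'); first by rewrite lt_min k0.
move=> h; rewrite lt_min => /andP[hk hk'].
have -> : f (z + h) + g (z + h) - (f z + g z) - (d + d') * emb h =
  (f (z + h) - f z - d * emb h) + (g (z + h) - g z - d' * emb h) by ring.
rewrite (le_trans (cmodD _ _))// (le_trans (lerD (H _ hk) (H' _ hk')))//.
by rewrite -mulrDl -splitr.
Qed.

Lemma tdiffZ f z d c : td f z d -> td (fun x => c * f x) z (c * d).
Proof.
move=> fd e e0; have c0 : 0 < cmod c + 1 by rewrite ltr_wpDl ?cmod_ge0.
have [k k0 H] := fd _ (divr_gt0 e0 c0).
exists k => // h hk; have -> : c * f (z + h) - c * f z - c * d * emb h =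
  c * (f (z + h) - f z - d * emb h) by ring.
rewrite cmodM (le_trans (ler_wpM2l (cmod_ge0 _) (H _ hk)))// mulrA.
rewrite ler_wpM2r ?cmod_ge0// mulrCA ler_piMr ?(ltW e0)//.
by rewrite ler_pdivrMr// mul1r lerDl.
Qed.

Lemma tdiffN f z d : td f z d -> td (fun x => - f x) z (- d).
Proof.
move=> fd; have := tdiffZ (-1) fd; rewrite mulN1r.
by congr tdiff; apply/funext => x; rewrite mulN1r.
Qed.

Lemma tdiffB f g z d d' : td f z d -> td g z d' -> td (fun x => f x - g x) z (d - d').
Proof. by move=> fd gd; apply: tdiffD => //; apply: tdiffN. Qed.

Lemma tdiff_emb z : {morph emb : x y / x + y} -> td emb z 1.
Proof.
move=> embD e e0; exists 1 => // h _; rewrite embD mul1r (addrC (emb z)) addrK subrr cmod0.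
by rewrite mulr_ge0 ?cmod_ge0 ?ltW.
Qed.

(** The outer function is complex differentiable while the inner one has any admissible domain [V],
    so this is both the complex chain rule and the derivative of a holomorphic function along a
    curve. *)
Lemma tdiff_comp (f : C -> C) g z d d' : tdiff id f (g z) d' -> td g z d ->
  td (fun x => f (g x)) z (d' * d).
Proof.
move=> fd gd e e0; have := tdiff_cont gd; move: (gd).
have D'0 : 0 < cmod d' + 1 by rewrite ltr_wpDl ?cmod_ge0.
have D0 : 0 < cmod d + 1 by rewrite ltr_wpDl ?cmod_ge0.
have e1 : 0 < e / 2 / (cmod d + 1) by rewrite !divr_gt0.
have [k1 k10 H1] := fd _ e1.
have e2 : 0 < Num.min 1 (e / 2 / (cmod d' + 1)) by rewrite lt_min !divr_gt0 ?ltr01.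
move=> /(_ _ e2)[k2 k20 H2] /(_ _ (divr_gt0 k10 (ltr0Sn _ 1)))[k3 k30 H3].
exists (Num.min k2 k3); first by rewrite lt_min k20.
move=> h; rewrite lt_min => /andP[hk2 hk3].
set y := g (z + h) - g z; have gy : g (z + h) = g z + y by rewrite /y; ring.
have yk : cmod y < k1 by rewrite (le_lt_trans (H3 _ hk3))// ltr_pdivrMr// ltr_pMr// ltr1n.
have := H1 _ yk; rewrite -gy => Hf.
have Hg := H2 _ hk2; rewrite -/y in Hg.
have -> : f (g (z + h)) - f (g z) - d' * d * emb h =
  (f (g (z + h)) - f (g z) - d' * y) + d' * (y - d * emb h) by ring.
have m0 := cmod_ge0 (emb h).
have yle : cmod y <= (cmod d + 1) * cmod (emb h).
  have -> : y = (y - d * emb h) + d * emb h by ring.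
  rewrite (le_trans (cmodD _ _))// cmodM mulrDl mul1r addrC lerD2l (le_trans Hg)//.
  by rewrite ler_piMl// ge_min lexx.
rewrite (le_trans (cmodD _ _))// cmodM.
have T1 : cmod (f (g (z + h)) - f (g z) - d' * y) <= e / 2 * cmod (emb h).
  rewrite (le_trans Hf)// (le_trans (ler_wpM2l (ltW e1) yle))//.
  by rewrite mulrA divfK ?gt_eqF.
have T2 : cmod d' * cmod (y - d * emb h) <= e / 2 * cmod (emb h).
  rewrite (le_trans (ler_wpM2l (cmod_ge0 _) Hg))// mulrA ler_wpM2r//.
  rewrite (@le_trans _ _ (cmod d' * (e / 2 / (cmod d' + 1))))//.
    by rewrite ler_wpM2l ?cmod_ge0// ge_min lexx orbT.
  rewrite mulrCA ler_piMr ?divr_ge0 ?(ltW e0)//.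
  by rewrite ler_pdivrMr// mul1r lerDl.
by rewrite (le_trans (lerD T1 T2))// -mulrDl -splitr.
Qed.

End generic.

Lemma cdiff_id z : cdiff id z 1.
Proof. exact: tdiff_emb. Qed.

Lemma cdiff_sqr z : cdiff (fun x => x ^+ 2) z (2%:R * z).
Proof.
move=> e e0; exists e => // h hk.
have -> : (z + h) ^+ 2 - z ^+ 2 - 2%:R * z * h = h * h by ring.
by rewrite cmodM ler_wpM2r ?cmod_ge0// ltW.
Qed.

Lemma cdiffV z : z != 0 -> cdiff (fun x => x^-1) z (- z ^- 2).
Proof.
move=> z0 e e0; have m0 : 0 < cmod z by rewrite cmod_gt0.
(* The first bound keeps |z + h| >= |z| / 2; the second makes |h| / (|z|^2 |z + h|) at most [e]. *)
exists (Num.min (cmod z / 2) (e * cmod z ^+ 3 / 2)).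
  by rewrite lt_min !(divr_gt0, mulr_gt0, exprn_gt0).
move=> h; rewrite lt_min => /andP[h1 h2].
have zh : cmod z / 2 <= cmod (z + h).
  have : cmod z <= cmod (z + h) + cmod h.
    by rewrite (le_trans _ (cmodB _ _))// addrK.
  by move=> ?; lra.
have zh0 : z + h != 0 by rewrite -cmod_gt0 (lt_le_trans _ zh) ?divr_gt0.
have -> : (z + h)^-1 - z^-1 - - z ^- 2 * h = h * (h / (z ^+ 2 * (z + h))).
  by field; rewrite z0 zh0.
rewrite cmodM mulrC ler_wpM2r ?cmod_ge0// cmodM cmodV cmodM cmodX.
have P0 : 0 < cmod z ^+ 2 * cmod (z + h) by rewrite mulr_gt0 ?exprn_gt0 ?cmod_gt0.
rewrite ler_pdivrMr//.
have Q : e * (cmod z ^+ 2 * (cmod z / 2)) <= e * (cmod z ^+ 2 * cmod (z + h)).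
  by rewrite ler_pM2l// ler_pM2l ?exprn_gt0.
by rewrite (le_trans (ltW h2))// (le_trans _ Q)// le_eqVlt; apply/orP; left; apply/eqP; field.
Qed.

(** By polarization, fg = ((f + g)^2 - (f - g)^2) / 4, so the chain rule for the square replaces a
    separate estimate for products. *)
Lemma tdiffM (V : zmodType) (emb : V -> C) (f g : V -> C) z d d' :
  tdiff emb f z d -> tdiff emb g z d' ->
  tdiff emb (fun x => f x * g x) z (d * g z + f z * d').
Proof.
move=> fd gd.
have S := tdiff_comp (@cdiff_sqr _) (tdiffD fd gd).
have D := tdiff_comp (@cdiff_sqr _) (tdiffB fd gd).
have := tdiffZ (4%:R^-1) (tdiffB S D).
have -> : (fun x => 4%:R^-1 * ((f x + g x) ^+ 2 - (f x - g x) ^+ 2)) = (fun x => f x * g x).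
  by apply/funext => x; field.
by congr tdiff; field.
Qed.

Lemma tdiffX (V : zmodType) (emb : V -> C) (f : V -> C) z d n :
  tdiff emb f z d -> tdiff emb (fun x => f x ^+ n) z (n%:R * f z ^+ n.-1 * d).
Proof.
move=> fd; elim: n => [|n IH].
  by rewrite !mul0r; apply: tdiff_cst.
have := tdiffM fd IH; have -> : (fun x => f x * f x ^+ n) = (fun x => f x ^+ n.+1).
  by apply/funext => x; rewrite exprS.
congr tdiff => /=; case: n {IH} => [|n] /=; first by rewrite expr0; ring.
by rewrite -(natr1 n.+1) exprS; ring.
Qed.

End differentiability.

Section exponential.
Variable R : realType.
Local Notation C := R[i].

(** Built from real functions rather than from a power series; its complex derivative is recovered
    later from derivatives along rays. *)
Definition cexp (z : C) : C :=
  (expR (complex.Re z))%:C * expi (complex.Im z).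

Lemma expiD (x y : R) : expi (x + y) = expi x * expi y.
Proof. by rewrite /expi; simpc; rewrite cosD sinD; congr (_ +i* _); ring. Qed.

Lemma expi0 : expi (0 : R) = 1.
Proof. by rewrite /expi cos0 sin0. Qed.

Lemma cmod_expi (x : R) : cmod (expi x) = 1.
Proof. by rewrite cmodE /= cos2Dsin2 sqrtr1. Qed.

Lemma expi_neq0 (x : R) : expi x != 0.
Proof. by rewrite -cmod_gt0 cmod_expi. Qed.

Lemma conj_expi (x : R) : (conjc (expi x)) = expi (- x).
Proof. by rewrite /expi cosN sinN. Qed.

Lemma cexpD z w : cexp (z + w) = cexp z * cexp w.
Proof. by rewrite /cexp cReD cImD expRD expiD rmorphM /=; ring. Qed.

Lemma cexp0 : cexp 0 = 1.
Proof. by rewrite /cexp /= expR0 expi0 mulr1. Qed.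

Lemma cmod_cexp z : cmod (cexp z) = expR (complex.Re z).
Proof. by rewrite /cexp cmodM cmodR cmod_expi mulr1 ger0_norm ?expR_ge0. Qed.

Lemma cexp_neq0 z : cexp z != 0.
Proof. by rewrite -cmod_gt0 cmod_cexp expR_gt0. Qed.

Lemma cexpN z : cexp (- z) = (cexp z)^-1.
Proof.
apply: (mulfI (cexp_neq0 z)); rewrite -cexpD subrr cexp0 mulfV//; exact: cexp_neq0.
Qed.

Lemma cexpR (x : R) : cexp x%:C = (expR x)%:C.
Proof. by rewrite /cexp /= expi0 mulr1. Qed.

End exponential.

(** * Real calculus *)

Section real_calculus.
Variable R : realType.
Implicit Types (f g F : R -> R) (a b c d t M : R).

Lemma continuous_epsP f t : {for t, continuous f} <->
  forall e : R, 0 < e -> exists2 k : R, 0 < k & forall h : R, `|h| < k ->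
    `|f (t + h) - f t| <= e.
Proof.
split=> [/cvgrPdist_le ft e e0|H].
  have /nbhs_ballP[k /= k0 H] := ft _ e0; exists k => // h hk.
  by rewrite distrC; apply: H; rewrite /ball /= opprD addrA subrr add0r normrN.
apply/cvgrPdist_le => e e0; have [k k0 Hk] := H e e0.
apply/nbhs_ballP; exists k => //= y; rewrite /ball /= => yk.
have -> : y = t + (y - t) by ring.
by rewrite distrC; apply: Hk; rewrite distrC.
Qed.

Lemma is_derive_epsP f t d : is_derive t 1 f d <->
  forall e : R, 0 < e -> exists2 k : R, 0 < k & forall h : R, `|h| < k ->
    `|f (t + h) - f t - d * h| <= e * `|h|.
Proof.
split=> [fd e e0|H].
  have : h^-1 *: ((f \o shift t) (h *: 1) - f t) @[h --> 0^'] --> d.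
    by have [fd1 <-] := fd; exact: fd1.
  move=> /cvgrPdist_le/(_ _ e0); rewrite near_withinE => /nbhs_ballP[k /= k0 Hk].
  exists k => // h hk; have [->|h0] := eqVneq h 0.
    by rewrite addr0 subrr mulr0 subr0 normr0 mulr0.
  have := Hk h; rewrite /ball /= sub0r normrN => /(_ hk h0).
  rewrite /= [h%:A]mulr1 (addrC h t) => Hd.
  have -> : f (t + h) - f t - d * h = - (d - h^-1 * (f (t + h) - f t)) * h.
    by field.
  by rewrite normrM normrN ler_wpM2r.
have cv : h^-1 *: ((f \o shift t) (h *: 1) - f t) @[h --> 0^'] --> d.
  apply/cvgrPdist_le => e e0; have [k k0 Hk] := H e e0.
  rewrite near_withinE; apply/nbhs_ballP; exists k => //= h.
  rewrite /ball /= sub0r normrN => hk h0; rewrite [h%:A]mulr1 (addrC h t).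
  have -> : d - h^-1 *: (f (t + h) - f t) = - ((f (t + h) - f t - d * h) / h).
    by rewrite /GRing.scale /=; field.
  by rewrite normrN normrM normfV ler_pdivrMr ?normr_gt0//; exact: Hk.
by apply: DeriveDef; [apply/cvg_ex; exists d | exact: cvg_lim cv].
Qed.

Lemma is_derive_continuous f t d : is_derive t 1 f d -> {for t, continuous f}.
Proof. by move=> [df _]; apply: differentiable_continuous; apply/derivable1_diffP. Qed.

(** Two-sided continuity even at the end points: pointwise limit rules then apply directly, and
    subintervals inherit the property. *)
Definition cont_on a b f := forall t, a <= t <= b -> {for t, continuous f}.

Lemma cont_on_within a b f : cont_on a b f -> {within `[a, b], continuous f}.
Proof.
move=> H; apply: continuous_in_subspaceT => t; rewrite inE /= in_itv /=.
exact: H.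
Qed.

Lemma cont_onW a b c d f : a <= c -> d <= b -> cont_on a b f -> cont_on c d f.
Proof.
move=> ac db H t /andP[ct td]; apply: H.
by rewrite (le_trans ac ct) (le_trans td db).
Qed.

Definition integ (a b : R) f : R := \int[lebesgue_measure]_(x in `[a, b]) f x.

Lemma cont_on_integrable a b f : cont_on a b f ->
  lebesgue_measure.-integrable `[a, b] (EFin \o f).
Proof.
move=> H; apply: continuous_compact_integrable; first exact: segment_compact.
exact: cont_on_within.
Qed.

Lemma eq_integ a b f g : (forall t, a <= t <= b -> f t = g t) ->
  integ a b f = integ a b g.
Proof.
by move=> fg; apply: eq_Rintegral => t; rewrite inE /= in_itv /= => /fg.
Qed.

Lemma integD a b f g : cont_on a b f -> cont_on a b g ->
  integ a b (fun t => f t + g t) = integ a b f + integ a b g.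
Proof. by move=> cf cg; apply: RintegralD => //; exact: cont_on_integrable. Qed.

Lemma integZ a b c f : cont_on a b f ->
  integ a b (fun t => c * f t) = c * integ a b f.
Proof. by move=> cf; apply: RintegralZl => //; exact: cont_on_integrable. Qed.

Lemma integ_cst a b c : a <= b -> integ a b (fun=> c) = c * (b - a).
Proof.
move=> ab; rewrite /integ Rintegral_cst//= lebesgue_measure_itv /= lte_fin.
by case: ltP => //= ba; rewrite (le_anti (introT andP (conj ab ba))) subrr.
Qed.

Lemma integ_le a b f g : cont_on a b f -> cont_on a b g ->
  (forall t, a <= t <= b -> f t <= g t) -> integ a b f <= integ a b g.
Proof.
move=> cf cg fg; apply: le_Rintegral => //; exact: cont_on_integrable.
Qed.

Lemma integ_ge0 a b f : (forall t, a <= t <= b -> 0 <= f t) -> 0 <= integ a b f.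
Proof. by move=> f0; apply: Rintegral_ge0 => t; rewrite /= in_itv /= => /f0. Qed.

Lemma cont_on_cst a b (c : R) : cont_on a b (fun=> c).
Proof. by move=> t _; exact: cst_continuous. Qed.

Lemma cont_onD a b f g : cont_on a b f -> cont_on a b g ->
  cont_on a b (fun t => f t + g t).
Proof. by move=> cf cg t H; apply: cvgD; [exact: cf|exact: cg]. Qed.

Lemma cont_onM a b f g : cont_on a b f -> cont_on a b g ->
  cont_on a b (fun t => f t * g t).
Proof. by move=> cf cg t H; apply: cvgM; [exact: cf|exact: cg]. Qed.

Lemma cont_onN a b f : cont_on a b f -> cont_on a b (fun t => - f t).
Proof. by move=> cf t H; apply: cvgN; exact: cf. Qed.

Lemma cont_on_norm a b f : cont_on a b f -> cont_on a b (fun t => `|f t|).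
Proof. by move=> cf t H; apply: cvg_norm; exact: cf. Qed.

Lemma integ_norm_le a b f : cont_on a b f -> `|integ a b f| <= integ a b (fun t => `|f t|).
Proof. by move=> cf; apply: le_normr_Rintegral => //; exact: cont_on_integrable. Qed.

Lemma integ_bound a b f M : a <= b -> cont_on a b f ->
  (forall t, a <= t <= b -> `|f t| <= M) -> `|integ a b f| <= M * (b - a).
Proof.
move=> ab cf fM; rewrite (le_trans (integ_norm_le cf))// -integ_cst//.
by apply: integ_le => //; [exact: cont_on_norm|exact: cont_on_cst].
Qed.

Lemma integ_cat a b c f : a <= b -> b <= c -> cont_on a c f ->
  integ a c f = integ a b f + integ b c f.
Proof.
move=> ab bc cf; have If := cont_on_integrable cf.
rewrite /integ; apply/eqP; rewrite addrC -subr_eq; apply/eqP.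
rewrite (Rintegral_itvB If) ?bnd_simp//.
rewrite Rintegral_itv_obnd_cbnd//; apply: integrableS If => //.
by apply: subset_itv; rewrite bnd_simp.
Qed.

Lemma integ_FTC a b F f : a <= b -> (forall t, a <= t <= b -> is_derive t 1 F (f t)) ->
  cont_on a b f -> integ a b f = F b - F a.
Proof.
rewrite le_eqVlt => /predU1P[<- _ _|ab dF cf].
  by rewrite /integ set_itv1 Rintegral_set1 subrr.
have dF' t : t \in `]a, b[ -> is_derive t 1 F (f t).
  by rewrite in_itv /= => /andP[/ltW ? /ltW ?]; apply: dF; apply/andP.
have cF t : a <= t <= b -> {for t, continuous F}.
  by move=> /dF; exact: is_derive_continuous.
rewrite /integ /Rintegral (@continuous_FTC2 _ f F)//.
- exact: cont_on_within.
- split.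
  + by move=> t /dF'[].
  + by apply: cvg_at_right_filter; apply: cF; rewrite lexx ltW.
  + by apply: cvg_at_left_filter; apply: cF; rewrite lexx ltW.
- by move=> t /dF'[d1 <-]; rewrite derive1E.
Qed.

Lemma derive_bound a b F f M : a <= b -> (forall t, a <= t <= b -> is_derive t 1 F (f t)) ->
  (forall t, a <= t <= b -> `|f t| <= M) -> `|F b - F a| <= M * (b - a).
Proof.
move=> ab dF fM.
have dF' t : t \in `]a, b[ -> is_derive t 1 F (f t).
  by rewrite in_itv /= => /andP[/ltW ? /ltW ?]; apply: dF; apply/andP.
have cF : {within `[a, b], continuous F}.
  by apply: cont_on_within => t tab; exact: is_derive_continuous (dF t tab).
have [c + ->] := MVT_segment ab dF' cF.
rewrite in_itv /= => cab; rewrite normrM (ger0_norm (_ : 0 <= b - a)) ?subr_ge0//.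
by rewrite ler_wpM2r ?subr_ge0// fM.
Qed.

End real_calculus.

(** * Curves and their integrals *)

Section continuity.
Variable R : realType.
Local Notation C := R[i].

Section generic.
Variables (V : zmodType) (emb : V -> C).
Local Notation tc := (tcont emb).
Implicit Types f g : V -> C.

Lemma tcont_cst c z : tc (fun=> c) z.
Proof. by move=> e e0; exists 1 => // h _; rewrite subrr cmod0 ltW. Qed.

Lemma tcontD f g z : tc f z -> tc g z -> tc (fun x => f x + g x) z.
Proof.
move=> fc gc e e0; have e2 : 0 < e / 2 by rewrite divr_gt0.
have [k k0 H] := fc _ e2; have [k' k'0 H'] := gc _ e2.
exists (Num.min k k'); first by rewrite lt_min k0.
move=> h; rewrite lt_min => /andP[hk hk'].
have -> : f (z + h) + g (z + h) - (f z + g z) =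
  (f (z + h) - f z) + (g (z + h) - g z) by ring.
by rewrite (le_trans (cmodD _ _))// (splitr e) lerD ?H ?H'.
Qed.

Lemma tcontM f g z : tc f z -> tc g z -> tc (fun x => f x * g x) z.
Proof.
move=> fc gc e e0; have [k1 k10 B] := tcont_bound gc.
have G0 : 0 < cmod (g z) + 1 by rewrite ltr_wpDl ?cmod_ge0.
have F0 : 0 < cmod (f z) + 1 by rewrite ltr_wpDl ?cmod_ge0.
have [k2 k20 H2] := fc (e / 2 / (cmod (g z) + 1)) ltac:(by rewrite !divr_gt0).
have [k3 k30 H3] := gc (e / 2 / (cmod (f z) + 1)) ltac:(by rewrite !divr_gt0).
exists (Num.min k1 (Num.min k2 k3)); first by rewrite !lt_min k10 k20.
move=> h; rewrite !lt_min => /and3P[h1 h2 h3].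
have -> : f (z + h) * g (z + h) - f z * g z =
  (f (z + h) - f z) * g (z + h) + f z * (g (z + h) - g z) by ring.
rewrite (le_trans (cmodD _ _))// !cmodM (splitr e) lerD//.
  rewrite (le_trans (ler_pM (cmod_ge0 _) (cmod_ge0 _) (H2 _ h2) (B _ h1)))//.
  by rewrite divfK ?gt_eqF.
rewrite (le_trans (ler_wpM2l (cmod_ge0 _) (H3 _ h3)))//.
by rewrite mulrCA ler_piMr ?divr_ge0 ?ltW// ltr_pdivrMr// mul1r ltrDl.
Qed.

Lemma tcontN f z : tc f z -> tc (fun x => - f x) z.
Proof.
move=> /(tcontM (@tcont_cst (-1) z)); congr tcont.
by apply/funext => x; rewrite mulN1r.
Qed.

Lemma tcontB f g z : tc f z -> tc g z -> tc (fun x => f x - g x) z.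
Proof. by move=> fc gc; apply: tcontD => //; apply: tcontN. Qed.

Lemma tcont_comp (f : C -> C) g z : ccont f (g z) -> tc g z -> tc (fun x => f (g x)) z.
Proof.
move=> fc gc e e0; have [k k0 H] := fc _ e0.
have [k' k'0 H'] := gc (k / 2) ltac:(by rewrite divr_gt0).
exists k' => // h hk; have -> : g (z + h) = g z + (g (z + h) - g z) by ring.
by apply: H; rewrite (le_lt_trans (H' _ hk))// ltr_pdivrMr// ltr_pMr// ltr1n.
Qed.

Lemma tcont_conj f z : tc f z -> tc (fun x => (conjc (f x))) z.
Proof.
move=> fc e e0; have [k k0 H] := fc _ e0; exists k => // h hk.
by rewrite -rmorphB cmodJ; exact: H.
Qed.

End generic.

Lemma rcont_Re (g : R -> C) t : rcont g t -> {for t, continuous (fun s => complex.Re (g s))}.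
Proof.
move=> gc; apply/continuous_epsP => e e0; have [k k0 H] := gc _ e0.
exists k => // h hk; rewrite -cReN -cReD (le_trans (Re_le_cmod _))//.
by apply: H; rewrite cmodR.
Qed.

Lemma rcont_Im (g : R -> C) t : rcont g t -> {for t, continuous (fun s => complex.Im (g s))}.
Proof.
move=> gc; apply/continuous_epsP => e e0; have [k k0 H] := gc _ e0.
exists k => // h hk; rewrite -cImN -cImD (le_trans (Im_le_cmod _))//.
by apply: H; rewrite cmodR.
Qed.

Lemma rcont_real (g : R -> R) t : {for t, continuous g} -> rcont (fun s => (g s)%:C) t.
Proof.
move=> /continuous_epsP gc e e0; have [k k0 H] := gc _ e0.
by exists k => // h hk; rewrite -rmorphB cmodR; apply: H; rewrite -cmodR.
Qed.

Lemma rdiff_Re (g : R -> C) t d : rdiff g t d ->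
  is_derive t 1 (fun s => complex.Re (g s)) (complex.Re d).
Proof.
move=> gd; apply/is_derive_epsP => e e0; have [k k0 H] := gd _ e0.
exists k => // h hk; have := H h; rewrite cmodR => /(_ hk); apply: le_trans.
by rewrite (le_trans _ (Re_le_cmod _))// !(cReD, cReN, cReM) /= mulr0 subr0.
Qed.

Lemma rdiff_Im (g : R -> C) t d : rdiff g t d ->
  is_derive t 1 (fun s => complex.Im (g s)) (complex.Im d).
Proof.
move=> gd; apply/is_derive_epsP => e e0; have [k k0 H] := gd _ e0.
exists k => // h hk; have := H h; rewrite cmodR => /(_ hk); apply: le_trans.
by rewrite (le_trans _ (Im_le_cmod _))// !(cImD, cImN, cImM) /= mulr0 add0r.
Qed.

Lemma rdiff_mk (a b : R -> R) (t da db : R) : is_derive t 1 a da -> is_derive t 1 b db ->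
  rdiff (fun s => a s +i* b s) t (da +i* db).
Proof.
move=> /is_derive_epsP ad /is_derive_epsP bd e e0.
have e2 : 0 < e / 2 by rewrite divr_gt0.
have [k k0 H] := ad _ e2; have [k' k'0 H'] := bd _ e2.
exists (Num.min k k'); first by rewrite lt_min k0.
move=> h; rewrite cmodR lt_min => /andP[hk hk'].
rewrite (le_trans (cmod_le_ReIm _))// !(cReD, cReN, cReM, cImD, cImN, cImM) /=.
by rewrite mulr0 subr0 mulr0 add0r (splitr e) mulrDl lerD ?H ?H'.
Qed.

Lemma rdiff_real (a : R -> R) (t da : R) : is_derive t 1 a da ->
  rdiff (fun s => (a s)%:C) t da%:C.
Proof. by move=> ad; apply: rdiff_mk => //; exact: is_derive_cst. Qed.

Lemma rdiff_id t : rdiff (fun s : R => s%:C) t 1.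
Proof. by apply: tdiff_emb => x y; rewrite rmorphD. Qed.

(** The mean value theorem fails for complex values; it is applied to the real and the imaginary
    part, whence the factor 2. *)
Lemma rdiff_mean (g g' : R -> C) (a b M : R) : a <= b ->
  (forall t, a <= t <= b -> rdiff g t (g' t)) ->
  (forall t, a <= t <= b -> cmod (g' t) <= M) ->
  cmod (g b - g a) <= 2 * M * (b - a).
Proof.
move=> ab gd gM; rewrite (le_trans (cmod_le_ReIm _))// !(cReD, cReN, cImD, cImN).
rewrite mulrAC mulr_natl mulr2n mulrC mulrDr; apply: lerD.
  apply: (derive_bound (F := fun t => complex.Re (g t)) (f := fun t => complex.Re (g' t)) ab) => t tab.
    by apply: rdiff_Re; exact: gd.
  by rewrite (le_trans (Re_le_cmod _)) ?gM.
apply: (derive_bound (F := fun t => complex.Im (g t)) (f := fun t => complex.Im (g' t)) ab) => t tab.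
  by apply: rdiff_Im; exact: gd.
by rewrite (le_trans (Im_le_cmod _)) ?gM.
Qed.

Lemma rdiff_constant (g : R -> C) (a b : R) : a <= b ->
  (forall t, a <= t <= b -> rdiff g t 0) -> g b = g a.
Proof.
move=> ab gd; apply/eqP; rewrite -subr_eq0; apply/eqP/cmod_le0.
rewrite (le_trans (rdiff_mean (M := 0) ab gd _)) ?mulr0 ?mul0r//.
by move=> t _; rewrite cmod0.
Qed.

End continuity.

Section complex_integral.
Variable R : realType.
Local Notation C := R[i].
Implicit Types (g : R -> C) (a b : R).

Definition cint a b g : C :=
  integ a b (fun t => complex.Re (g t)) +i* integ a b (fun t => complex.Im (g t)).

Definition ccont_on a b g := forall t, a <= t <= b -> rcont g t.

Lemma ccont_onW a b c d g : a <= c -> d <= b -> ccont_on a b g -> ccont_on c d g.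
Proof.
move=> ac db H t /andP[ct td]; apply: H.
by rewrite (le_trans ac ct) (le_trans td db).
Qed.

Lemma ccont_on_Re a b g : ccont_on a b g -> cont_on a b (fun t => complex.Re (g t)).
Proof. by move=> gc t /gc; exact: rcont_Re. Qed.

Lemma ccont_on_Im a b g : ccont_on a b g -> cont_on a b (fun t => complex.Im (g t)).
Proof. by move=> gc t /gc; exact: rcont_Im. Qed.

Lemma eq_cint a b g g' : (forall t, a <= t <= b -> g t = g' t) -> cint a b g = cint a b g'.
Proof. by move=> gg; congr (_ +i* _); apply: eq_integ => t /gg ->. Qed.

Lemma cintD a b g g' : ccont_on a b g -> ccont_on a b g' ->
  cint a b (fun t => g t + g' t) = cint a b g + cint a b g'.
Proof.
move=> cg cg'; rewrite /cint; simpc; congr (_ +i* _).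
  rewrite -integD; [|exact: ccont_on_Re..].
  by apply: eq_integ => t _; rewrite cReD.
rewrite -integD; [|exact: ccont_on_Im..].
by apply: eq_integ => t _; rewrite cImD.
Qed.

Lemma cintZ a b c g : ccont_on a b g -> cint a b (fun t => c * g t) = c * cint a b g.
Proof.
move=> cg; have cR := ccont_on_Re cg; have cI := ccont_on_Im cg.
have cZ x (h : R -> R) : cont_on a b h -> cont_on a b (fun t => x * h t).
  by move=> ch; apply: cont_onM => //; exact: cont_on_cst.
rewrite {2}/cint; case: c => x y; simpc; rewrite -mulNr /cint.
rewrite -(integZ x cR) -(integZ (- y) cI) -(integZ x cI) -(integZ y cR).
congr (_ +i* _); rewrite -integD; try exact: cZ.
  by apply: eq_integ => t _; rewrite cReM /=; ring.
by apply: eq_integ => t _; rewrite cImM /=; ring.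
Qed.

Lemma cintN a b g : ccont_on a b g -> cint a b (fun t => - g t) = - cint a b g.
Proof.
by move=> cg; rewrite -mulN1r -cintZ//; apply: eq_cint => t _; rewrite mulN1r.
Qed.

Lemma cintB a b g g' : ccont_on a b g -> ccont_on a b g' ->
  cint a b (fun t => g t - g' t) = cint a b g - cint a b g'.
Proof.
move=> cg cg'; rewrite cintD ?cintN// => t tab; apply: tcontN; exact: cg'.
Qed.

Lemma cint_cst a b c : a <= b -> cint a b (fun=> c) = c * (b - a)%:C.
Proof. by move=> ab; rewrite /cint !integ_cst//; case: c => x y; simpc. Qed.

Lemma cint_conj a b g : ccont_on a b g -> cint a b (fun t => (conjc (g t))) = (conjc (cint a b g)).
Proof.
move=> cg; rewrite /cint /=; congr (_ +i* _).
  by apply: eq_integ => t _; case: (g t).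
rewrite -mulN1r -integZ; last exact: ccont_on_Im.
by apply: eq_integ => t _; case: (g t) => ? ?; rewrite /= mulN1r.
Qed.

Lemma cmod_cint_le a b g (phi : R -> R) : ccont_on a b g -> cont_on a b phi ->
  (forall t, a <= t <= b -> cmod (g t) <= phi t) ->
  cmod (cint a b g) <= 2 * integ a b phi.
Proof.
move=> cg cphi gphi; rewrite (le_trans (cmod_le_ReIm _))//= mulr_natl mulr2n.
apply: lerD.
  rewrite (le_trans (integ_norm_le (ccont_on_Re cg)))//; apply: integ_le => //.
    exact: cont_on_norm (ccont_on_Re cg).
  by move=> t tab; rewrite (le_trans (Re_le_cmod _)) ?gphi.
rewrite (le_trans (integ_norm_le (ccont_on_Im cg)))//; apply: integ_le => //.
  exact: cont_on_norm (ccont_on_Im cg).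
by move=> t tab; rewrite (le_trans (Im_le_cmod _)) ?gphi.
Qed.

Lemma cint_bound a b g M : a <= b -> ccont_on a b g ->
  (forall t, a <= t <= b -> cmod (g t) <= M) -> cmod (cint a b g) <= 2 * M * (b - a).
Proof.
move=> ab cg gM; rewrite (le_trans (cmod_cint_le cg (@cont_on_cst _ a b M) gM))//.
by rewrite integ_cst// mulrA.
Qed.

Lemma cint_cat a b c g : a <= b -> b <= c -> ccont_on a c g ->
  cint a c g = cint a b g + cint b c g.
Proof.
move=> ab bc cg; rewrite /cint; simpc; congr (_ +i* _); apply: integ_cat => //.
  exact: ccont_on_Re.
exact: ccont_on_Im.
Qed.

Lemma cint_FTC a b G g : a <= b -> (forall t, a <= t <= b -> rdiff G t (g t)) ->
  ccont_on a b g -> cint a b g = G b - G a.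
Proof.
move=> ab dG cg; rewrite /cint.
rewrite (integ_FTC (F := fun t => complex.Re (G t)) ab _ (ccont_on_Re cg)).
  rewrite (integ_FTC (F := fun t => complex.Im (G t)) ab _ (ccont_on_Im cg)).
    by case: (G b) (G a) => [? ?] [? ?].
  by move=> t tab; apply: rdiff_Im; exact: dG.
by move=> t tab; apply: rdiff_Re; exact: dG.
Qed.

End complex_integral.

Section exponential_derivative.
Variable R : realType.
Local Notation C := R[i].

Lemma rdiff_expi (t : R) : rdiff (@expi R) t (ii * expi t).
Proof.
have -> : ii * expi t = (- sin t) +i* cos t by rewrite /expi; simpc.
exact: rdiff_mk.
Qed.

(** On the ray through [z] the modulus and the argument of the exponential are elementary real
    functions, so real derivatives suffice here. *)
Lemma rdiff_cexp_line (z : C) (t : R) :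
  rdiff (fun s : R => cexp (s%:C * z)) t (z * cexp (t%:C * z)).
Proof.
have E (s : R) : cexp (s%:C * z) =
    (expR (s * complex.Re z))%:C * expi (s * complex.Im z).
  by rewrite /cexp cReM cImM /= !mul0r subr0 addr0.
have -> : (fun s : R => cexp (s%:C * z)) =
  (fun s => (expR (s * complex.Re z))%:C * expi (s * complex.Im z)).
  by apply/funext => s; exact: E.
have lin (c : R) : is_derive t 1 (fun s : R => s * c) c.
  by apply: is_derive_eq; rewrite /GRing.scale /= mulr0 add0r mulr1.
have D1 : rdiff (fun s => (expR (s * complex.Re z))%:C) t
    (expR (t * complex.Re z) * complex.Re z)%:C.
  apply: rdiff_real; exact: (is_derive1_comp (is_derive_expR _) (lin _)).
have D2 : rdiff (fun s => expi (s * complex.Im z)) t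
    (ii * expi (t * complex.Im z) * (complex.Im z)%:C).
  rewrite /expi; have -> : ii * (cos (t * complex.Im z) +i* sin (t * complex.Im z)) *
    (complex.Im z)%:C = (- sin (t * complex.Im z) * complex.Im z) +i*
      (cos (t * complex.Im z) * complex.Im z) by simpc.
  exact: (rdiff_mk (is_derive1_comp (is_derive_cos _) (lin (complex.Im z)))
    (is_derive1_comp (is_derive_sin _) (lin (complex.Im z)))).
have := tdiffM D1 D2; congr tdiff; rewrite E [X in _ = X * _](complexE z) rmorphM /=; ring.
Qed.

Lemma cexpB1_bound (z : C) : cmod (cexp z - 1) <= 2 * cmod z * expR (cmod z).
Proof.
have := @rdiff_mean _ (fun s : R => cexp (s%:C * z)) (fun t => z * cexp (t%:C * z)) 0 1
  (cmod z * expR (cmod z)) ler01 (fun t _ => rdiff_cexp_line z t).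
rewrite mul1r mul0r cexp0 subr0 mulr1 mulrA; apply => t /andP[t0 t1].
rewrite cmodM ler_wpM2l ?cmod_ge0// cmod_cexp ler_expR cReM /= mul0r subr0.
rewrite (le_trans (ler_norm _))// normrM (ger0_norm t0).
by rewrite (le_trans (ler_piMl _ t1))// ?Re_le_cmod.
Qed.

Lemma cexpB1z_bound (z : C) : cmod (cexp z - 1 - z) <= 4 * cmod z ^+ 2 * expR (cmod z).
Proof.
have D t : 0 <= t <= 1 -> rdiff (fun s : R => cexp (s%:C * z) - s%:C * z) t
    (z * cexp (t%:C * z) - 1 * z).
  move=> _; apply: tdiffB; first exact: rdiff_cexp_line.
  have := tdiffM (@rdiff_id R t) (@tdiff_cst _ _ (real_complex R) z t).
  by rewrite mulr0 addr0.
have -> : cexp z - 1 - z = (cexp (1%:C * z) - 1%:C * z) - (cexp (0%:C * z) - 0%:C * z).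
  by rewrite !mul1r !mul0r cexp0; ring.
have -> : 4 * cmod z ^+ 2 * expR (cmod z) =
  2 * (2 * cmod z ^+ 2 * expR (cmod z)) * (1 - 0) by ring.
apply: (rdiff_mean ler01 D) => t /andP[t0 t1].
have -> : z * cexp (t%:C * z) - 1 * z = z * (cexp (t%:C * z) - 1) by ring.
have tz : cmod (t%:C * z) <= cmod z.
  by rewrite cmodM cmodR (ger0_norm t0) ler_piMl ?cmod_ge0.
rewrite cmodM expr2 mulrA -!mulrA mulrCA ler_wpM2l ?cmod_ge0//.
rewrite (le_trans (cexpB1_bound _))// mulrA ler_pM ?mulr_ge0 ?expR_ge0 ?cmod_ge0//.
  by rewrite ler_wpM2l.
by rewrite ler_expR.
Qed.

(** By the addition formula only the increment at 0 matters, and [cexpB1z_bound] makes it quadratic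
    in [h]. *)
Lemma cdiff_cexp (z : C) : cdiff (@cexp R) z (cexp z).
Proof.
move=> e e0; set B := cmod (cexp z) * 4 * expR 1.
have B0 : 0 < B by rewrite !mulr_gt0 ?expR_gt0 ?cmod_gt0 ?cexp_neq0.
exists (Num.min 1 (e / B)); first by rewrite lt_min ltr01 divr_gt0.
move=> h; rewrite lt_min => /andP[h1 he].
have -> : cexp (z + h) - cexp z - cexp z * h = cexp z * (cexp h - 1 - h).
  by rewrite cexpD; ring.
rewrite cmodM (le_trans (ler_wpM2l (cmod_ge0 _) (cexpB1z_bound _)))//.
rewrite (@le_trans _ _ (B * cmod h * cmod h))//.
  rewrite /B expr2.
  have -> : cmod (cexp z) * (4 * (cmod h * cmod h) * expR (cmod h)) =
    (cmod (cexp z) * 4 * (cmod h * cmod h)) * expR (cmod h) by ring.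
  have -> : cmod (cexp z) * 4 * expR 1 * cmod h * cmod h =
    (cmod (cexp z) * 4 * (cmod h * cmod h)) * expR 1 by ring.
  by rewrite ler_wpM2l ?mulr_ge0 ?cmod_ge0// ler_expR ltW.
by rewrite ler_wpM2r ?cmod_ge0// mulrC -ler_pdivlMr// ltW.
Qed.

End exponential_derivative.

(** * Cauchy's theorem on a cone *)

Section bisection.
Variable R : realType.
Local Notation rect := (R * R * (R * R))%type.

(** Goursat's bisection freed from integrals: if [Q] failed, it would fail on nested rectangles
    shrinking to a point (p, q), where the local hypothesis contradicts it. Degenerate rectangles
    are allowed. *)
Lemma rectangle_bisection (Q : R -> R -> R -> R -> Prop) (A B C D : R) :
  A <= B -> C <= D ->
  (forall a b c d, A <= a -> a <= b -> b <= B -> C <= c -> c <= d -> d <= D ->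
    let m := (a + b) / 2 in let n := (c + d) / 2 in
    Q a m c n -> Q m b c n -> Q a m n d -> Q m b n d -> Q a b c d) ->
  (forall p q, A <= p <= B -> C <= q <= D -> exists2 k, 0 < k &
    forall a b c d, A <= a -> b <= B -> C <= c -> d <= D ->
    a <= p <= b -> c <= q <= d -> b - a < k -> d - c < k -> Q a b c d) ->
  Q A B C D.
Proof.
move=> AB CD glue loc; apply: contrapT => nQ.
pose ok (x : rect) := [/\ A <= x.1.1, x.1.1 <= x.1.2, x.1.2 <= B &
  [/\ C <= x.2.1, x.2.1 <= x.2.2, x.2.2 <= D &
    ~ Q x.1.1 x.1.2 x.2.1 x.2.2]].
pose child (x y : rect) := [/\ x.1.1 <= y.1.1, y.1.2 <= x.1.2,
  x.2.1 <= y.2.1, y.2.2 <= x.2.2 &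
  (y.1.2 - y.1.1 = (x.1.2 - x.1.1) / 2) /\ (y.2.2 - y.2.1 = (x.2.2 - x.2.1) / 2)].
(* Dependent choice wants a total successor, so a rectangle that is not [ok] is sent to itself. *)
have step (x : rect) : {y | ok x -> ok y /\ child x y}.
  apply: cid; have [okx|] := pselect (ok x); last by exists x.
  case: x okx => [[a b] [c d]] [/= Aa ab bB [Cc cd dD nq]].
  set m := (a + b) / 2; set n := (c + d) / 2.
  have [am mb cn nd] : [/\ a <= m, m <= b, c <= n & n <= d].
    by rewrite /m /n; split; lra.
  have hm : m - a = (b - a) / 2 by rewrite /m; field.
  have hm' : b - m = (b - a) / 2 by rewrite /m; field.
  have hn : n - c = (d - c) / 2 by rewrite /n; field.
  have hn' : d - n = (d - c) / 2 by rewrite /n; field.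
  have cases : ~ [/\ Q a m c n, Q m b c n, Q a m n d & Q m b n d].
    by case=> *; apply: nq; apply: glue.
  have [q1|q1] := pselect (Q a m c n); last first.
    by exists (a, m, (c, n)) => _; split; split => //=; try split => //; lra.
  have [q2|q2] := pselect (Q m b c n); last first.
    by exists (m, b, (c, n)) => _; split; split => //=; try split => //; lra.
  have [q3|q3] := pselect (Q a m n d); last first.
    by exists (a, m, (n, d)) => _; split; split => //=; try split => //; lra.
  have [q4|q4] := pselect (Q m b n d); last first.
    by exists (m, b, (n, d)) => _; split; split => //=; try split => //; lra.
  by exfalso; apply: cases.
have [s [s0 sS]] := dependent_choice step (A, B, (C, D)).
have oks n : ok (s n).
  elim: n => [|n IH]; last by have [] := sS n IH.
  by rewrite s0; split => //=.
have chs n : child (s n) (s n.+1) by have [] := sS n (oks n).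
have mon n k : [/\ (s n).1.1 <= (s (n + k)%N).1.1, (s (n + k)%N).1.2 <= (s n).1.2,
    (s n).2.1 <= (s (n + k)%N).2.1 & (s (n + k)%N).2.2 <= (s n).2.2].
  elim: k => [|k [h1 h2 h3 h4]]; first by rewrite addn0.
  rewrite addnS; have [g1 g2 g3 g4 _] := chs (n + k)%N.
  by split; [exact: le_trans g1|exact: le_trans h2|exact: le_trans g3|exact: le_trans h4].
have cross n m : (s n).1.1 <= (s m).1.2 /\ (s n).2.1 <= (s m).2.2.
  have [h1 _ h3 _] := mon n m; have [_ h2 _ h4] := mon m n.
  have [_ k1 _ [_ k2 _ _]] := oks (n + m)%N.
  rewrite addnC in h2 h4; split.
    exact: le_trans h1 (le_trans k1 h2).
  exact: le_trans h3 (le_trans k2 h4).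
have size n : (s n).1.2 - (s n).1.1 = (B - A) / 2 ^+ n /\
    (s n).2.2 - (s n).2.1 = (D - C) / 2 ^+ n.
  elim: n => [|n [h1 h2]]; first by rewrite s0 expr0 !divr1.
  have [_ _ _ _ [-> ->]] := chs n; rewrite h1 h2 exprS.
  have n0 : (2 : R) ^+ n != 0 by rewrite expf_neq0.
  by split; field.
pose p := sup (range (fun n => (s n).1.1)); pose q := sup (range (fun n => (s n).2.1)).
have pn n : (s n).1.1 <= p <= (s n).1.2.
  apply/andP; split.
    apply: ub_le_sup; last by exists n.
    by exists (s 0%N).1.2 => _ [m _ <-]; have [] := cross m 0%N.
  by apply: ge_sup; [exists (s 0%N).1.1; exists 0%N|move=> _ [m _ <-]; have [] := cross m n].
have qn n : (s n).2.1 <= q <= (s n).2.2.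
  apply/andP; split.
    apply: ub_le_sup; last by exists n.
    by exists (s 0%N).2.2 => _ [m _ <-]; have [] := cross m 0%N.
  by apply: ge_sup; [exists (s 0%N).2.1; exists 0%N|move=> _ [m _ <-]; have [] := cross m n].
have [k k0 H] : exists2 k, 0 < k & forall a b c d, A <= a -> b <= B -> C <= c -> d <= D ->
    a <= p <= b -> c <= q <= d -> b - a < k -> d - c < k -> Q a b c d.
  by apply: loc; [have := pn 0%N|have := qn 0%N]; rewrite s0.
(* The sides after [n] halvings are (B - A) / 2^n and (D - C) / 2^n; this [n] makes both smaller
   than [k]. *)
pose n := Num.bound (((B - A) + (D - C)) / k).
have hn : (B - A) + (D - C) < k * 2 ^+ n.
  by rewrite -ltr_pdivrMl// mulrC upper_nthrootP.
have [Aa _ bB [Cc _ dD]] := oks n; apply; apply: H => //.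
  by rewrite (size n).1 ltr_pdivrMr ?exprn_gt0//; lra.
by rewrite (size n).2 ltr_pdivrMr ?exprn_gt0//; lra.
Qed.

Lemma midpoint_itv (x y : R) : x <= y -> x <= (x + y) / 2 <= y.
Proof. by move=> xy; apply/andP; split; lra. Qed.

End bisection.

Section goursat.
Variable R : realType.
Local Notation C := R[i].
Variables (f : C -> C) (w : C) (e e' : R -> C) (A B S T K : R).
Hypotheses (A0 : 0 <= A) (AB : A <= B) (B1 : B <= 1) (ST : S <= T).
Hypothesis ed : forall t, S <= t <= T -> rdiff e t (e' t).
Hypothesis e'c : forall t, S <= t <= T -> rcont e' t.
Hypothesis e'K : forall t, S <= t <= T -> cmod (e' t) <= K.
Hypothesis ewK : forall t, S <= t <= T -> cmod (e t - w) <= K.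
(** Cone with apex [w] over the curve [e]. Over a circle it yields the integral theorem around [w];
    over a segment, with apex 0, it yields primitives on a star-shaped set. Only differentiability
    of [f] on the image is used, not continuity of the derivative. *)
Let gam (l t : R) : C := w + l%:C * (e t - w).
Hypothesis fd : forall l t, A <= l <= B -> S <= t <= T -> exists d, cdiff f (gam l t) d.

Lemma K_ge0 : 0 <= K.
Proof. by rewrite (le_trans (cmod_ge0 (e' S)))// e'K// lexx. Qed.

Lemma gam_dl l t : S <= t <= T -> rdiff (gam^~ t) l (e t - w).
Proof.
move=> _; rewrite /gam.
have := tdiffD (@tdiff_cst _ _ (real_complex R) w l)
  (tdiffM (@rdiff_id R l) (@tdiff_cst _ _ (real_complex R) (e t - w) l)).
by rewrite mulr0 addr0 add0r mul1r.
Qed.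

Lemma gam_dt l t : S <= t <= T -> rdiff (gam l) t (l%:C * e' t).
Proof.
move=> tST; rewrite /gam.
have := tdiffD (@tdiff_cst _ _ (real_complex R) w t)
  (tdiffZ l%:C (tdiffB (ed tST) (@tdiff_cst _ _ (real_complex R) w t))).
by rewrite subr0 add0r.
Qed.

Let hseg a b t := cint a b (fun l => f (gam l t) * (e t - w)).
Let vseg c d l := cint c d (fun t => f (gam l t) * (l%:C * e' t)).

Lemma fgam_cl t l : A <= l <= B -> S <= t <= T -> rcont (fun l => f (gam l t)) l.
Proof.
move=> lAB tST; have [d /tdiff_cont fc] := fd lAB tST.
exact: (tcont_comp (g := gam^~ t) fc (tdiff_cont (gam_dl l tST))).
Qed.

Lemma fgam_ct t l : A <= l <= B -> S <= t <= T -> rcont (fun t => f (gam l t)) t.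
Proof.
move=> lAB tST; have [d /tdiff_cont fc] := fd lAB tST.
exact: (tcont_comp (g := gam l) fc (tdiff_cont (gam_dt l tST))).
Qed.

Lemma hseg_c t : S <= t <= T -> ccont_on A B (fun l => f (gam l t) * (e t - w)).
Proof.
by move=> tST l lAB; apply: tcontM; [exact: fgam_cl|exact: tcont_cst].
Qed.

Lemma vseg_c l : A <= l <= B -> ccont_on S T (fun t => f (gam l t) * (l%:C * e' t)).
Proof.
move=> lAB t tST; apply: tcontM; first exact: fgam_ct.
by apply: tcontM; [exact: tcont_cst|exact: e'c].
Qed.

(** The integral of f(z) dz along the image of the boundary of [a, b] x [c, d], run through
    counterclockwise in the parameter plane. *)
Let Phi a b c d := hseg a b c + vseg c d b - hseg a b d - vseg c d a.

Lemma PhiD a m b c n d : A <= a -> a <= m -> m <= b -> b <= B ->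
  S <= c -> c <= n -> n <= d -> d <= T ->
  Phi a b c d = Phi a m c n + Phi m b c n + Phi a m n d + Phi m b n d.
Proof.
move=> Aa am mb bB Sc cn nd dT.
have H t : S <= t <= T -> hseg a b t = hseg a m t + hseg m b t.
  by move=> /hseg_c h; apply: cint_cat => //; exact: ccont_onW h.
have V l : A <= l <= B -> vseg c d l = vseg c n l + vseg n d l.
  by move=> /vseg_c h; apply: cint_cat => //; exact: ccont_onW h.
have cT : c <= T := le_trans cn (le_trans nd dT).
have Sd : S <= d := le_trans Sc (le_trans cn nd).
have aB : a <= B := le_trans am (le_trans mb bB).
have Ab : A <= b := le_trans Aa (le_trans am mb).
rewrite /Phi (H c) ?(H d) ?(V a) ?(V b); first by ring.
all: exact/andP.
Qed.

Let G d z0 z := f z0 * z + d * (z - z0) ^+ 2 / 2%:R.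

(* Along each side f is compared with its affine part at z0, which has the
   primitive [G]. *)
Lemma edge_estimate (g g' : R -> C) a b z0 d M : a <= b ->
  (forall t, a <= t <= b -> rdiff g t (g' t)) ->
  (forall t, a <= t <= b -> rcont g' t) ->
  (forall t, a <= t <= b -> rcont (fun t => f (g t)) t) ->
  (forall t, a <= t <= b -> cmod (f (g t) - f z0 - d * (g t - z0)) * cmod (g' t) <= M) ->
  cmod (cint a b (fun t => f (g t) * g' t) - (G d z0 (g b) - G d z0 (g a))) <= 2 * M * (b - a).
Proof.
move=> ab gd g'c fgc HM.
have gc t : a <= t <= b -> rcont g t by move=> /gd /tdiff_cont.
pose aff t := (f z0 + d * (g t - z0)) * g' t.
have affc : ccont_on a b aff.
  move=> t tab; apply: tcontM; last exact: g'c.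
  apply: tcontD; first exact: tcont_cst.
  apply: tcontM; first exact: tcont_cst.
  by apply: tcontB; [exact: gc|exact: tcont_cst].
have Gd t : a <= t <= b -> rdiff (fun t => G d z0 (g t)) t (aff t).
  move=> tab; have gt := gd _ tab.
  have D1 := tdiffZ (f z0) gt.
  have D2 := tdiffZ (d / 2%:R)
    (tdiffX 2 (tdiffB gt (@tdiff_cst _ _ (real_complex R) z0 t))).
  have := tdiffD D1 D2; rewrite subr0 /= expr1.
  have -> : f z0 * g' t + d / 2%:R * (2%:R * (g t - z0) * g' t) = aff t.
    by rewrite /aff; field.
  by congr tdiff; apply/funext => s; rewrite /G; ring.
have fc : ccont_on a b (fun t => f (g t) * g' t).
  by move=> t tab; apply: tcontM; [exact: fgc|exact: g'c].
rewrite -(cint_FTC ab Gd affc) -cintB//; apply: cint_bound => //.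
  by move=> t tab; apply: tcontB; [exact: fc|exact: affc].
move=> t tab; have -> : f (g t) * g' t - aff t =
  (f (g t) - f z0 - d * (g t - z0)) * g' t by rewrite /aff; ring.
by rewrite cmodM; exact: HM.
Qed.

Lemma gam_dist p q l t a b c d : A <= a -> b <= B -> S <= c -> d <= T ->
  a <= p <= b -> c <= q <= d -> a <= l <= b -> c <= t <= d ->
  cmod (gam l t - gam p q) <= 2 * K * ((b - a) + (d - c)).
Proof.
move=> Aa bB Sc dT pab qcd lab tcd.
have tST : S <= t <= T by apply/andP; split; lra.
have qST : S <= q <= T by apply/andP; split; lra.
have -> : gam l t - gam p q = (l - p)%:C * (e t - w) + p%:C * (e t - e q).
  by rewrite /gam rmorphB /=; ring.
have lp : `|l - p| <= b - a by rewrite ler_norml; apply/andP; split; lra.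
have p1 : `|p| <= 1.
  have [ap pb] := andP pab; rewrite ger0_norm; last exact: le_trans A0 (le_trans Aa ap).
  exact: le_trans pb (le_trans bB B1).
have eL : cmod (e t - e q) <= 2 * K * (d - c).
  wlog qt : q t {p1 lp pab lab} qcd tcd tST qST / q <= t.
    move=> W; have [|/ltW] := leP q t; first exact: W.
    by rewrite cmodBC; exact: W.
  have sub s : q <= s <= t -> S <= s <= T by move=> ?; apply/andP; split; lra.
  have := rdiff_mean qt (fun s h => ed (sub s h)) (fun s h => e'K (sub s h)).
  move=> /le_trans; apply; apply: ler_wpM2l; last by lra.
  by rewrite mulr_ge0// K_ge0.
rewrite (le_trans (cmodD _ _))// !cmodM !cmodR.
have X := ler_pM (normr_ge0 _) (cmod_ge0 _) lp (ewK tST).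
have Y := ler_pM (normr_ge0 _) (cmod_ge0 _) p1 eL.
have Kb : 0 <= K * (b - a) by rewrite mulr_ge0 ?K_ge0//; lra.
by rewrite (le_trans (lerD X Y))//; lra.
Qed.

(** The boundary integral is additive under bisection, and near a point of differentiability it is
    o(s^2) with s the half perimeter, because the affine part has a primitive and contributes
    nothing around the closed boundary. *)
Lemma goursat_rectangle : Phi A B S T = 0.
Proof.
have Sz0 : 0 <= ((B - A) + (T - S)) ^+ 2 by rewrite sqr_ge0.
apply: (cmod_small Sz0) => ep ep0.
pose Q a b c d := cmod (Phi a b c d) <= ep * ((b - a) + (d - c)) ^+ 2.
suff : Q A B S T by [].
apply: (rectangle_bisection (Q := Q)) => // [a b c d Aa ab bB Sc cd dT m n|p q pAB qST].
  rewrite /Q => q1 q2 q3 q4.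
  have [/andP[am mb] /andP[cn nd]] := (midpoint_itv ab, midpoint_itv cd).
  rewrite (PhiD Aa am mb bB Sc cn nd dT).
  rewrite (le_trans (cmodD _ _))// (le_trans (lerD (cmodD _ _) (lexx _)))//.
  rewrite (le_trans (lerD (lerD (cmodD _ _) (lexx _)) (lexx _)))//.
  rewrite (le_trans (lerD (lerD (lerD q1 q2) q3) q4))// le_eqVlt; apply/orP; left.
  by apply/eqP; rewrite /m /n; field.
have [d0 fd0] := fd pAB qST; set z0 := gam p q in fd0.
have K1 : 0 < K + 1 by rewrite ltr_wpDl ?K_ge0.
(* Points of the small cell are within 2(K + 1)s of [z0], so the remainder is at most ep s / (8(K +
   1)); the four sides together then give ep s^2 / 2. *)
have ep1 : 0 < ep / (16 * (K + 1) ^+ 2) by rewrite divr_gt0// mulr_gt0 ?exprn_gt0.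
have [k k0 Hk] := fd0 _ ep1.
exists (k / (4 * (K + 1))); first by rewrite divr_gt0 ?mulr_gt0.
move=> a b c d Aa bB Sc dT pab qcd; rewrite !ltr_pdivlMr ?mulr_gt0// => bak dck.
set s := (b - a) + (d - c).
have s0 : 0 <= s by rewrite /s; lra.
have sk : 2 * (K + 1) * s < k by rewrite /s; lra.
have rem l t : a <= l <= b -> c <= t <= d ->
    cmod (f (gam l t) - f z0 - d0 * (gam l t - z0)) <= ep / (8 * (K + 1)) * s.
  move=> lab tcd; have gd := gam_dist Aa bB Sc dT pab qcd lab tcd.
  rewrite -/s -/z0 in gd.
  have K2 : cmod (gam l t - z0) <= 2 * (K + 1) * s.
    by rewrite (le_trans gd)// ler_wpM2r// ler_pM2l// lerDl.
  have := Hk _ (le_lt_trans K2 sk); have -> : z0 + (gam l t - z0) = gam l t by ring.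
  move=> /le_trans; apply; rewrite (le_trans (ler_wpM2l (ltW ep1) K2))//.
  by rewrite le_eqVlt; apply/orP; left; apply/eqP; field; rewrite gt_eqF.
have ab : a <= b by lra.
have cd : c <= d by lra.
have E0 : 0 <= ep / (8 * (K + 1)) * s by rewrite mulr_ge0// divr_ge0 ?mulr_ge0 ?ltW.
have MM x : x <= K -> 0 <= x -> ep / (8 * (K + 1)) * s * x <= ep / 8 * s.
  move=> xK x0; have -> : ep / (8 * (K + 1)) * s * x = ep / 8 * s * (x / (K + 1)).
    by field; rewrite gt_eqF.
  apply: ler_piMr; first by rewrite mulr_ge0// divr_ge0// ltW.
  by rewrite ler_pdivrMr// mul1r (le_trans xK)// lerDl.
have hE t : c <= t <= d -> 
    cmod (hseg a b t - (G d0 z0 (gam b t) - G d0 z0 (gam a t))) <= 2 * (ep / 8 * s) * (b - a).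
  move=> tcd; have tST : S <= t <= T by apply/andP; split; lra.
  apply: (@edge_estimate (gam^~ t) (fun=> e t - w)) => // l lab.
  - exact: gam_dl.
  - exact: tcont_cst.
  - by apply: fgam_cl => //; apply/andP; split; lra.
  rewrite (le_trans _ (MM _ (ewK tST) (cmod_ge0 _)))// ler_wpM2r ?cmod_ge0//.
  exact: rem.
have vE l : a <= l <= b -> 
    cmod (vseg c d l - (G d0 z0 (gam l d) - G d0 z0 (gam l c))) <= 2 * (ep / 8 * s) * (d - c).
  move=> lab; have lAB : A <= l <= B by apply/andP; split; lra.
  have sub t : c <= t <= d -> S <= t <= T by move=> ?; apply/andP; split; lra.
  apply: (@edge_estimate (gam l) (fun t => l%:C * e' t)) => // t tcd.
  - by apply: gam_dt; exact: sub.
  - by apply: tcontM; [exact: tcont_cst|apply: e'c; exact: sub].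
  - by apply: fgam_ct => //; exact: sub.
  have le'K : cmod (l%:C * e' t) <= K.
    have [al lb] := andP lab.
    rewrite cmodM cmodR ger0_norm; last exact: le_trans A0 (le_trans Aa al).
    rewrite (le_trans _ (e'K (sub _ tcd)))// ler_piMl ?cmod_ge0//.
    exact: le_trans lb (le_trans bB B1).
  rewrite (le_trans _ (MM _ le'K (cmod_ge0 _)))// ler_wpM2r ?cmod_ge0//.
  exact: rem.
have cc : c <= c <= d by rewrite lexx.
have dd : c <= d <= d by rewrite lexx andbT.
have aa : a <= a <= b by rewrite lexx.
have bb : a <= b <= b by rewrite lexx andbT.
move: (hE _ cc) (hE _ dd) (vE _ aa) (vE _ bb).
set G1 := G d0 z0 (gam b c); set G2 := G d0 z0 (gam a c).
set G3 := G d0 z0 (gam b d); set G4 := G d0 z0 (gam a d).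
move=> h1 h2 h3 h4; rewrite /Q -/s.
have -> : Phi a b c d = (hseg a b c - (G1 - G2)) + (vseg c d b - (G3 - G1))
  - (hseg a b d - (G3 - G4)) - (vseg c d a - (G4 - G2)) by rewrite /Phi; ring.
rewrite (le_trans (cmodB _ _))// (le_trans (lerD (cmodB _ _) (lexx _)))//.
rewrite (le_trans (lerD (lerD (cmodD _ _) (lexx _)) (lexx _)))//.
rewrite (le_trans (lerD (lerD (lerD h1 h4) h2) h3))//.
have -> : 2 * (ep / 8 * s) * (b - a) + 2 * (ep / 8 * s) * (d - c) +
  2 * (ep / 8 * s) * (b - a) + 2 * (ep / 8 * s) * (d - c) = ep * s ^+ 2 / 2.
  by rewrite /s; field.
by rewrite ler_pdivrMr// ler_peMr ?ler1n// mulr_ge0 ?sqr_ge0// ltW.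
Qed.

End goursat.

(** * Cauchy's formula *)

Section cauchy.
Variable R : realType.
Local Notation C := R[i].
Implicit Types (f q : C -> C) (w z : C) (r rho : R).

Definition circle r (t : R) : C := r%:C * expi t.
Definition holo_disc rho f := forall z, cmod z < rho -> exists d, cdiff f z d.

Let p2 : R := 2 * pi.

Lemma twopi_gt0 : 0 < p2.
Proof. by rewrite mulr_gt0 ?pi_gt0. Qed.

Lemma twopi_neq0 : p2%:C != 0.
Proof. by rewrite fmorph_eq0 gt_eqF// twopi_gt0. Qed.

Lemma expi_2pi : expi p2 = 1.
Proof.
rewrite /p2 mulr_natl /expi cos2pi.
by rewrite -[X in sin X]add0r -(_ : pi + pi = pi *+ 2)// addrA !sinDpi sin0 opprK.
Qed.

Lemma cmod_circle r t : 0 <= r -> cmod (circle r t) = r.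
Proof. by move=> r0; rewrite cmodM cmodR cmod_expi mulr1 ger0_norm. Qed.

Lemma circle_neq0 r t : 0 < r -> circle r t != 0.
Proof. by move=> r0; rewrite -cmod_gt0 cmod_circle// ltW. Qed.

Lemma rdiff_circle r t : rdiff (circle r) t (ii * circle r t).
Proof. by have := tdiffZ r%:C (@rdiff_expi R t); rewrite mulrCA. Qed.

Lemma rcont_circle r t : rcont (circle r) t.
Proof. exact: tdiff_cont (rdiff_circle r t). Qed.

Lemma conj_circle r t : 0 < r -> (conjc (circle r t)) = (r ^+ 2)%:C / circle r t.
Proof.
move=> r0; apply: (mulIf (circle_neq0 t r0)); rewrite divfK ?circle_neq0//.
by rewrite mulrC mulcJ cmod_circle// ltW.
Qed.

Lemma circle_subr_ge r t w : 0 <= r -> r - cmod w <= cmod (circle r t - w).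
Proof.
move=> r0; rewrite lerBlDr -{1}(cmod_circle t r0).
by have := cmodD (circle r t - w) w; rewrite subrK.
Qed.

Lemma circle_neq r t w : 0 <= r -> cmod w < r -> circle r t - w != 0.
Proof.
move=> r0 wr; rewrite -cmod_gt0 (lt_le_trans _ (circle_subr_ge t w r0))//.
by rewrite subr_gt0.
Qed.

Lemma holo_circle_cont rho f r t : 0 <= r -> r < rho -> holo_disc rho f ->
  rcont (fun t => f (circle r t)) t.
Proof.
move=> r0 rrho fh; have [|d /tdiff_cont fd] := fh (circle r t).
  by rewrite cmod_circle.
exact: (tcont_comp (g := circle r) fd (rcont_circle r t)).
Qed.

(** Goursat on the cone from the circle down to its copy shrunk towards [w] by the factor [ep]: the
    integral over the circle equals that over the small loop, which tends to 0 because q(z)(z - w)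
    does. The circle need not be centred at [w]. *)
Lemma cauchy_removable rho r w q : cmod w < r -> r < rho ->
  (forall z, z != w -> cmod z < rho -> exists d, cdiff q z d) ->
  (forall e, 0 < e -> exists2 k, 0 < k & forall z, z != w -> cmod (z - w) < k ->
     cmod (q z) * cmod (z - w) <= e) ->
  cint 0 p2 (fun t => q (circle r t) * (ii * circle r t)) = 0.
Proof.
move=> wr rrho qd qs.
have r0 : 0 < r by rewrite (le_lt_trans (cmod_ge0 w)).
have rw : 0 < r - cmod w by rewrite subr_gt0.
have p0 := ltW twopi_gt0.
have M0 : 0 <= 2 * (r / (r - cmod w)) * p2.
  by apply: mulr_ge0 => //; apply: mulr_ge0 => //; apply: divr_ge0; exact: ltW.
apply: (cmod_small M0) => eta eta0; have [k k0 Hk] := qs _ eta0.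
(* Points of the circle are within 2r of [w], so the shrunken loop stays at distance less than [k],
   where the hypothesis on [q] applies. *)
pose ep := Num.min (1 / 2) (k / (4 * r)).
have ep0 : 0 < ep by rewrite lt_min divr_gt0//= divr_gt0// mulr_gt0.
have ep1 : ep <= 1 by rewrite ge_min; apply/orP; left; lra.
have epk : ep * (2 * r) < k.
  have : ep <= k / (4 * r) by rewrite ge_min lexx orbT.
  by rewrite ler_pdivlMr ?mulr_gt0// => ?; lra.
have cw t : cmod (circle r t - w) <= 2 * r.
  rewrite (le_trans (cmodB _ _))// cmod_circle ?(ltW r0)// mulr_natl mulr2n.
  by rewrite lerD2l ltW.
pose gam l t := w + l%:C * (circle r t - w).
have gw l t : gam l t - w = l%:C * (circle r t - w) by rewrite /gam; ring.
have gneq l t : 0 < l -> gam l t != w.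
  move=> l0; rewrite -subr_eq0 gw mulf_neq0//; last exact: circle_neq (ltW r0) wr.
  by rewrite fmorph_eq0 gt_eqF.
have gin l t : 0 < l -> l <= 1 -> cmod (gam l t) < rho.
  move=> l0 l1; have -> : gam l t = (1 - l)%:C * w + l%:C * circle r t.
    by rewrite /gam rmorphB rmorph1 /=; ring.
  rewrite (le_lt_trans _ rrho)// (le_trans (cmodD _ _))// !cmodM !cmodR.
  rewrite cmod_expi (ger0_norm (ltW l0)) (ger0_norm (ltW r0)) ger0_norm ?subr_ge0//.
  have : (1 - l) * cmod w <= (1 - l) * r by rewrite ler_wpM2l ?subr_ge0// ltW.
  by rewrite mulr1 => ?; lra.
have fd l t : ep <= l <= 1 -> 0 <= t <= p2 -> exists d, cdiff q (gam l t) d.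
  move=> /andP[epl l1] _; have l0 := lt_le_trans ep0 epl.
  by apply: qd; [exact: gneq|exact: gin].
have bnd t : cmod (ii * circle r t) <= 2 * r.
  rewrite cmodM cmodi mul1r cmod_circle; last exact: ltW.
  by rewrite ler_peMl ?ler1n// ltW.
(* Periodicity: the two radial sides of the cone carry the same integral with opposite signs. *)
have c0 : circle r p2 = circle r 0 by rewrite /circle expi_2pi expi0.
have := goursat_rectangle (ltW ep0) ep1 (lexx 1) p0 (fun t _ => rdiff_circle r t)
  (fun t _ => tcontM (tcont_cst _ _ _) (rcont_circle r t)) (fun t _ => bnd t)
  (fun t _ => cw t) fd.
rewrite c0.
move=> E; have -> : cint 0 p2 (fun t => q (circle r t) * (ii * circle r t)) =
    cint 0 p2 (fun t => q (gam ep t) * (ep%:C * (ii * circle r t))).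
  apply/eqP; rewrite -subr_eq0 -[X in _ == X]E; apply/eqP.
  have -> : cint 0 p2 (fun t => q (circle r t) * (ii * circle r t)) =
      cint 0 p2 (fun t => q (w + 1%:C * (circle r t - w)) * (1%:C * (ii * circle r t))).
    by apply: eq_cint => t _; rewrite !mul1r addrC subrK.
  rewrite /gam; ring.
rewrite (_ : eta * _ = 2 * (eta * (r / (r - cmod w))) * (p2 - 0)); last by ring.
apply: cint_bound => //.
  move=> t t02; have [d /tdiff_cont qc] := fd ep t (introT andP (conj (lexx _) ep1)) t02.
  apply: tcontM.
    apply: (tcont_comp (g := gam ep) qc); apply: tcontD; first exact: tcont_cst.
    apply: tcontM; first exact: tcont_cst.
    by apply: tcontB; [exact: rcont_circle|exact: tcont_cst].
  by apply: tcontM; [exact: tcont_cst|apply: tcontM; [exact: tcont_cst|exact: rcont_circle]].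
move=> t _; rewrite !cmodM cmodi mul1r cmodR cmodR cmod_expi mulr1 (ger0_norm (ltW ep0)) (ger0_norm (ltW r0)).
have gwk : cmod (gam ep t - w) < k.
  rewrite gw cmodM cmodR (ger0_norm (ltW ep0)) (le_lt_trans _ epk)//.
  by rewrite ler_wpM2l// ltW.
have := Hk _ (gneq ep t ep0) gwk; rewrite gw cmodM cmodR (ger0_norm (ltW ep0)) => H.
have cge := circle_subr_ge t w (ltW r0).
(* The hypothesis controls [q] times the distance to [w], and on the loop this distance is at least
   ep (r - |w|); the factor r / (r - |w|) is the price of an off-centre [w]. *)
have -> : cmod (q (gam ep t)) * (ep * r) =
    cmod (q (gam ep t)) * (ep * (r - cmod w)) * (r / (r - cmod w)).
  by field; rewrite gt_eqF.
apply: ler_wpM2r; first by apply: divr_ge0; exact: ltW.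
rewrite (le_trans _ H)//; apply: ler_wpM2l; first exact: cmod_ge0.
by apply: ler_wpM2l => //; exact: ltW.
Qed.

Lemma cdiff_quotient f z w d : z != w -> cdiff f z d ->
  exists d', cdiff (fun x => (f x - f w) / (x - w)) z d'.
Proof.
move=> zw fd; have zw0 : z - w != 0 by rewrite subr_eq0.
exists ((d - 0) * (z - w)^-1 + (f z - f w) * (- (z - w) ^- 2 * (1 - 0))).
apply: tdiffM; first by apply: tdiffB => //; exact: tdiff_cst.
apply: (tdiff_comp (f := fun x => x^-1) (g := fun x => x - w)); first exact: cdiffV.
by apply: tdiffB; [exact: cdiff_id|exact: tdiff_cst].
Qed.

(** The quotient (f(z) - f(0)) / z has a removable singularity, and dz / z = i dt on the circle. *)
Lemma mean_value rho r f : 0 < r -> r < rho -> holo_disc rho f ->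
  cint 0 p2 (fun t => f (circle r t)) = p2%:C * f 0.
Proof.
move=> r0 rrho fh.
have [d0 fd0] : exists d, cdiff f 0 d by apply: fh; rewrite cmod0 (lt_trans r0).
have fc := tdiff_cont fd0.
unshelve epose proof
  (@cauchy_removable rho r 0 (fun z => (f z - f 0) / (z - 0)) _ rrho _ _) as E.
- by rewrite cmod0.
- by move=> z z0 /fh[d fd]; exact: cdiff_quotient fd.
- move=> e e0; have [k k0 H] := fc e e0; exists k => // z z0; rewrite subr0 => zk.
  rewrite cmodM cmodV divfK ?cmod_eq0//.
  by have := H _ zk; rewrite add0r.
move: E; have -> : cint 0 p2 (fun t => (f (circle r t) - f 0) / (circle r t - 0) * (ii * circle r t)) =
    cint 0 p2 (fun t => ii * (f (circle r t) - f 0)).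
  apply: eq_cint => t _; rewrite subr0; field; exact: circle_neq0.
have fcc : ccont_on 0 p2 (fun t => f (circle r t)).
  by move=> t _; exact: holo_circle_cont (ltW r0) rrho fh.
have cc : ccont_on 0 p2 (fun=> f 0) by move=> t _; exact: tcont_cst.
rewrite cintZ; last by move=> t tt; apply: tcontB; [exact: (fcc _ tt)|exact: (cc _ tt)].
rewrite cintB// cint_cst ?(ltW twopi_gt0)// subr0 => /eqP.
rewrite mulf_eq0 -cmod_eq0 cmodi oner_eq0 /= subr_eq0 => /eqP ->.
by rewrite mulrC.
Qed.

(** Apply [cauchy_removable] to (f(z) - f(0) - d z) / z^2, which is o(1/|z|) at 0 by
    differentiability alone. *)
Lemma first_coefficient rho r f d : 0 < r -> r < rho -> holo_disc rho f -> cdiff f 0 d ->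
  cint 0 p2 (fun t => f (circle r t) * expi (- t)) = p2%:C * (r%:C * d).
Proof.
move=> r0 rrho fh fd0.
pose q z := (f z - f 0 - d * z) / z ^+ 2.
unshelve epose proof (@cauchy_removable rho r 0 q _ rrho _ _) as E.
- by rewrite cmod0.
- move=> z z0 /fh[d1 fd1].
  have z20 : z ^+ 2 != 0 by rewrite expf_neq0.
  eexists; apply: tdiffM.
    apply: tdiffB; first by apply: tdiffB; [exact: fd1|exact: tdiff_cst].
    exact: (tdiffZ d (@cdiff_id R z)).
  by apply: (tdiff_comp (f := fun x => x^-1)); [exact: cdiffV|exact: cdiff_sqr].
- move=> e e0; have [k k0 H] := fd0 e e0; exists k => // z z0; rewrite subr0 => zk.
  have := H _ zk; rewrite add0r /q cmodM cmodV cmodX => {}H.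
  have m0 : 0 < cmod z by rewrite cmod_gt0.
  by rewrite expr2 invfM mulrA divfK ?gt_eqF// ler_pdivrMr.
have fcc : ccont_on 0 p2 (fun t => f (circle r t) * expi (- t)).
  move=> t _; apply: tcontM; first exact: holo_circle_cont (ltW r0) rrho fh.
  have := tcont_conj (tdiff_cont (@rdiff_expi R t)).
  by congr tcont; apply/funext => s; rewrite conj_expi.
have ec : ccont_on 0 p2 (fun t => expi (- t)).
  move=> t _; have := tcont_conj (tdiff_cont (@rdiff_expi R t)).
  by congr tcont; apply/funext => s; rewrite conj_expi.
have e0 : cint 0 p2 (fun t => expi (- t)) = 0 :> C.
  have M := @mean_value 2 1 id ltr01 (ltr1n _ 2) (fun z _ => ex_intro _ _ (@cdiff_id R z)).
  rewrite mulr0 in M; rewrite -[LHS]conjcK -cint_conj//.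
  rewrite -[RHS](rmorph0 (@conjc R)); congr (conjc _); rewrite -[RHS]M.
  by apply: eq_cint => t _; rewrite conj_expi opprK /circle mul1r.
have r0C : r%:C != 0 :> C by rewrite fmorph_eq0 gt_eqF.
move: E; have -> : cint 0 p2 (fun t => q (circle r t) * (ii * circle r t)) =
    cint 0 p2 (fun t => (ii / r%:C) *
      (f (circle r t) * expi (- t) - f 0 * expi (- t) - d * r%:C)).
  apply: eq_cint => t _; rewrite /q /circle -(conj_expi t).
  have -> : (conjc (expi t)) = (expi t)^-1.
    apply: (mulfI (expi_neq0 t)); rewrite mulcJ cmod_expi expr1n mulfV//; exact: expi_neq0.
  by field; rewrite r0C expi_neq0.
have c1 : ccont_on 0 p2 (fun t => f 0 * expi (- t)).
  by move=> t tt; apply: tcontM; [exact: tcont_cst|exact: (ec _ tt)].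
have c2 : ccont_on 0 p2 (fun t => f (circle r t) * expi (- t) - f 0 * expi (- t)).
  by move=> t tt; apply: tcontB; [exact: (fcc _ tt)|exact: (c1 _ tt)].
have c3 : ccont_on 0 p2 (fun=> d * r%:C) by move=> t _; exact: tcont_cst.
rewrite cintZ; last by move=> t tt; apply: tcontB; [exact: (c2 _ tt)|exact: (c3 _ tt)].
rewrite cintB// cintB// cintZ// e0 mulr0 subr0 cint_cst ?(ltW twopi_gt0)// subr0 => /eqP.
rewrite !mulf_eq0 invr_eq0 (negbTE r0C) -cmod_eq0 cmodi oner_eq0 /= subr_eq0 => /eqP ->.
ring.
Qed.

Lemma conj_kernel_neq0 r w z : cmod w * cmod z < r ^+ 2 ->
  (r ^+ 2)%:C - (conjc w) * z != 0.
Proof.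
move=> H; rewrite -cmod_gt0.
have : cmod ((r ^+ 2)%:C) <= cmod ((r ^+ 2)%:C - (conjc w) * z) + cmod ((conjc w) * z).
  by rewrite -{1}(subrK ((conjc w) * z) (r ^+ 2)%:C) cmodD.
rewrite cmodM cmodJ cmodR ger0_norm ?sqr_ge0// => H2.
by rewrite -(ltrD2r (cmod w * cmod z)) add0r (lt_le_trans H).
Qed.

(* Radius slightly larger than r on which [conj_kernel_neq0] still applies. *)
Lemma reflected_radius r w : 0 < r -> cmod w < r ->
  let rho := 2 * r ^+ 2 / (r + cmod w) in
  r < rho /\ forall z, cmod z < rho -> cmod w * cmod z < r ^+ 2.
Proof.
move=> r0 wr /=; have rw : 0 < r + cmod w by rewrite ltr_pwDl ?cmod_ge0.
split; first by rewrite ltr_pdivlMr//; nra.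
move=> z; rewrite ltr_pdivlMr// => H.
have w0 := cmod_ge0 w; have z0 := cmod_ge0 z; nra.
Qed.

Lemma cdiff_conj_kernel r w z : cmod w * cmod z < r ^+ 2 ->
  exists d, cdiff (fun z => ((r ^+ 2)%:C - (conjc w) * z)^-1) z d.
Proof.
move=> H; eexists; apply: (tdiff_comp (f := fun x => x^-1)).
  by apply: cdiffV; exact: conj_kernel_neq0.
by apply: tdiffB; [exact: tdiff_cst|exact: (tdiffZ _ (@cdiff_id R z))].
Qed.

(** On the circle the conjugate of z is r^2 / z. The right side without the conjugation is
    holomorphic in a larger disc, so the integral of the Cauchy kernel follows from the mean value
    property, without winding numbers or series. *)
Lemma kernel_conj r w t : 0 < r -> cmod w < r ->
  circle r t / (circle r t - w) =
  (conjc ((r ^+ 2)%:C / ((r ^+ 2)%:C - (conjc w) * circle r t))).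
Proof.
move=> r0 wr; have z0 := circle_neq0 t r0; have zw := circle_neq t (ltW r0) wr.
rewrite conjcM conjcV conjcB conjcM conjcK conjc_real conj_circle//.
have r20 : (r ^+ 2)%:C != 0 :> C by rewrite fmorph_eq0 expf_neq0// gt_eqF.
field; rewrite z0 zw /=.
rewrite rmorphXn in r20.
by rewrite andbT (mulrC w) -mulrBr mulf_neq0.
Qed.

Lemma kernel_integral r w : 0 < r -> cmod w < r ->
  cint 0 p2 (fun t => circle r t / (circle r t - w)) = p2%:C.
Proof.
move=> r0 wr; have [rrho Hrho] := reflected_radius r0 wr.
set rho := 2 * r ^+ 2 / _ in rrho Hrho.
pose g z : C := (r ^+ 2)%:C * ((r ^+ 2)%:C - (conjc w) * z)^-1.
have gh : holo_disc rho g.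
  move=> z /Hrho/cdiff_conj_kernel[d gd]; eexists; exact: (tdiffZ _ gd).
have gc : ccont_on 0 p2 (fun t => g (circle r t)).
  by move=> t _; exact: holo_circle_cont (ltW r0) rrho gh.
have := mean_value r0 rrho gh.
rewrite {2}/g mulr0 subr0 mulfV ?mulr1; last by rewrite fmorph_eq0 expf_neq0// gt_eqF.
move=> M; rewrite -(conjc_real p2) -M -cint_conj//.
by apply: eq_cint => t _; exact: kernel_conj.
Qed.

Lemma kernel_cont r w t : 0 < r -> cmod w < r ->
  rcont (fun t => circle r t / (circle r t - w)) t.
Proof.
move=> r0 wr; apply: tcontM; first exact: rcont_circle.
apply: (tcont_comp (f := fun x => x^-1) (g := fun t => circle r t - w)).
  by apply: tdiff_cont; apply: cdiffV; exact: circle_neq (ltW r0) wr.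
by apply: tcontB; [exact: rcont_circle|exact: tcont_cst].
Qed.

Lemma cauchy_formula rho r f w : r < rho -> cmod w < r -> holo_disc rho f ->
  cint 0 p2 (fun t => f (circle r t) * (circle r t / (circle r t - w))) = p2%:C * f w.
Proof.
move=> rrho wr fh.
have r0 : 0 < r by rewrite (le_lt_trans (cmod_ge0 w)).
have [d0 fd0] : exists d, cdiff f w d by apply: fh; rewrite (lt_trans wr).
have fc := tdiff_cont fd0.
unshelve epose proof
  (@cauchy_removable rho r w (fun z => (f z - f w) / (z - w)) wr rrho _ _) as E.
- by move=> z z0 /fh[d fd]; exact: cdiff_quotient fd.
- move=> e e0; have [k k0 H] := fc e e0; exists k => // z z0 zk.
  rewrite cmodM cmodV divfK ?cmod_eq0 ?subr_eq0//.
  by have := H _ zk; rewrite (addrC w) subrK.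
have fcc : ccont_on 0 p2 (fun t => f (circle r t)).
  by move=> t _; exact: holo_circle_cont (ltW r0) rrho fh.
have kc : ccont_on 0 p2 (fun t => circle r t / (circle r t - w)).
  by move=> t _; exact: kernel_cont.
have c1 : ccont_on 0 p2 (fun t => f (circle r t) * (circle r t / (circle r t - w))).
  by move=> t tt; apply: tcontM; [exact: (fcc _ tt)|exact: (kc _ tt)].
have c2 : ccont_on 0 p2 (fun t => f w * (circle r t / (circle r t - w))).
  by move=> t tt; apply: tcontM; [exact: tcont_cst|exact: (kc _ tt)].
move: E; have -> : cint 0 p2 (fun t => (f (circle r t) - f w) / (circle r t - w) * (ii * circle r t)) =
    cint 0 p2 (fun t => ii * (f (circle r t) * (circle r t / (circle r t - w))
      - f w * (circle r t / (circle r t - w)))).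
  by apply: eq_cint => t _; ring.
rewrite cintZ; last by move=> t tt; apply: tcontB; [exact: (c1 _ tt)|exact: (c2 _ tt)].
rewrite cintB// (cintZ _ kc) kernel_integral// => /eqP.
rewrite mulf_eq0 -cmod_eq0 cmodi oner_eq0 /= subr_eq0 => /eqP ->.
by rewrite mulrC.
Qed.

Lemma ccont_on_bounded a b (g : R -> C) : a <= b -> ccont_on a b g ->
  exists2 M, 0 <= M & forall t, a <= t <= b -> cmod (g t) <= M.
Proof.
move=> ab gc.
have [c1 _ H1] := EVT_max ab (cont_on_within (cont_on_norm (ccont_on_Re gc))).
have [c2 _ H2] := EVT_max ab (cont_on_within (cont_on_norm (ccont_on_Im gc))).
exists (`|complex.Re (g c1)| + `|complex.Im (g c2)|); first exact: addr_ge0.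
move=> t tab; rewrite (le_trans (cmod_le_ReIm _))// lerD//.
  by apply: H1; rewrite in_itv.
by apply: H2; rewrite in_itv.
Qed.

(** Cauchy's formula with the geometric expansion of the kernel stopped after N terms. The constant
    must not depend on N, since the moment bound later lets N grow with the order of the moment. *)
Lemma taylor_expansion rho r f : 0 < r -> r < rho -> holo_disc rho f ->
  exists (a : nat -> C) (M : R), 0 <= M /\ forall N w, cmod w <= r / 2 ->
    cmod (f w - \sum_(n < N) a n * w ^+ n) <= M * (cmod w / r) ^+ N.
Proof.
move=> r0 rrho fh.
have fcc : ccont_on 0 p2 (fun t => f (circle r t)).
  by move=> t _; exact: holo_circle_cont (ltW r0) rrho fh.
have [B B0 fB] := ccont_on_bounded (ltW twopi_gt0) fcc.
have vc n : ccont_on 0 p2 (fun t => (circle r t) ^- n).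
  move=> t _; apply: (tcont_comp (f := fun x => x^-1)).
    by apply: tdiff_cont; apply: cdiffV; rewrite expf_neq0// circle_neq0.
  exact: tdiff_cont (tdiffX n (rdiff_circle r t)).
pose a n := p2%:C^-1 * cint 0 p2 (fun t => f (circle r t) * (circle r t) ^- n).
exists a, (4 * B); split; first by rewrite mulr_ge0.
move=> N w w2.
have wr : cmod w < r by rewrite (le_lt_trans w2)// ltr_pdivrMr// ltr_pMr// ltr1n.
have kc : ccont_on 0 p2 (fun t => circle r t / (circle r t - w)).
  by move=> t _; exact: kernel_cont.
(* The kernel of the remainder, (w / z)^N z / (z - w). Its last factor is at most 2 for |w| <= r /
   2, and [cint_bound] costs another 2, whence the constant 4 B. *)
pose K N t := w ^+ N * (circle r t) ^- N * (circle r t / (circle r t - w)).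
have Kc n : ccont_on 0 p2 (fun t => f (circle r t) * K n t).
  move=> t tt; apply: tcontM; first exact: (fcc _ tt).
  apply: tcontM; last exact: (kc _ tt).
  by apply: tcontM; [exact: tcont_cst|exact: (vc _ _ tt)].
have E : f w - \sum_(n < N) a n * w ^+ n =
    p2%:C^-1 * cint 0 p2 (fun t => f (circle r t) * K N t).
  elim: N => [|N IH].
    rewrite big_ord0 subr0 -[LHS](mulKf twopi_neq0) -(cauchy_formula rrho wr fh).
    by congr (_ * _); apply: eq_cint => t _; rewrite /K !expr0 invr1 !mul1r.
  rewrite big_ord_recr /= opprD addrA IH /a -mulrA -mulrBr; congr (_ * _).
  rewrite mulrC -cintZ; last by move=> t tt; apply: tcontM; [exact: (fcc _ tt)|exact: (vc _ _ tt)].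
  rewrite -cintB//; last first.
    move=> t tt; apply: tcontM; first exact: tcont_cst.
    by apply: tcontM; [exact: (fcc _ tt)|exact: (vc _ _ tt)].
  apply: eq_cint => t _; rewrite /K !exprS.
  have z0 := circle_neq0 t r0; have zw := circle_neq t (ltW r0) wr.
  by field; rewrite zw z0 expf_neq0.
rewrite E cmodM cmodV cmodR ger0_norm ?(ltW twopi_gt0)//.
rewrite mulrC ler_pdivrMr ?twopi_gt0//.
have -> : 4 * B * (cmod w / r) ^+ N * p2 = 2 * (B * ((cmod w / r) ^+ N * 2)) * (p2 - 0).
  by ring.
apply: cint_bound; [exact: ltW twopi_gt0|exact: Kc|move=> t tt].
rewrite cmodM; apply: ler_pM; rewrite ?cmod_ge0 ?fB// !cmodM !cmodV !cmodX.
rewrite cmod_circle ?(ltW r0)// -expr_div_n; apply: ler_wpM2l.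
  by rewrite exprn_ge0// divr_ge0 ?cmod_ge0// ltW.
have := circle_subr_ge t w (ltW r0) => zw.
have zw0 : 0 < cmod (circle r t - w) by rewrite cmod_gt0 circle_neq// ltW.
by rewrite ler_pdivrMr// cmodR cmod_expi mulr1 (ger0_norm (ltW r0)); lra.
Qed.

(** Identity theorem on the real line: the coefficients vanish one after another as t tends to 0,
    and the remainder alone tends to 0 with N. It serves to continue identities known for real
    arguments. *)
Lemma entire_eq0 f : (forall rho, holo_disc rho f) -> (forall t : R, f t%:C = 0) ->
  forall z, f z = 0.
Proof.
move=> fh f0 z; pose r := 2 * cmod z + 1.
have r0 : 0 < r by rewrite ltr_wpDl// mulr_ge0// cmod_ge0.
have rr : r < r + 1 by rewrite ltrDl.
have [a [M [M0 H]]] := taylor_expansion r0 rr (fh (r + 1)).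
have a0 n : a n = 0.
  elim/ltn_ind: n => n IH.
  have M'0 : 0 <= M / r ^+ n.+1 by rewrite divr_ge0// exprn_ge0// ltW.
  apply: (cmod_small M'0) => e e0; pose t := Num.min e (r / 2).
  have t0 : 0 < t by rewrite lt_min e0 divr_gt0.
  have := H n.+1 t%:C; rewrite f0 big_ord_recr /= big1; last first.
    by move=> i _; rewrite IH ?mul0r.
  rewrite !add0r cmodN cmodM cmodX cmodR ger0_norm ?(ltW t0)//.
  have -> : t <= r / 2 by rewrite ge_min lexx orbT.
  move=> /(_ isT); rewrite expr_div_n [t ^+ n.+1]exprS.
  have tn : 0 < t ^+ n by rewrite exprn_gt0.
  move=> Hn; rewrite -(ler_pM2r tn) (le_trans Hn)//.
  rewrite (_ : M * (t * t ^+ n / r ^+ n.+1) = t * (M / r ^+ n.+1) * t ^+ n); last by ring.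
  by rewrite ler_wpM2r ?(ltW tn)// ler_wpM2r// ge_min lexx.
apply: (cmod_small M0) => e e0.
(* The choice of r gives |z| / r <= 1/2, and 2^N exceeds 1/e. *)
pose N := Num.bound e^-1.
have zr : cmod z / r <= 2^-1.
  by rewrite ler_pdivrMr// /r; lra.
have zr2 : cmod z <= r / 2 by rewrite /r; lra.
have := H N z zr2; rewrite big1 ?subr0; last by move=> i _; rewrite a0 mul0r.
move=> /le_trans; apply; rewrite mulrC ler_wpM2r//.
have zr0 : 0 <= cmod z / r by rewrite divr_ge0 ?cmod_ge0// ltW.
rewrite (le_trans (lerXn2r N _ _ zr))// ?nnegrE// ?invr_ge0// exprVn.
rewrite invf_ple ?posrE ?exprn_gt0//; apply: ltW; exact: upper_nthrootP.
Qed.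

End cauchy.

(** * Functions with positive real part *)

Section positive_real_part.
Variable R : realType.
Local Notation C := R[i].
Local Notation p2 := (2 * pi : R).

Lemma rcont_expiN (t : R) : rcont (fun t : R => expi (- t)) t.
Proof.
have := tcont_conj (tdiff_cont (@rdiff_expi R t)).
by congr tcont; apply/funext => s; rewrite conj_expi.
Qed.

Lemma circle_expi (r t : R) : 0 < r -> expi t = r%:C^-1 * circle r t.
Proof. by move=> r0; rewrite mulKf// fmorph_eq0 gt_eqF. Qed.

(** The integrand is the conjugate of z g(z) / r, and z g(z) vanishes at the centre. Adding or
    subtracting this zero lets the first coefficient be computed from Re g or Im g alone. *)
Lemma conj_first_coefficient rho (r : R) (g : C -> C) : 0 < r -> r < rho -> holo_disc rho g ->
  cint 0 p2 (fun t => conjc (g (circle r t)) * expi (- t)) = 0.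
Proof.
move=> r0 rrho gh.
have zgh : holo_disc rho (fun z => z * g z).
  by move=> z /gh[d gd]; eexists; exact: tdiffM (@cdiff_id R z) gd.
have M := mean_value r0 rrho zgh; rewrite mul0r mulr0 in M.
have c1 : ccont_on 0 p2 (fun t => circle r t * g (circle r t)).
  by move=> t _; exact: holo_circle_cont (ltW r0) rrho zgh.
have -> : cint 0 p2 (fun t => conjc (g (circle r t)) * expi (- t)) =
    conjc (r%:C^-1 * cint 0 p2 (fun t => circle r t * g (circle r t))).
  rewrite -cintZ// -cint_conj.
    apply: eq_cint => t _; rewrite -conj_expi -conjcM; congr conjc.
    by rewrite (circle_expi t r0); ring.
  by move=> t tt; apply: tcontM; [exact: tcont_cst|exact: (c1 _ tt)].
by rewrite M mulr0 conjc0.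
Qed.

(** The coefficient is an integral against 2 Re G, which is nonnegative and has mean 2 Re G(0). The
    sharp constant is 2 / r; the other factor 2 is that of [cmod_cint_le]. *)
Lemma gradient_estimate (r rho : R) (G : C -> C) d : 0 < r -> r < rho -> holo_disc rho G ->
  (forall z, cmod z < rho -> 0 <= complex.Re (G z)) -> cdiff G 0 d ->
  cmod d <= 4 / r * complex.Re (G 0).
Proof.
move=> r0 rrho Gh Gpos Gd; have p20 := ltW (@twopi_gt0 R).
have Gc : ccont_on 0 p2 (fun t => G (circle r t)).
  by move=> t _; exact: holo_circle_cont (ltW r0) rrho Gh.
have F1 := first_coefficient r0 rrho Gh Gd.
have F2 := conj_first_coefficient r0 rrho Gh.
have c1 : ccont_on 0 p2 (fun t => G (circle r t) * expi (- t)).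
  by move=> t tt; apply: tcontM; [exact: (Gc _ tt)|exact: rcont_expiN].
have c2 : ccont_on 0 p2 (fun t => conjc (G (circle r t)) * expi (- t)).
  by move=> t tt; apply: tcontM; [exact: tcont_conj (Gc _ tt)|exact: rcont_expiN].
have S : cint 0 p2 (fun t => (2 * complex.Re (G (circle r t)))%:C * expi (- t)) =
    p2%:C * (r%:C * d).
  rewrite -F1 -[RHS]addr0 -F2 -cintD//; apply: eq_cint => t _.
  by rewrite -mulrDl addcJ rmorphM rmorph_nat.
have mv := congr1 (@complex.Re R) (mean_value r0 rrho Gh).
rewrite cReM /= mul0r subr0 in mv.
have Rc : cont_on 0 p2 (fun t => 2 * complex.Re (G (circle r t))).
  by apply: cont_onM; [exact: cont_on_cst|exact: ccont_on_Re].
have Rc' : ccont_on 0 p2 (fun t => (2 * complex.Re (G (circle r t)))%:C * expi (- t)).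
  by move=> t tt; apply: tcontM; [exact: rcont_real (Rc _ tt)|exact: rcont_expiN].
have := cmod_cint_le Rc' Rc.
have bnd t : 0 <= t <= p2 -> cmod ((2 * complex.Re (G (circle r t)))%:C * expi (- t)) <=
    2 * complex.Re (G (circle r t)).
  move=> _; rewrite cmodM cmodR cmod_expi mulr1 ger0_norm// mulr_ge0// Gpos//.
  by rewrite cmod_circle// ltW.
move=> /(_ bnd); rewrite S integZ; last exact: ccont_on_Re.
rewrite mv !cmodM !cmodR (ger0_norm p20) (ger0_norm (ltW r0)).
move=> H; rewrite -(ler_pM2l r0) -(ler_pM2l (@twopi_gt0 R)) (le_trans H)//.
by rewrite le_eqVlt; apply/orP; left; apply/eqP; field; rewrite gt_eqF.
Qed.

Section typically_real.
Variables (r rho s : R) (g : C -> C).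
Hypotheses (r0 : 0 < r) (rrho : r < rho) (gh : holo_disc rho g).
Hypothesis gJ : forall z, cmod z < rho -> g (conjc z) = conjc (g z).
Hypothesis gpos : forall z, cmod z < rho -> 0 <= complex.Im z -> 0 <= complex.Im (g z).
Hypothesis gd : cdiff g 0 s%:C.

Let V t := complex.Im (g (circle r t)).
Let k (w : C) t := (circle r t * (circle r t - w))^-1.

Let gc : ccont_on 0 p2 (fun t => g (circle r t)).
Proof. by move=> t _; exact: holo_circle_cont (ltW r0) rrho gh. Qed.

(** Conjugation symmetry reverses the sign of Im g on the lower half circle together with that of
    sin t. This is the positive density on which the remainder bound rests. *)
Lemma V_sin_ge0 t : 0 <= V t * sin t.
Proof.
have zr : cmod (circle r t) < rho by rewrite cmod_circle// ltW.
have Imz : complex.Im (circle r t) = r * sin t by rewrite cImM /= mul0r addr0.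
have [st|st] := leP 0 (sin t).
  by apply: mulr_ge0 => //; apply: gpos => //; rewrite Imz mulr_ge0// ltW.
have : 0 <= complex.Im (g (conjc (circle r t))).
  apply: gpos; rewrite ?cmodJ// cImJ Imz oppr_ge0 mulr_ge0_le0//; exact: ltW.
rewrite gJ// cImJ oppr_ge0 => V0.
by rewrite mulr_le0// ltW.
Qed.

(** The mass of the density: it sees only the derivative [s] at 0, not the size of [g] on the
    circle. *)
Lemma V_sin_integral : integ 0 p2 (fun t => V t * sin t) = pi * r * s.
Proof.
have F1 := first_coefficient r0 rrho gh gd.
have F2 := conj_first_coefficient r0 rrho gh.
have c1 : ccont_on 0 p2 (fun t => g (circle r t) * expi (- t)).
  by move=> t tt; apply: tcontM; [exact: (gc tt)|exact: rcont_expiN].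
have c2 : ccont_on 0 p2 (fun t => conjc (g (circle r t)) * expi (- t)).
  by move=> t tt; apply: tcontM; [exact: tcont_conj (gc tt)|exact: rcont_expiN].
have E : cint 0 p2 (fun t => g (circle r t) * expi (- t) -
    conjc (g (circle r t)) * expi (- t)) = p2%:C * (r%:C * s%:C).
  by rewrite cintB// F1 F2 subr0.
have := congr1 (@complex.Re R) E; rewrite -!rmorphM /= => {}E.
have cV : cont_on 0 p2 (fun t => V t * sin t).
  apply: cont_onM; first exact: ccont_on_Im.
  by move=> t _; exact: continuous_sin.
have : integ 0 p2 (fun t => 2 * (V t * sin t)) = p2 * (r * s).
  rewrite -E; apply: eq_integ => t _; rewrite /expi cosN sinN /V.
  by case: (g _) => a b /=; ring.
rewrite integZ// => H; apply: (@mulfI _ 2); first by rewrite pnatr_eq0.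
by rewrite H; ring.
Qed.

Lemma k_den_neq0 w t : cmod w < r -> circle r t * (circle r t - w) != 0.
Proof. by move=> wr; rewrite mulf_neq0 ?circle_neq0 ?circle_neq// ltW. Qed.

Lemma k_cont w : cmod w < r -> ccont_on 0 p2 (k w).
Proof.
move=> wr t _; apply: (tcont_comp (f := fun x => x^-1)).
  by apply: tdiff_cont; apply: cdiffV; exact: k_den_neq0.
apply: tcontM; first exact: rcont_circle.
by apply: tcontB; [exact: rcont_circle|exact: tcont_cst].
Qed.

(** The identity w^2 / (z(z - w)) = z / (z - w) - 1 - w / z combines Cauchy's formula, the mean
    value and the first coefficient. *)
Lemma remainder_kernel w : cmod w < r ->
  w ^+ 2 * cint 0 p2 (fun t => g (circle r t) * k w t) =
  p2%:C * (g w - g 0 - s%:C * w).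
Proof.
move=> wr; have CF := cauchy_formula rrho wr gh.
have M := mean_value r0 rrho gh.
have F1 := first_coefficient r0 rrho gh gd.
have kc := k_cont wr.
have c1 : ccont_on 0 p2 (fun t => g (circle r t) * expi (- t)).
  by move=> t tt; apply: tcontM; [exact: (gc tt)|exact: rcont_expiN].
have c0 : ccont_on 0 p2 (fun t => g (circle r t) * (circle r t / (circle r t - w))).
  by move=> t tt; apply: tcontM; [exact: (gc tt)|exact: kernel_cont].
have r0C : r%:C != 0 :> C by rewrite fmorph_eq0 gt_eqF.
have -> : p2%:C * (g w - g 0 - s%:C * w) =
  p2%:C * g w - p2%:C * g 0 - w / r%:C * (p2%:C * (r%:C * s%:C)).
  by field.
rewrite -CF -M -F1 -!cintZ//.
- rewrite -cintB// -cintB//.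
  + apply: eq_cint => t _; rewrite /k -conj_expi.
    have -> : conjc (expi t) = (expi t)^-1.
      apply: (mulfI (expi_neq0 t)); rewrite mulcJ cmod_expi expr1n mulfV//; exact: expi_neq0.
    rewrite (circle_expi t r0).
    by field; rewrite r0C circle_neq0// circle_neq// ltW.
  + by move=> t tt; apply: tcontB; [exact: (c0 _ tt)|exact: (gc tt)].
  + by move=> t tt; apply: tcontM; [exact: tcont_cst|exact: (c1 _ tt)].
- by move=> t tt; apply: tcontM; [exact: (gc tt)|exact: (kc _ tt)].
Qed.

(** On the circle the conjugate of the kernel is z^2 / (r^2 (r^2 - conj(w) z)), holomorphic across
    the disc and zero at 0. Hence g may be replaced by 2i Im g in [remainder_kernel]. *)
Lemma conj_kernel_integral w : cmod w < r ->
  cint 0 p2 (fun t => conjc (g (circle r t)) * k w t) = 0.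
Proof.
move=> wr; have [rr1 Hr1] := reflected_radius r0 wr.
set r1 := 2 * r ^+ 2 / _ in rr1 Hr1.
pose h z : C := g z * (z ^+ 2 * ((r ^+ 2)%:C^-1 * ((r ^+ 2)%:C - conjc w * z)^-1)).
have hh : holo_disc (Num.min rho r1) h.
  move=> z; rewrite lt_min => /andP[/gh[d1 D1] /Hr1/cdiff_conj_kernel[d2 D2]].
  by eexists; apply: tdiffM D1 _; apply: tdiffM (@cdiff_sqr R z) _; exact: tdiffZ D2.
have rm : r < Num.min rho r1 by rewrite lt_min rrho.
have := mean_value r0 rm hh; rewrite /h expr0n /= mul0r !mulr0 => M.
have hc : ccont_on 0 p2 (fun t => h (circle r t)).
  by move=> t _; exact: holo_circle_cont (ltW r0) rm hh.
rewrite -[LHS]conjcK -cint_conj; last first.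
  by move=> t tt; apply: tcontM; [exact: tcont_conj (gc tt)|exact: k_cont].
rewrite -[RHS](rmorph0 (@conjc R)); congr (conjc _); rewrite -[RHS]M.
apply: eq_cint => t _; rewrite conjcM conjcK /k conjcV conjcM conjcB conj_circle//.
have z0 := circle_neq0 t r0.
have r20 : (r ^+ 2)%:C != 0 :> C by rewrite fmorph_eq0 expf_neq0// gt_eqF.
have kn : (r ^+ 2)%:C - conjc w * circle r t != 0.
  by apply: conj_kernel_neq0; rewrite cmod_circle ?ltW// expr2 ltr_pM2r.
have rC : r%:C != 0 :> C by rewrite fmorph_eq0 gt_eqF.
congr (_ * _); rewrite rmorphXn in kn.
by field; apply/and3P; split.
Qed.

(** Im g alone has no sign on the circle; Im g times sin t does. So the kernel is antisymmetrised
    until it contains a factor sin t, and the rest is integrated against the positive density of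
    mass pi r s. *)
Lemma typically_real_bound w : cmod w <= r / 2 ->
  cmod (g w - g 0 - s%:C * w) <= 20 * cmod w ^+ 2 * s / r.
Proof.
move=> w2; have wr : cmod w < r.
  by rewrite (le_lt_trans w2)// ltr_pdivrMr// ltr_pMr// ltr1n.
have wJr : cmod (conjc w) < r by rewrite cmodJ.
set D := g w - g 0 - s%:C * w.
have cg t : 0 <= t <= p2 -> rcont (fun t => conjc (g (circle r t))) t.
  by move=> tt; exact: tcont_conj (gc tt).
have cV t : 0 <= t <= p2 -> rcont (fun t => (V t)%:C) t.
  by move=> tt; apply: rcont_real; exact: (ccont_on_Im gc) tt.
have VE t : (V t)%:C = (2%:R * ii)^-1 * (g (circle r t) - conjc (g (circle r t))).
  have i0 : ii != 0 :> C by rewrite -cmod_eq0 cmodi oner_eq0.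
  rewrite subcJ /V; field; exact: i0.
have gkc v : cmod v < r -> ccont_on 0 p2 (fun t => g (circle r t) * k v t).
  by move=> vr t tt; apply: tcontM; [exact: (gc tt)|exact: k_cont].
have gJkc v : cmod v < r -> ccont_on 0 p2 (fun t => conjc (g (circle r t)) * k v t).
  by move=> vr t tt; apply: tcontM; [exact: (cg _ tt)|exact: k_cont].
have E v : cmod v < r -> v ^+ 2 * cint 0 p2 (fun t => (V t)%:C * k v t) =
    (2%:R * ii)^-1 * (p2%:C * (g v - g 0 - s%:C * v)).
  move=> vr; rewrite -remainder_kernel// mulrCA; congr (_ * _).
  rewrite -[cint 0 p2 (fun t => g _ * _)]subr0 -(conj_kernel_integral vr) -cintB//; [|exact: gkc|exact: gJkc].
  rewrite -cintZ; last by move=> t tt; apply: tcontB; [exact: gkc|exact: gJkc].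
  by apply: eq_cint => t _; rewrite VE; ring.
have E1 := E _ wr.
have wrho : cmod w < rho by rewrite (lt_trans wr).
have g0J : conjc (g 0) = g 0 by rewrite -gJ ?conjc0// cmod0 (lt_trans r0).
have DJ : g (conjc w) - g 0 - s%:C * conjc w = conjc D.
  by rewrite /D !conjcB conjcM conjc_real gJ// g0J.
have iJ : conjc (ii : C) = - ii by rewrite /=; simpc.
have n2J : conjc (2%:R : C) = 2%:R by exact: conjc_nat.
have E2 : w ^+ 2 * conjc (cint 0 p2 (fun t => (V t)%:C * k (conjc w) t)) =
    (2%:R * - ii)^-1 * (p2%:C * D).
  have -> : w ^+ 2 = conjc (conjc w ^+ 2) by rewrite !expr2 conjcM conjcK.
  rewrite -conjcM E// DJ conjcM conjcV [conjc (_ * ii)]conjcM n2J iJ.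
  by rewrite [conjc (_ * conjc D)]conjcM conjcK conjc_real.
rewrite -cint_conj in E2; last first.
  by move=> t tt; apply: tcontM; [exact: (cV _ tt)|exact: k_cont].
(* Subtracting the conjugated formula at conj(w) adds the two remainders, while the kernel becomes
   its value at z minus its value at conj(z) and thus vanishes for real z. *)
pose K t : C := k w t - conjc (k (conjc w) t).
have Kc : ccont_on 0 p2 K.
  by move=> t tt; apply: tcontB; [exact: k_cont|apply: tcont_conj; exact: k_cont].
have ED : w ^+ 2 * cint 0 p2 (fun t => (V t)%:C * K t) = - ii * (p2%:C * D).
  have -> : - ii * (p2%:C * D) = (2%:R * ii)^-1 * (p2%:C * D) - (2%:R * - ii)^-1 * (p2%:C * D).
    have i0 : ii != 0 :> C by rewrite -cmod_eq0 cmodi oner_eq0.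
    have i2 : - ii = ii^-1 :> C.
      by apply: (mulfI i0); rewrite mulfV// mulrN; simpc.
    by rewrite {1}i2; field; exact: i0.
  rewrite -E1 -E2 -mulrBr; congr (_ * _); rewrite -cintB.
  - by apply: eq_cint => t _; rewrite conjcM conjc_real /K; ring.
  - by move=> t tt; apply: tcontM; [exact: (cV _ tt)|exact: k_cont].
  - move=> t tt; apply: tcont_conj; apply: tcontM; [exact: (cV _ tt)|exact: k_cont].
(* The numerator is at most 2r|sin t| times 5r/2, and the denominator at least r^2 (r/2)^2, since
   |w| <= r/2. *)
have Kb t : cmod (K t) <= 20 / r ^+ 2 * `|sin t|.
  have z0 := circle_neq0 t r0; have zw := circle_neq t (ltW r0) wr.
  set z := circle r t in z0 zw.
  have zJw : conjc z - w != 0.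
    by rewrite -cmod_gt0 -(conjcK w) -conjcB cmodJ cmod_gt0; exact: circle_neq (ltW r0) wJr.
  have zJ0 : conjc z != 0 by rewrite conjc_eq0.
  have KE : K t = (conjc z - z) * (conjc z + z - w) / ((z * conjc z) * ((z - w) * (conjc z - w))).
    rewrite /K /k -/z conjcV conjcM conjcB conjcK.
    by field; rewrite zJ0 z0 zw zJw.
  have zr : cmod z = r by rewrite cmod_circle// ltW.
  have zJz : cmod (conjc z - z) = 2 * r * `|sin t|.
    have -> : conjc z - z = (- (2 * r * sin t))%:C * ii.
      rewrite -opprB subcJ /z cImM /= mul0r addr0 !rmorphN !rmorphM rmorph_nat /=; ring.
    by rewrite cmodM cmodi mulr1 cmodR normrN !normrM (ger0_norm (ltW r0)) normr_nat.
  have A1 : cmod (conjc z + z - w) <= 5 / 2 * r.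
    rewrite (le_trans (cmodB _ _))// (le_trans (lerD (cmodD _ _) (lexx _)))//.
    by rewrite cmodJ zr; lra.
  have A2 : r / 2 <= cmod (z - w).
    by have := circle_subr_ge t w (ltW r0); rewrite -/z => ?; lra.
  have A3 : r / 2 <= cmod (conjc z - w).
    rewrite -(conjcK w) -conjcB cmodJ.
    by have := circle_subr_ge t (conjc w) (ltW r0); rewrite -/z cmodJ => ?; lra.
  have zr' : cmod r%:C * cmod (expi t) = r by rewrite -cmodM.
  rewrite KE !(cmodM, cmodV) cmodJ zr zr' zJz.
  have P0 : 0 < r * r * (cmod (z - w) * cmod (conjc z - w)).
    by rewrite !mulr_gt0// cmod_gt0.
  rewrite ler_pdivrMr//.
  have A4 : (r / 2) * (r / 2) <= cmod (z - w) * cmod (conjc z - w).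
    by apply: ler_pM => //; rewrite divr_ge0// ltW.
  have st := normr_ge0 (sin t).
  apply: (@le_trans _ _ (2 * r * `|sin t| * (5 / 2 * r))).
    by rewrite ler_wpM2l// mulr_ge0// mulr_ge0// ltW.
  have eqle (x y : R) : x = y -> x <= y by move->.
  have Q : 20 * `|sin t| * (r / 2 * (r / 2)) <=
      20 * `|sin t| * (cmod (z - w) * cmod (conjc z - w)) by rewrite ler_wpM2l// mulr_ge0.
  apply: (le_trans _ (le_trans Q _)); apply: eqle; first by field.
  by field; rewrite gt_eqF.
have cVs : cont_on 0 p2 (fun t => V t * sin t).
  apply: cont_onM; first exact: ccont_on_Im.
  by move=> t _; exact: continuous_sin.
have cV20 : cont_on 0 p2 (fun t => 20 / r ^+ 2 * (V t * sin t)).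
  by apply: cont_onM => //; exact: cont_on_cst.
have VKc : ccont_on 0 p2 (fun t => (V t)%:C * K t).
  by move=> t tt; apply: tcontM; [exact: (cV _ tt)|exact: (Kc _ tt)].
have VK := cmod_cint_le VKc cV20.
have {}VK : cmod (cint 0 p2 (fun t => (V t)%:C * K t)) <= 2 * (20 / r ^+ 2 * (pi * r * s)).
  rewrite -V_sin_integral -integZ//; apply: VK => t _.
  rewrite cmodM cmodR -(ger0_norm (V_sin_ge0 t)) normrM mulrCA ler_wpM2l//; exact: Kb.
have := congr1 (@cmod R) ED; rewrite !cmodM cmodN cmodi mul1r cmodR -expr2.
rewrite (ger0_norm (ltW (twopi_gt0 R))) => {}ED.
rewrite -(ler_pM2l (twopi_gt0 R)) -ED.
rewrite (le_trans (ler_wpM2l (exprn_ge0 _ (cmod_ge0 _)) VK))// le_eqVlt.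
by apply/orP; left; apply/eqP; field; rewrite gt_eqF.
Qed.

End typically_real.
End positive_real_part.

(** * Primitives and logarithms in a horizontal strip *)

Section primitive.
Variable R : realType.
Local Notation C := R[i].
Variables (del : R) (L : C -> C).
Let strip (z : C) := `|complex.Im z| < del.
Hypothesis Lh : forall z, strip z -> exists d, cdiff L z d.

Definition primitive (z : C) := cint 0 1 (fun l => L (l%:C * z) * z).

Lemma strip_scale (l : R) z : 0 <= l <= 1 -> strip z -> strip (l%:C * z).
Proof.
move=> /andP[l0 l1]; rewrite /strip cImM /= mul0r addr0 normrM ger0_norm//.
by apply: le_lt_trans; rewrite ler_piMl.
Qed.

Lemma strip_open z : strip z -> exists2 k : R, 0 < k & forall h, cmod h < k -> strip (z + h).
Proof.
move=> zs; exists (del - `|complex.Im z|); first by rewrite subr_gt0.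
move=> h hk; rewrite /strip cImD (le_lt_trans (ler_normD _ _))//.
by rewrite -ltrBrDl (le_lt_trans (Im_le_cmod _)).
Qed.

(** Goursat on the triangle 0, z, z + h, viewed as the cone with apex 0 over the segment from z to z
    + h; the side at [l] = 0 degenerates to a point and contributes nothing. *)
Lemma cdiff_primitive z : strip z -> cdiff primitive z (L z).
Proof.
move=> zs e e0; have [d0 /tdiff_cont Lc] := Lh zs.
have [k k0 Hk] := Lc (e / 2) ltac:(by rewrite divr_gt0).
have [k' k'0 Hk'] := strip_open zs.
exists (Num.min k k'); first by rewrite lt_min k0.
move=> h; rewrite lt_min => /andP[hk hk'].
pose g (t : R) := z + t%:C * h.
have gd t : rdiff g t h.
  have := tdiffD (@tdiff_cst _ _ (real_complex R) z t)
    (tdiffM (@rdiff_id R t) (@tdiff_cst _ _ (real_complex R) h t)).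
  by rewrite mulr0 addr0 add0r mul1r.
have th t (t01 : 0 <= t <= 1) : cmod (t%:C * h) <= cmod h.
  case/andP: t01 => t0 t1; rewrite cmodM cmodR ger0_norm//.
  by rewrite ler_piMl ?cmod_ge0.
have gs t : 0 <= t <= 1 -> strip (g t).
  by move=> t01; apply: Hk'; rewrite (le_lt_trans (th _ t01)).
pose K := cmod z + cmod h.
have gK t : 0 <= t <= 1 -> cmod (g t - 0) <= K.
  by move=> t01; rewrite subr0 (le_trans (cmodD _ _))// lerD2l th.
have hK : cmod h <= K by rewrite lerDr cmod_ge0.
have fd l t : 0 <= l <= 1 -> 0 <= t <= 1 -> exists d, cdiff L (0 + l%:C * (g t - 0)) d.
  by move=> l01 t01; apply: Lh; rewrite add0r subr0; apply: strip_scale => //; exact: gs.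
have := goursat_rectangle (lexx 0) ler01 (lexx 1) ler01 (fun t _ => gd t)
  (fun t _ => @tcont_cst _ _ (real_complex R) h t) (fun t _ => hK) gK fd.
have -> : cint 0 1 (fun l => L (0 + l%:C * (g 0 - 0)) * (g 0 - 0)) = primitive z.
  by apply: eq_cint => l _; rewrite add0r subr0 /g mul0r addr0.
have -> : cint 0 1 (fun l => L (0 + l%:C * (g 1 - 0)) * (g 1 - 0)) = primitive (z + h).
  by apply: eq_cint => l _; rewrite add0r subr0 /g mul1r.
have -> : cint 0 1 (fun t => L (0 + 0%:C * (g t - 0)) * (0%:C * h)) = 0.
  rewrite -[RHS](_ : cint 0 1 (fun=> 0) = 0 :> C); last by rewrite cint_cst ?ler01// mul0r.
  by apply: eq_cint => l _; rewrite [0%:C * h]mul0r mulr0.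
have -> : cint 0 1 (fun t => L (0 + 1%:C * (g t - 0)) * (1%:C * h)) =
    cint 0 1 (fun t => L (g t) * h).
  by apply: eq_cint => l _; rewrite add0r subr0 !mul1r.
rewrite subr0 => E.
have Lgc : ccont_on 0 1 (fun t => L (g t) * h).
  move=> t t01; apply: tcontM; last exact: tcont_cst.
  have [d /tdiff_cont Lgc] := Lh (gs _ t01).
  exact: (tcont_comp (g := g) Lgc (tdiff_cont (gd t))).
have cc : ccont_on 0 1 (fun=> L z * h) by move=> t _; exact: tcont_cst.
have -> : primitive (z + h) - primitive z - L z * h =
    cint 0 1 (fun t => L (g t) * h - L z * h).
  rewrite cintB// cint_cst ?ler01// subr0 mulr1; apply/eqP.
  by rewrite -subr_eq0 -[X in _ == X]oppr0 -E; apply/eqP; ring.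
have -> : e * cmod h = 2 * (e / 2 * cmod h) * (1 - 0) by field.
apply: cint_bound => [|t t01|t t01]; first exact: ler01.
  by apply: tcontB; [exact: (Lgc _ t01)|exact: (cc _ t01)].
rewrite -mulrBl cmodM ler_wpM2r ?cmod_ge0//.
by apply: Hk; rewrite (le_lt_trans (th _ t01)).
Qed.

Lemma primitive0 : primitive 0 = 0.
Proof.
rewrite /primitive -[RHS](_ : cint 0 1 (fun=> 0) = 0 :> C); last by rewrite cint_cst ?ler01// mul0r.
by apply: eq_cint => l _; rewrite mulr0.
Qed.

(** The product of F and the exponential of minus the primitive has derivative 0 along rays and
    value 1 at 0. *)
Lemma exp_primitive (F : C -> C) : 0 < del -> F 0 = 1 ->
  (forall z, strip z -> cdiff F z (L z * F z)) ->
  forall z, strip z -> F z = cexp (primitive z).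
Proof.
move=> del0 F0 Fd z zs.
pose q z := F z * cexp (- primitive z).
have qd y : strip y -> cdiff q y 0.
  move=> ys; have := tdiffM (Fd _ ys)
    (tdiff_comp (@cdiff_cexp R _) (tdiffN (cdiff_primitive ys))).
  by congr tdiff; ring.
have : q z = q 0.
  have := @rdiff_constant R (fun t => q (t%:C * z)) 0 1 ler01.
  rewrite mul1r mul0r; apply => t t01.
  have := tdiff_comp (g := fun s : R => s%:C * z) (qd _ (strip_scale t01 zs))
    (tdiffM (@rdiff_id R t) (@tdiff_cst _ _ (real_complex R) z t)).
  by rewrite mul0r.
rewrite /q primitive0 oppr0 cexp0 F0 mulr1 cexpN => H.
by rewrite -[LHS](divfK (cexp_neq0 (primitive z))) H mul1r.
Qed.

End primitive.

(** * Phragmen-Lindelof principle in a strip *)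

Section phragmen_lindelof.
Variable R : realType.
Local Notation C := R[i].

Lemma second_derivative_min (f f1 : R -> R) (t f2 k : R) : 0 < k ->
  (forall s, `|s - t| < k -> is_derive s 1 f (f1 s)) -> is_derive t 1 f1 f2 ->
  (forall s, `|s - t| < k -> f t <= f s) -> 0 <= f2.
Proof.
move=> k0 fd f1d fmin.
have inI s : s \in `]t - k, t + k[ -> `|s - t| < k.
  by rewrite in_itv /= ltr_distl.
have ft0 : f1 t = 0.
  have tk : t - k <= t + k by lra.
  have tI : t \in `]t - k, t + k[ by rewrite in_itv /=; apply/andP; split; lra.
  have [_ D0] := derive1_at_min tk (fun s si => @ex_derive _ _ _ _ _ _ _ (fd s (inI s si)))
    tI (fun s si => fmin s (inI s si)).
  have [_ <-] := fd t ltac:(by rewrite subrr normr0).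
  exact: D0.
rewrite leNgt; apply/negP => f20.
have e0 : 0 < - f2 / 2 by rewrite divr_gt0// oppr_gt0.
have [k' k'0 H] := (is_derive_epsP _ _ _).1 f1d _ e0.
pose h := Num.min k k' / 2.
have h0 : 0 < h by rewrite divr_gt0// lt_min k0.
have hk : h < k by rewrite /h; have m1 : Num.min k k' <= k; [by rewrite ge_min lexx|lra].
have hk' : h < k' by rewrite /h; have m1 : Num.min k k' <= k'; [by rewrite ge_min lexx orbT|lra].
have sub s : s \in `]t, (t + h)[ -> `|s - t| < k.
  by rewrite in_itv /= => /andP[ts sh]; rewrite ltr_distl; apply/andP; split; lra.
have cf : {within `[t, t + h], continuous f}.
  apply: cont_on_within => s /andP[ts sh].
  by apply: is_derive_continuous; apply: fd; rewrite ltr_distl; apply/andP; split; lra.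
have [|c + E] := MVT _ (fun s si => fd s (sub s si)) cf; first by rewrite ltrDl.
rewrite in_itv /= => /andP[tc ch].
have : 0 <= f (t + h) - f t.
  by rewrite subr_ge0; apply: fmin; rewrite addrC addKr gtr0_norm.
rewrite E (_ : t + h - t = h); last by ring.
rewrite pmulr_lge0// => f1c.
have ct : `|c - t| < k' by rewrite gtr0_norm ?subr_gt0//; lra.
have := H _ ct; rewrite (addrC t) subrK ft0 subr0 (gtr0_norm (_ : 0 < c - t)) ?subr_gt0//.
rewrite ler_norml => /andP[_]; have : 0 < c - t by rewrite subr_gt0.
nra.
Qed.

Lemma is_derive_affine (k c t : R) : is_derive t 1 (fun s => k * s + c) k.
Proof. by apply: is_derive_eq; rewrite /GRing.scale /=; ring. Qed.

Lemma rdiff_horizontal (y t : R) : rdiff (fun s => s +i* y) t 1.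
Proof. by apply: (rdiff_mk (a := id) (b := fun=> y)). Qed.

Lemma rdiff_vertical (x t : R) : rdiff (fun s => x +i* s) t ii.
Proof. by apply: (rdiff_mk (a := fun=> x) (b := id)). Qed.

Lemma derive_horizontal (W : C -> C) (x y : R) d : cdiff W (x +i* y) d ->
  is_derive x 1 (fun s => complex.Re (W (s +i* y))) (complex.Re d).
Proof.
move=> Wd; have := tdiff_comp (g := fun s => s +i* y) Wd (rdiff_horizontal y x).
by rewrite mulr1 => /rdiff_Re.
Qed.

Lemma derive_vertical (W : C -> C) (x y : R) d : cdiff W (x +i* y) d ->
  is_derive y 1 (fun s => complex.Re (W (x +i* s))) (- complex.Im d).
Proof.
move=> Wd; have := tdiff_comp (g := fun s => x +i* s) Wd (rdiff_vertical x y).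
by move=> /rdiff_Re; rewrite cReM /= mulr0 mulr1 sub0r.
Qed.

Lemma cos_ge_cos1 (x : R) : -1 <= x <= 1 -> cos 1 <= cos x.
Proof.
wlog x0 : x / 0 <= x.
  move=> W /andP[x1 x2]; have [x0|x0] := leP 0 x; first by apply: W; rewrite ?x1.
  by rewrite -(cosN x); apply: W; [lra|apply/andP; split; lra].
move=> /andP[_]; rewrite le_eqVlt => /predU1P[->//|x1].
have pi1 : 1 <= pi :> R by rewrite (le_trans _ (@pi_ge2 R))// ler1n.
by apply: ltW; rewrite ltr_cos// in_itv /= ?x0 ?ler01 ?(le_trans (ltW x1)).
Qed.

Variables (a : R) (W W1 W2 : C -> C).
Hypothesis a0 : 0 < a.
Hypothesis W_d : forall z, 0 <= complex.Im z <= a -> cdiff W z (W1 z).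
Hypothesis W1_d : forall z, 0 <= complex.Im z <= a -> cdiff W1 z (W2 z).

(** The barrier is [ex x * cy y], that is 2 cosh(x / a) cos(2y / a - 1). The shift by 1 keeps the
    angle in [-1, 1], so the cosine is at least cos 1; the frequency 2 / a against the rate 1 / a
    makes the Laplacian -3 / a^2 times the barrier, strictly negative. The summand 0 only fits the
    shape of [is_derive_affine]. *)
Let k := a^-1.
Let ex (x : R) := expR (k * x + 0) + expR (- k * x + 0).
Let cy (y : R) := cos (2 * k * y + -1).

Lemma ex_gt0 x : 0 < ex x.
Proof. by rewrite addr_gt0 ?expR_gt0. Qed.

Lemma cy_ge y : 0 <= y <= a -> cos 1 <= cy y.
Proof.
move=> /andP[y0 ya]; apply: cos_ge_cos1.
have k0 : 0 < k by rewrite invr_gt0.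
have ky0 : 0 <= k * y by rewrite mulr_ge0// ltW.
have ky1 : k * y <= 1 by rewrite /k mulrC ler_pdivrMr// mul1r.
by apply/andP; split; lra.
Qed.

Lemma derive_ex (x : R) : is_derive x 1 ex (k * (expR (k * x + 0) - expR (- k * x + 0))).
Proof.
have := is_deriveD (is_derive1_comp (is_derive_expR _) (is_derive_affine k 0 x))
  (is_derive1_comp (is_derive_expR _) (is_derive_affine (- k) 0 x)).
move=> D; apply: is_derive_eq; ring.
Qed.

Lemma derive_ex2 (x : R) :
  is_derive x 1 (fun x => k * (expR (k * x + 0) - expR (- k * x + 0))) (k ^+ 2 * ex x).
Proof.
have := is_deriveZ k (is_deriveB (is_derive1_comp (is_derive_expR _) (is_derive_affine k 0 x))
  (is_derive1_comp (is_derive_expR _) (is_derive_affine (- k) 0 x))).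
move=> D; apply: is_derive_eq; rewrite /ex /GRing.scale /=; ring.
Qed.

Lemma derive_cy (y : R) : is_derive y 1 cy (- (2 * k) * sin (2 * k * y + -1)).
Proof.
have := is_derive1_comp (is_derive_cos _) (is_derive_affine (2 * k) (-1) y).
move=> D; apply: is_derive_eq; ring.
Qed.

Lemma derive_cy2 (y : R) :
  is_derive y 1 (fun y => - (2 * k) * sin (2 * k * y + -1)) (- (4 * k ^+ 2) * cy y).
Proof.
have := is_deriveZ (- (2 * k)) (is_derive1_comp (is_derive_sin _) (is_derive_affine (2 * k) (-1) y)).
move=> D; apply: is_derive_eq; rewrite /cy /GRing.scale /=; ring.
Qed.

Hypothesis W_bottom : forall x : R, 0 <= complex.Re (W (x +i* 0)).
Hypothesis W_top : forall x : R, 0 <= complex.Re (W (x +i* a)).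
Hypothesis W_growth : forall e x0 : R, 0 < e -> exists2 r, x0 < r &
  forall y, 0 <= y <= a -> - (e * ex r) <= complex.Re (W (r +i* y)) /\
    - (e * ex r) <= complex.Re (W ((- r) +i* y)).

Let z (e : R) (p : R * R) := complex.Re (W (p.1 +i* p.2)) + e * (ex p.1 * cy p.2).

Lemma z_continuous (e : R) (p : R * R) : 0 <= p.2 <= a -> {for p, continuous (z e)}.
Proof.
move=> pa; apply: cvgD.
  have Wc : ccont W (p.1 +i* p.2) := tdiff_cont (W_d (z := p.1 +i* p.2) pa).
  apply/cvgrPdist_le => eta eta0; have [r r0 Hr] := Wc _ eta0.
  have r2 : 0 < r / 2 by rewrite divr_gt0.
  exists (ball p.1 (r / 2), ball p.2 (r / 2)) => /=.
    by split; exact: nbhsx_ballx.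
  move=> q /= [/= q1 q2]; rewrite distrC -cReN -cReD (le_trans (Re_le_cmod _))//.
  have -> : q.1 +i* q.2 = p.1 +i* p.2 + ((q.1 - p.1) +i* (q.2 - p.2)).
    by simpc; rewrite !(addrC p.1) !(addrC p.2) !subrK.
  apply: Hr; rewrite (le_lt_trans (cmod_le_ReIm _))//= (splitr r).
  by rewrite ltrD// distrC.
apply: cvgM; first exact: cvg_cst.
apply: cvgM.
  apply: (@continuous_comp _ _ _ fst ex); first exact: cvg_fst.
  exact: is_derive_continuous (derive_ex _).
apply: (@continuous_comp _ _ _ snd cy); first exact: cvg_snd.
exact: is_derive_continuous (derive_cy _).
Qed.

(** Adding a small multiple of a positive strictly superharmonic barrier to the harmonic Re W
    excludes an interior minimum on a rectangle. [W_growth] is needed only at one abscissa beyond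
    each bound, which is what a liminf provides. *)
Lemma phragmen_lindelof_strip (x y : R) : 0 <= y <= a -> 0 <= complex.Re (W (x +i* y)).
Proof.
move=> ya; apply/ler_addgt0Pl => e' e'0.
have c10 : 0 < cos 1 :> R := cos1_gt0 R.
have Bgt0 (p : R * R) : 0 <= p.2 <= a -> 0 < ex p.1 * cy p.2.
  by move=> pa; rewrite mulr_gt0 ?ex_gt0// (lt_le_trans c10)// cy_ge.
have B0 := Bgt0 (x, y) ya; rewrite /= in B0.
(* Normalised so that the barrier contributes exactly [e'] at the given point. *)
pose e := e' / (ex x * cy y).
have e0 : 0 < e by rewrite divr_gt0.
(* The factor cos 1 compensates for the smallest value of the cosine on the vertical sides. *)
have [r xr Hr] := W_growth `|x| (mulr_gt0 e0 c10).
have r0 : 0 < r by rewrite (le_lt_trans _ xr).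
pose A := `[- r, r] `*` `[0, a].
have cA : compact A by apply: compact_setX; exact: segment_compact.
have A0 : A !=set0.
  by exists (0, 0); split; rewrite /= in_itv /= ?lexx ?oppr_le0 ?ltW.
have inA p : A p -> 0 <= p.2 <= a.
  by move=> [_]; rewrite /= in_itv.
have cz : {within A, continuous (z e)}.
  apply: continuous_in_subspaceT => p; rewrite inE => /inA; exact: z_continuous.
have [p0 + pmin] := compact_EVT_min A0 cA cz; rewrite inE => Ap0.
suff zp0 : 0 <= z e p0.
  have xyA : (x, y) \in A.
    rewrite inE; split; rewrite /= in_itv //=.
    by rewrite -ler_norml ltW.
  have := le_trans zp0 (pmin _ xyA); rewrite /z /= /e divfK ?gt_eqF// addrC.
  by [].
have pa := inA _ Ap0.
rewrite leNgt; apply/negP => zneg.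
have side s : 0 <= s <= a -> e * cos 1 * ex r <= e * (ex r * cy s).
  by move=> /cy_ge sc; rewrite -mulrA ler_pM2l// mulrC ler_pM2l// ex_gt0.
have exN s : ex (- s) = ex s by rewrite /ex !mulrN !mulNr opprK addrC.
have x1 : - r < p0.1 < r.
  move: Ap0 => [/= + _]; rewrite in_itv /= => /andP[]; rewrite !le_eqVlt.
  case/predU1P => [E|->] /=; last first.
    case/predU1P => // E; exfalso; move: zneg; rewrite ltNge; case/negP.
    rewrite /z E; have [h _] := Hr _ pa; have := side _ pa => ?; lra.
  exfalso; move: zneg; rewrite ltNge; case/negP.
  rewrite /z -E exN; have [_ h] := Hr _ pa; have := side _ pa => ?; lra.
have y1 : 0 < p0.2 < a.
  have B1 := ltW (mulr_gt0 e0 (Bgt0 _ pa)).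
  move: (pa) => /andP[]; rewrite !le_eqVlt.
  case/predU1P => [E|->] /=; last first.
    case/predU1P => // E; exfalso; move: zneg; rewrite ltNge; case/negP.
    by rewrite /z in B1 *; rewrite addr_ge0// E W_top.
  exfalso; move: zneg; rewrite ltNge; case/negP.
  by rewrite /z in B1 *; rewrite addr_ge0// -E W_bottom.
have /andP[x1l x1r] := x1; have /andP[y1l y1r] := y1.
pose kk := Num.min (Num.min (p0.1 + r) (r - p0.1)) (Num.min p0.2 (a - p0.2)).
have kk0 : 0 < kk by rewrite !lt_min; apply/andP; split; apply/andP; split; lra.
have kb s t : `|s - t| < kk -> [/\ s < t + kk, t - kk < s,
    kk <= p0.1 + r & kk <= r - p0.1] /\ kk <= p0.2 /\ kk <= a - p0.2.
  rewrite ltr_distl => /andP[h1 h2]; split; split => //; by rewrite /kk !ge_min lexx ?orbT.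
have zx : 0 <= complex.Re (W2 (p0.1 +i* p0.2)) + e * (k ^+ 2 * ex p0.1 * cy p0.2).
  apply: (@second_derivative_min (fun s => z e (s, p0.2))
    (fun s => complex.Re (W1 (s +i* p0.2)) +
       (e * cy p0.2) * (k * (expR (k * s + 0) - expR (- k * s + 0)))) p0.1 _ kk) => //.
  - move=> s _; have D1 := derive_horizontal (W_d (z := s +i* p0.2) pa).
    have D2 := is_deriveZ (e * cy p0.2) (derive_ex s).
    have := is_deriveD D1 D2; congr (is_derive _ _ _ _).
    apply/funext => u.
    rewrite [LHS](_ : _ = complex.Re (W (u +i* p0.2)) + (e * cy p0.2) * ex u) //.
    by rewrite /z /=; ring.
  - have D1 := derive_horizontal (W1_d (z := p0.1 +i* p0.2) pa).
    have D2 := is_deriveZ (e * cy p0.2) (derive_ex2 p0.1).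
    have := is_deriveD D1 D2; congr (is_derive _ _ _ _).
    by rewrite /GRing.scale /=; ring.
  - move=> s /kb[[h1 h2 h3 h4] _].
    have -> : (p0.1, p0.2) = p0 by case: (p0).
    apply: pmin; rewrite inE; split; rewrite /= in_itv //=.
    by apply/andP; split; lra.
have zy : 0 <= - complex.Re (W2 (p0.1 +i* p0.2)) + e * (ex p0.1 * (- (4 * k ^+ 2) * cy p0.2)).
  apply: (@second_derivative_min (fun s => z e (p0.1, s))
    (fun s => - complex.Im (W1 (p0.1 +i* s)) +
       (e * ex p0.1) * (- (2 * k) * sin (2 * k * s + -1))) p0.2 _ kk) => //.
  - move=> s /kb[[h1 h2 _ _] [h3 h4]].
    have sa : 0 <= complex.Im (p0.1 +i* s) <= a by apply/andP; split => /=; lra.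
    have D1 := derive_vertical (W_d sa).
    have D2 := is_deriveZ (e * ex p0.1) (derive_cy s).
    have := is_deriveD D1 D2; congr (is_derive _ _ _ _).
    apply/funext => u.
    rewrite [LHS](_ : _ = complex.Re (W (p0.1 +i* u)) + (e * ex p0.1) * cy u) //.
    by rewrite /z /=; ring.
  - have D1 := rdiff_Im (tdiff_comp (g := fun s => p0.1 +i* s) (W1_d (z := p0.1 +i* p0.2) pa)
      (rdiff_vertical p0.1 p0.2)).
    have D2 := is_deriveZ (e * ex p0.1) (derive_cy2 p0.2).
    have := is_deriveD (is_deriveN D1) D2; congr (is_derive _ _ _ _).
    by rewrite /GRing.scale cImM /=; ring.
  - move=> s /kb[[h1 h2 _ _] [h3 h4]].
    have -> : (p0.1, p0.2) = p0 by case: (p0).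
    apply: pmin; rewrite inE; case: (Ap0) => Ap1 _; split; rewrite //= in_itv /=.
    by apply/andP; split; lra.
have k0 : 0 < k by rewrite invr_gt0.
(* The second derivatives of Re W cancel, as it is harmonic, and only the negative Laplacian of the
   barrier remains. *)
have := addr_ge0 zx zy; rewrite leNgt; case/negP.
have -> : complex.Re (W2 (p0.1 +i* p0.2)) + e * (k ^+ 2 * ex p0.1 * cy p0.2) +
  (- complex.Re (W2 (p0.1 +i* p0.2)) + e * (ex p0.1 * (- (4 * k ^+ 2) * cy p0.2))) =
  - (3 * k ^+ 2 * (e * (ex p0.1 * cy p0.2))) by ring.
rewrite oppr_lt0; apply: mulr_gt0; first by rewrite mulr_gt0 ?exprn_gt0.
by apply: mulr_gt0 => //; exact: Bgt0.
Qed.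

End phragmen_lindelof.

(** * Zero-free strips *)

Section monotone.
Variable R : realType.
Implicit Types (f : R -> R).

Lemma derive_le0 f (f' : R -> R) (a b : R) : a <= b ->
  (forall t, a <= t <= b -> is_derive t 1 f (f' t)) ->
  (forall t, a <= t <= b -> f' t <= 0) -> f b <= f a.
Proof.
move=> ab fd f0.
have fd' t : t \in `]a, b[ -> is_derive t 1 f (f' t).
  by rewrite in_itv /= => /andP[/ltW ? /ltW ?]; apply: fd; apply/andP.
have cf : {within `[a, b], continuous f}.
  by apply: cont_on_within => t tab; exact: is_derive_continuous (fd t tab).
have [c + E] := MVT_segment ab fd' cf.
rewrite in_itv /= => /f0 c0; rewrite -subr_le0 E mulr_le0_ge0// subr_ge0//.
Qed.

Lemma derive_ge0_of_min f (a t d : R) : 0 < a -> is_derive t 1 f d ->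
  (forall h, 0 <= h <= a -> f t <= f (t + h)) -> 0 <= d.
Proof.
move=> a0 /is_derive_epsP fd fmin; rewrite leNgt; apply/negP => d0.
have e0 : 0 < - d / 2 by rewrite divr_gt0// oppr_gt0.
have [k k0 H] := fd _ e0.
pose h := Num.min a (k / 2).
have h0 : 0 < h by rewrite lt_min a0 divr_gt0.
have ha : h <= a by rewrite ge_min lexx.
have hk : h <= k / 2 by rewrite ge_min lexx orbT.
have := H h; rewrite gtr0_norm// => /(_ ltac:(lra)).
rewrite ler_norml => /andP[_].
have := fmin h; rewrite (ltW h0) ha => /(_ isT); nra.
Qed.

End monotone.

Section zero_free_strip.
Variable R : realType.
Local Notation C := R[i].
Variables (F F1 F2 : C -> C) (fr : R -> R) (mu sg2 del : R).
Hypothesis F_d : forall z, cdiff F z (F1 z).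
Hypothesis F1_d : forall z, cdiff F1 z (F2 z).
Hypothesis F_real : forall x : R, F x%:C = (fr x)%:C.
Hypothesis fr0 : fr 0 = 1.
Hypothesis fr_lb : forall x : R, expR (mu * x) <= fr x.
Hypothesis fr_mono : forall x r : R, `|x| <= r -> fr x <= fr r + fr (- r).
Hypothesis ridge : forall z, cmod (F z) <= fr (complex.Re z).
Hypothesis F_conj : forall z, F (conjc z) = conjc (F z).
Hypothesis F1_conj : forall z, F1 (conjc z) = conjc (F1 z).
Hypothesis F1_0 : F1 0 = mu%:C.
Hypothesis F2_0 : F2 0 = (sg2 + mu ^+ 2)%:C.
Hypothesis del0 : 0 < del.
Hypothesis nz : forall z, `|complex.Im z| < del -> F z != 0.
Hypothesis growth : forall eta x0 : R, 0 < eta -> exists2 r, x0 < r &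
  ln (fr r + fr (- r)) <= 1 + expR (eta * r).

Let L z := F1 z / F z.
Let L1 z := (F2 z * F z - F1 z * F1 z) / (F z) ^+ 2.
Let H := primitive L.
Let Lr r := ln (fr r + fr (- r)).

Lemma fr_gt0 x : 0 < fr x.
Proof. by rewrite (lt_le_trans _ (fr_lb x))// expR_gt0. Qed.

Lemma L_d z : `|complex.Im z| < del -> cdiff L z (L1 z).
Proof.
move=> zs; have Fz := nz zs.
have := tdiffM (F1_d z) (tdiff_comp (cdiffV Fz) (F_d z)).
by congr tdiff; rewrite /L1; field.
Qed.

Lemma L_ex z : `|complex.Im z| < del -> exists d, cdiff L z d.
Proof. by move=> /L_d zd; exists (L1 z). Qed.

Lemma H_d z : `|complex.Im z| < del -> cdiff H z (L z).
Proof. by move=> zs; exact: (cdiff_primitive L_ex zs). Qed.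

Lemma F_expH z : `|complex.Im z| < del -> F z = cexp (H z).
Proof.
apply: (exp_primitive L_ex) => //; first by rewrite (F_real 0) fr0.
by move=> y ys; rewrite /L divfK ?nz.
Qed.

Lemma u_exp z : `|complex.Im z| < del -> expR (complex.Re (H z)) = cmod (F z).
Proof. by move=> zs; rewrite F_expH// cmod_cexp. Qed.

Lemma u_conj z : `|complex.Im z| < del ->
  complex.Re (H (conjc z)) = complex.Re (H z).
Proof.
move=> zs; apply: (@expR_inj R); rewrite !u_exp ?F_conj ?cmodJ//.
by rewrite cImJ normrN.
Qed.

Lemma real_in_strip (x : R) : `|complex.Im x%:C| < del.
Proof. by rewrite /= normr0. Qed.

Lemma u_real x : expR (complex.Re (H x%:C)) = fr x.
Proof.
rewrite u_exp; last exact: real_in_strip.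
by rewrite F_real cmodR gtr0_norm// fr_gt0.
Qed.

Lemma u_ridge z : `|complex.Im z| < del ->
  complex.Re (H z) <= complex.Re (H (complex.Re z)%:C).
Proof. by move=> zs; rewrite -ler_expR u_real u_exp. Qed.

Lemma u_le z r : `|complex.Im z| < del -> `|complex.Re z| <= r ->
  complex.Re (H z) <= Lr r.
Proof.
move=> zs zr; have P0 : 0 < fr r + fr (- r) by rewrite addr_gt0 ?fr_gt0.
by rewrite -ler_expR u_exp// lnK ?posrE// (le_trans (ridge _))// fr_mono.
Qed.

Lemma u_real_ge x : mu * x <= complex.Re (H x%:C).
Proof. by rewrite -ler_expR u_real. Qed.

(** The function [Lr r - H] has nonnegative real part on the disc of radius [rho] about x + is;
    [gradient_estimate] at radius rho / 2 gives the constant 8. *)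
Lemma L_bound (x s rho r : R) : 0 < rho -> `|x| + rho <= r -> `|s| + rho <= del ->
  cmod (L (x +i* s)) <= 8 / rho * (Lr r - complex.Re (H (x +i* s))).
Proof.
move=> rho0 xr sd; pose c := x +i* s.
pose G z := (Lr r)%:C - H (c + z).
have cz z : cmod z < rho -> `|complex.Im (c + z)| < del.
  move=> zr; rewrite cImD /= (le_lt_trans (ler_normD _ _))//.
  by rewrite (lt_le_trans _ sd)// ltrD2l (le_lt_trans (Im_le_cmod _)).
have Gd z : cmod z < rho -> cdiff G z (- L (c + z)).
  move=> /cz zs.
  have := tdiffB (@tdiff_cst _ _ id (Lr r)%:C z)
    (tdiff_comp (g := fun z => c + z) (H_d zs)
      (tdiffD (@tdiff_cst _ _ id c z) (@cdiff_id R z))).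
  by rewrite sub0r add0r mulr1.
have Gh : holo_disc rho G by move=> z /Gd zd; eexists; exact: zd.
have Gpos z : cmod z < rho -> 0 <= complex.Re (G z).
  move=> zr; rewrite cReD cReN /= subr_ge0; apply: u_le; first exact: cz.
  rewrite cReD /= (le_trans (ler_normD _ _))// (le_trans _ xr)// lerD2l.
  by rewrite (le_trans (Re_le_cmod _))// ltW.
have c00 : cmod (0 : C) < rho by rewrite cmod0.
have r2 : 0 < rho / 2 by rewrite divr_gt0.
have rr : rho / 2 < rho by lra.
have := gradient_estimate r2 rr Gh Gpos (Gd 0 c00).
rewrite cmodN /G addr0 cReD cReN /=.
by rewrite (_ : 4 / (rho / 2) = 8 / rho)//; field; rewrite gt_eqF.
Qed.

(** By [L_bound] the vertical derivative of p = Lr r - Re H is at most (8 / rho) p, so p times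
    exp(-8s / rho) decreases. This carries a lower bound of Re H from the real axis into the
    strip. *)
Lemma harnack (x y rho r : R) : 0 < rho -> `|x| + rho <= r -> 0 <= y -> y + rho <= del ->
  Lr r - complex.Re (H (x +i* y)) <=
  expR (8 / rho * y) * (Lr r - complex.Re (H x%:C)).
Proof.
move=> rho0 xr y0 yd.
pose p s := Lr r - complex.Re (H (x +i* s)).
pose E s : R := expR (- (8 / rho) * s + 0).
have inS s : 0 <= s <= y -> `|complex.Im (x +i* s)| < del.
  by move=> /andP[s0 sy] /=; rewrite ger0_norm//; lra.
have pd s : 0 <= s <= y -> is_derive s 1 (fun s => p s * E s)
    ((complex.Im (L (x +i* s)) - 8 / rho * p s) * E s).
  move=> sy; have D1 := derive_vertical (H_d (inS s sy)).
  have D2 := is_derive1_comp (is_derive_expR _) (is_derive_affine (- (8 / rho)) 0 s).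
  have := is_deriveM (is_deriveB (is_derive_cst (Lr r) s 1) D1) D2.
  move=> D; apply: is_derive_eq.
  rewrite [LHS](_ : _ = p s * (E s * - (8 / rho)) + E s * (0 - - complex.Im (L (x +i* s)))) //.
  by ring.
have ple : p y * E y <= p 0 * E 0.
  apply: (derive_le0 y0 pd) => s sy.
  rewrite mulr_le0_ge0 ?expR_ge0// subr_le0 (le_trans (ler_norm _))//.
  rewrite (le_trans (Im_le_cmod _))// L_bound//.
  by case/andP: sy => s0 sy; rewrite ger0_norm//; lra.
have E0 : E 0 = 1 by rewrite /E mulr0 addr0 expR0.
rewrite E0 mulr1 /E addr0 mulNr expRN in ple.
by rewrite mulrC -ler_pdivrMr// expR_gt0.
Qed.

Section finite_shift.
Variable a : R.
Hypotheses (a0 : 0 < a) (ad : a < del / 2).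

(** The condition a < del / 2 keeps both shifted points in the zero-free strip while Im z runs over
    [0, a]. On the bottom line the two points are conjugate; on the top line one of them is real,
    where the ridge property compares them. *)
Let W z := H (z - (0 +i* a)) - H (z + (0 +i* a)).
Let W1 z := L (z - (0 +i* a)) - L (z + (0 +i* a)).
Let W2 z := L1 (z - (0 +i* a)) - L1 (z + (0 +i* a)).

Lemma shift_in_strip z : 0 <= complex.Im z <= a ->
  `|complex.Im (z - (0 +i* a))| < del /\ `|complex.Im (z + (0 +i* a))| < del.
Proof.
have [a0' ad'] := (a0, ad).
move=> /andP[z0 za]; rewrite !cImD cImN /=.
by split; rewrite ltr_norml; apply/andP; split; lra.
Qed.

Lemma cdiff_shift (f f' : C -> C) z c : cdiff f (z + c) (f' (z + c)) ->
  cdiff (fun z => f (z + c)) z (f' (z + c)).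
Proof.
move=> fd; have := tdiff_comp (g := fun z => z + c) fd
  (tdiffD (@cdiff_id R z) (@tdiff_cst _ _ id c z)).
by rewrite addr0 mulr1.
Qed.

Lemma W_d z : 0 <= complex.Im z <= a -> cdiff W z (W1 z).
Proof.
by move=> /shift_in_strip[z1 z2]; apply: tdiffB; apply: cdiff_shift; exact: H_d.
Qed.

Lemma W1_d z : 0 <= complex.Im z <= a -> cdiff W1 z (W2 z).
Proof.
by move=> /shift_in_strip[z1 z2]; apply: tdiffB; apply: cdiff_shift; exact: L_d.
Qed.

Lemma WE x y : W (x +i* y) = H (x +i* (y - a)) - H (x +i* (y + a)).
Proof. by rewrite /W; simpc. Qed.

Lemma Re_W_bottom x : complex.Re (W (x +i* 0)) = 0.
Proof.
have [a0' ad'] := (a0, ad).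
rewrite WE sub0r add0r cReD cReN -u_conj ?conjcE /= ?normrN ?ger0_norm ?ltW ?opprK ?subrr//.
by lra.
Qed.

(** The upper point costs at most [Lr r]; the lower one is bounded from below by Harnack and by Re H
    >= mu x on the axis. The loss is O(exp(eta r)), against a barrier of size exp(2 eta r). *)
Lemma W_growth e x0 : 0 < e -> exists2 r, x0 < r & forall y, 0 <= y <= a ->
  - (e * (expR (a^-1 * r + 0) + expR (- a^-1 * r + 0))) <= complex.Re (W (r +i* y)) /\
  - (e * (expR (a^-1 * r + 0) + expR (- a^-1 * r + 0))) <= complex.Re (W ((- r) +i* y)).
Proof.
have [a0' ad'] := (a0, ad).
move=> e0; pose rho := del - a.
have rho0 : 0 < rho by rewrite /rho; lra.
pose Ce := expR (8 / rho * a); have Ce0 : 0 < Ce := expR_gt0 _.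
(* Half the rate 1 / a of the barrier, so that exp(eta r) is left over to absorb every constant. *)
pose eta := (2 * a)^-1; have eta0 : 0 < eta by rewrite invr_gt0 mulr_gt0.
pose M := 2 + `|mu| / eta.
have M0 : 0 < M by rewrite ltr_pwDl// divr_ge0// ltW.
(* All constants to be absorbed, including the loss exp(rho / a) from moving the side to r - rho; r
   is taken so large that Q <= eta r. *)
pose Q := Ce * M * expR (rho / a) / e.
have [r hr Hr] := growth (Num.max (Num.max x0 0 + rho) (Q / eta)) eta0.
have hr1 : Num.max x0 0 + rho < r by rewrite (le_lt_trans _ hr)// le_max lexx.
have hr2 : Q / eta < r by rewrite (le_lt_trans _ hr)// le_max lexx orbT.
have x0m : x0 <= Num.max x0 0 by rewrite le_max lexx.
have m0 : 0 <= Num.max x0 0 by rewrite le_max lexx orbT.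
(* Discs of radius [rho] about the vertical side must stay in |Re z| <= r for Harnack's
   inequality. *)
exists (r - rho); first by lra.
have r0 : 0 < r by lra.
have r0' : 0 <= r - rho by lra.
have LrB : Lr r + `|mu| * r <= M * expR (eta * r).
  have e1 : 1 + eta * r <= expR (eta * r) by exact: expR_ge1Dx.
  have er0 : 0 <= eta * r by rewrite mulr_ge0// ltW.
  have : `|mu| * r <= `|mu| / eta * expR (eta * r).
    rewrite -mulrA ler_wpM2l// mulrC ler_pdivlMr// mulrC; lra.
  rewrite /M mulrDl; rewrite /Lr; lra.
have main : Ce * (Lr r + `|mu| * r) <= e * expR (a^-1 * (r - rho)).
  rewrite (le_trans (ler_wpM2l (ltW Ce0) LrB))// mulrA.
  have -> : a^-1 * (r - rho) = eta * r + (eta * r - rho / a).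
    by rewrite /eta; field; rewrite gt_eqF.
  rewrite expRD (mulrC (expR _) (expR _)) mulrA ler_wpM2r ?expR_ge0//.
  rewrite expRD expRN mulrA ler_pdivlMr ?expR_gt0// mulrC.
  rewrite -ler_pdivrMl//.
  have : Q <= eta * r by rewrite mulrC -ler_pdivrMr// ltW.
  have := expR_ge1Dx (eta * r); rewrite /Q => h1 h2.
  by rewrite mulrC; lra.
have side x y : 0 <= y <= a -> `|x| = r - rho ->
    - (e * (expR (a^-1 * (r - rho) + 0) + expR (- a^-1 * (r - rho) + 0))) <=
    complex.Re (W (x +i* y)).
  move=> /andP[y0 ya] xr; rewrite WE cReD cReN.
  have h1 : complex.Re (H (x +i* (y + a))) <= Lr r.
    by apply: u_le; rewrite /= ?xr ?ger0_norm; lra.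
  have -> : complex.Re (H (x +i* (y - a))) = complex.Re (H (x +i* (a - y))).
    rewrite -u_conj; first by rewrite conjcE /= opprB.
    by rewrite /= distrC ger0_norm; lra.
  have h2 : Lr r - complex.Re (H (x +i* (a - y))) <=
      expR (8 / rho * (a - y)) * (Lr r - complex.Re (H x%:C)).
    by apply: harnack => //; rewrite ?xr /rho; lra.
  have h3 : 0 <= Lr r - complex.Re (H x%:C).
    by rewrite subr_ge0; apply: u_le; rewrite /= ?normr0// xr; lra.
  have h4 : Lr r - complex.Re (H x%:C) <= Lr r + `|mu| * r.
    rewrite lerD2l lerNl (le_trans _ (u_real_ge x))// lerNl.
    rewrite (le_trans (ler_norm _))// normrN normrM ler_wpM2l// xr; lra.
  have h5 : expR (8 / rho * (a - y)) <= Ce.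
    by rewrite ler_expR ler_wpM2l ?divr_ge0 ?(ltW rho0)//; lra.
  have h6 : expR (8 / rho * (a - y)) * (Lr r - complex.Re (H x%:C)) <=
      Ce * (Lr r + `|mu| * r) by rewrite ler_pM ?expR_ge0.
  have h7 : 0 <= e * expR (- a^-1 * (r - rho)) by rewrite mulr_ge0 ?expR_ge0 ?ltW.
  rewrite !addr0; lra.
move=> y ya; split; apply: side => //; rewrite ?normrN; exact: ger0_norm.
Qed.

(** For this fixed [a], Re W vanishes on the real axis and is nonnegative above it, hence its
    vertical derivative there is nonnegative. Conjugation symmetry makes this derivative twice Im
    L(x + ia). *)
Lemma Im_L_ge0 x : 0 <= complex.Im (L (x +i* a)).
Proof.
have [a0' ad'] := (a0, ad).
have Wtop (t : R) : 0 <= complex.Re (W (t +i* a)).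
  rewrite WE subrr cReD cReN subr_ge0 [X in _ <= X](_ : _ = complex.Re (H t%:C))//.
  by apply: u_ridge => /=; rewrite ger0_norm; lra.
have Wbot (t : R) : 0 <= complex.Re (W (t +i* 0)) by rewrite Re_W_bottom.
have PL := phragmen_lindelof_strip a0 W_d W1_d Wbot Wtop W_growth.
have i0 : 0 <= complex.Im (x +i* 0) <= a by rewrite /= lexx ltW.
have D := derive_vertical (W_d i0).
have := derive_ge0_of_min a0 D.
have -> : - complex.Im (W1 (x +i* 0)) = 2 * complex.Im (L (x +i* a)).
  rewrite /W1; simpc; rewrite cImD cImN ?sub0r ?add0r.
  have -> : L (x +i* - a) = conjc (L (x +i* a)).
    by rewrite /L conjcM conjcV -F1_conj -F_conj.
  by rewrite cImJ; ring.
rewrite pmulr_rge0// => -> // h ha.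
by rewrite Re_W_bottom add0r PL.
Qed.

End finite_shift.

Lemma L_conj z : L (conjc z) = conjc (L z).
Proof. by rewrite /L F1_conj F_conj conjcM conjcV. Qed.

(** The bound for typically real functions at radius del / 4, whence 80 = 20 * 4; the derivative of
    [L] at 0 is the variance. Positivity is known only for heights below del / 2, which fixes the
    larger disc. *)
Lemma L_taylor (w : C) : cmod w <= del / 8 ->
  cmod (L w - mu%:C - sg2%:C * w) <= 80 * cmod w ^+ 2 * sg2 / del.
Proof.
have del0' := del0.
move=> wd; have r0 : 0 < del / 4 by rewrite divr_gt0.
have rr : del / 4 < del / 2 by lra.
have instrip z : cmod z < del / 2 -> `|complex.Im z| < del.
  by move=> zr; have := Im_le_cmod z; lra.
have Lh : holo_disc (del / 2) L by move=> z /instrip /L_ex.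
have F00 : F 0 = 1 by rewrite (F_real 0) fr0.
have Lpos z : cmod z < del / 2 -> 0 <= complex.Im z -> 0 <= complex.Im (L z).
  case: z => x y zr /=; rewrite le_eqVlt => /predU1P[<-|y0].
    have /(congr1 (@complex.Im R)) := L_conj x%:C; rewrite conjc_real cImJ /= => E.
    by rewrite -[x +i* 0]/(x%:C); lra.
  apply: Im_L_ge0 => //; rewrite (le_lt_trans _ zr)//.
  by rewrite (le_trans _ (Im_le_cmod _))//= ler_norm.
have Ld : cdiff L 0 sg2%:C.
  have := L_d (real_in_strip 0); congr tdiff.
  rewrite /L1 F00 F1_0 F2_0 expr1n divr1 mulr1 -rmorphM -rmorphB /=.
  by congr (_ %:C); ring.
have L0 : L 0 = mu%:C by rewrite /L F00 F1_0 divr1.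
have := typically_real_bound r0 rr Lh (fun z _ => L_conj z) Lpos Ld (w := w).
rewrite L0 => /(_ ltac:(lra)) /le_trans; apply.
by rewrite le_eqVlt; apply/orP; left; apply/eqP; field; rewrite gt_eqF.
Qed.

(** Integration of [L_taylor] along the imaginary axis. The factor s^2 is bounded by t^2 instead of
    being integrated, and [rdiff_mean] doubles 80 to 160. *)
Lemma zero_free_strip_normal t : 0 <= t -> t <= del / 8 ->
  exists rem : C, F (0 +i* t) = cexp ((- (sg2 * t ^+ 2 / 2)) +i* (mu * t) + rem) /\
    cmod rem <= 160 * sg2 * t ^+ 3 / del.
Proof.
have del0' := del0.
move=> t0 td.
pose q s := H (0 +i* s) - ((- (sg2 * s ^+ 2 / 2)) +i* (mu * s)).
have inS s : 0 <= s <= t -> `|complex.Im ((0 : R) +i* s)| < del.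
  by move=> /andP[s0 st] /=; rewrite ger0_norm//; lra.
have qd s : 0 <= s <= t ->
    rdiff q s (ii * (L (0 +i* s) - mu%:C - sg2%:C * (0 +i* s))).
  move=> st; have D1 := tdiff_comp (g := fun s => 0 +i* s) (H_d (inS s st)) (rdiff_vertical 0 s).
  have D2 : is_derive s 1 (fun s => - (sg2 * s ^+ 2 / 2)) (- (sg2 * s)).
    by apply: is_derive_eq; rewrite /GRing.scale /=; field.
  have D3 : is_derive s 1 (fun s => mu * s) mu.
    by apply: is_derive_eq; rewrite /GRing.scale /=; ring.
  have := tdiffB D1 (rdiff_mk D2 D3); congr tdiff.
  by case: (L _) => u v; simpc; congr (_ +i* _); ring.
have q0 : q 0 = 0.
  rewrite /q /H -[0 +i* 0]/(0 : C) primitive0.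
  by rewrite expr0n /= mulr0 mul0r oppr0 mulr0 subr0.
exists (q t); split.
  by rewrite F_expH ?inS ?lexx ?andbT// /q addrC subrK.
have -> : 160 * sg2 * t ^+ 3 / del = 2 * (80 * t ^+ 2 * sg2 / del) * (t - 0) by ring.
rewrite -[q t]subr0 -[X in _ - X]q0; apply: (rdiff_mean t0 qd) => s /andP[s0 st].
have cs : cmod ((0 : R) +i* s) = s by rewrite cmodE /= expr0n /= add0r sqrtr_sqr ger0_norm.
rewrite cmodM cmodi mul1r (le_trans (L_taylor _)) ?cs//; first by lra.
(* No sign is assumed for [sg2]; it is forced by the estimate, whose left side is a modulus. *)
have sg0 : 0 <= sg2.
  have d8 : cmod ((0 : R) +i* (del / 8)) <= del / 8.
    by rewrite cmodE /= expr0n /= add0r sqrtr_sqr ger0_norm// divr_ge0// ltW.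
  have := le_trans (cmod_ge0 _) (L_taylor d8).
  rewrite pmulr_lge0 ?invr_gt0// pmulr_rge0// mulr_gt0// exprn_gt0// cmod_gt0.
  by rewrite eq_complex /= negb_and orbC gt_eqF// divr_gt0.
have : s ^+ 2 <= t ^+ 2 by rewrite lerXn2r ?nnegrE//; lra.
move=> s2; rewrite ler_wpM2r ?invr_ge0 ?(ltW del0)// ler_wpM2r//; lra.
Qed.

End zero_free_strip.

(** * Exponential moments *)

Section exponential_moments.
Context d (T : measurableType d) (R : realType) (P : probability T R).
Local Notation C := R[i].
Variable X : {RV P >-> R}.
Implicit Types (g h : T -> R) (k : nat) (tr : R -> R) (z : C).

Definition Ex (g : T -> R) : R := \int[P]_w g w.
Definition Pint (g : T -> R) := P.-integrable setT (EFin \o g).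

Lemma ExD g h : Pint g -> Pint h -> Ex (fun w => g w + h w) = Ex g + Ex h.
Proof. by move=> ig ih; apply: RintegralD. Qed.

Lemma ExZ c g : Pint g -> Ex (fun w => c * g w) = c * Ex g.
Proof. by move=> ig; apply: RintegralZl. Qed.

Lemma PintD g h : Pint g -> Pint h -> Pint (fun w => g w + h w).
Proof. by move=> ig ih; apply: (integrableD _ ig ih). Qed.

Lemma PintZ c g : Pint g -> Pint (fun w => c * g w).
Proof. by move=> ig; apply: (integrableZl _ c ig). Qed.

Lemma PintB g h : Pint g -> Pint h -> Pint (fun w => g w - h w).
Proof. by move=> ig ih; exact: (integrableB _ ig ih). Qed.

Lemma ExB g h : Pint g -> Pint h -> Ex (fun w => g w - h w) = Ex g - Ex h.
Proof. by move=> ig ih; apply: RintegralB. Qed.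

Lemma Ex_le g h : Pint g -> Pint h -> (forall w, g w <= h w) -> Ex g <= Ex h.
Proof. by move=> ig ih gh; apply: le_Rintegral => // w _; exact: gh. Qed.

Lemma Ex_cst c : Ex (fun=> c) = c.
Proof.
rewrite /Ex Rintegral_cst// (_ : _ [set: T] = 1%E) ?mulr1//; exact: probability_setT.
Qed.

Lemma Ex_norm_le g : Pint g -> `|Ex g| <= Ex (fun w => `|g w|).
Proof. by move=> ig; apply: le_normr_Rintegral. Qed.

Lemma Pint_dom g h : measurable_fun setT g -> Pint h -> (forall w, `|g w| <= h w) -> Pint g.
Proof.
move=> mg ih gh; apply: (le_integrable measurableT _ _ ih).
  exact/measurable_EFinP.
by move=> w _ /=; rewrite lee_fin (le_trans (gh w))// ler_norm.
Qed.

Lemma Pint_norm g : Pint g -> Pint (fun w => `|g w|).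
Proof. by move=> ig; exact: (integrable_abse ig). Qed.

Lemma Pint_cst c : Pint (fun=> c).
Proof. exact: finite_measure_integrable_cst. Qed.

Hypothesis Xexp : forall x : R, Pint (fun w => expR (x * `|X w|)).

Lemma power_le_expR (k : nat) (y : R) : 0 <= y -> y ^+ k <= k`!%:R * expR y.
Proof.
move=> y0; have k0 : 0 < k`!%:R :> R by rewrite ltr0n fact_gt0.
rewrite mulrC -ler_pdivrMr//; case: k k0 => [_|k _].
  by rewrite expr0 fact0 divr1 (le_trans _ (expR_ge1Dx y))// lerDl.
by rewrite (le_trans _ (expR_ge1Dxn k y0))// lerDr.
Qed.

(** With the cosine and the sine for [tr] these are the real and imaginary parts of X^k exp(zX), so
    that only real expectations are taken. *)
Definition trig_moment (tr : R -> R) k (z : C) (w : T) : R :=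
  X w ^+ k * expR (complex.Re z * X w) * tr (complex.Im z * X w).

Definition Fk k (z : C) : C := Ex (trig_moment cos k z) +i* Ex (trig_moment sin k z).

Lemma trig_moment_measurable tr k z : measurable_fun setT tr ->
  measurable_fun setT (trig_moment tr k z).
Proof.
move=> mtr; apply: measurable_funM; last first.
  apply: measurableT_comp => //; exact: measurable_funM.
apply: measurable_funM; first exact: measurable_funX.
apply: measurableT_comp => //; exact: measurable_funM.
Qed.

Lemma poly_exp_Pint k (x : R) : Pint (fun w => `|X w| ^+ k * expR (x * `|X w|)).
Proof.
apply: (Pint_dom (h := fun w => k`!%:R * expR ((1 + x) * `|X w|))).
- apply: measurable_funM; first by apply: measurable_funX; exact: measurableT_comp.
  by apply: measurableT_comp => //; apply: measurable_funM => //; exact: measurableT_comp.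
- exact/PintZ/Xexp.
move=> w; rewrite ger0_norm ?mulr_ge0 ?exprn_ge0 ?expR_ge0//.
rewrite mulrDl mul1r expRD mulrA ler_wpM2r ?expR_ge0//; exact: power_le_expR.
Qed.

Lemma trig_moment_Pint tr k z : measurable_fun setT tr -> (forall x, `|tr x| <= 1) ->
  Pint (trig_moment tr k z).
Proof.
move=> mtr tr1; apply: Pint_dom (poly_exp_Pint k `|complex.Re z|) _.
  exact: trig_moment_measurable.
move=> w; rewrite !normrM normrX (ger0_norm (expR_ge0 _)).
rewrite (le_trans (ler_piMr _ (tr1 _)))// ?mulr_ge0 ?exprn_ge0 ?expR_ge0//.
by rewrite ler_wpM2l ?exprn_ge0// ler_expR -normrM ler_norm.
Qed.

Lemma mcos : measurable_fun setT (@cos R).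
Proof. by apply: continuous_measurable_fun; exact: continuous_cos. Qed.
Lemma msin : measurable_fun setT (@sin R).
Proof. by apply: continuous_measurable_fun; exact: continuous_sin. Qed.
Lemma ncos (x : R) : `|cos x| <= 1.
Proof. by rewrite ler_norml cos_geN1 cos_le1. Qed.
Lemma nsin (x : R) : `|sin x| <= 1.
Proof. by rewrite ler_norml sin_geN1 sin_le1. Qed.

Lemma cosP k z : Pint (trig_moment cos k z).
Proof. exact: trig_moment_Pint mcos ncos. Qed.
Lemma sinP k z : Pint (trig_moment sin k z).
Proof. exact: trig_moment_Pint msin nsin. Qed.

Lemma trig_momentE k z w :
  trig_moment cos k z w +i* trig_moment sin k z w =
  (X w ^+ k)%:C * cexp (z * (X w)%:C).
Proof.
rewrite /trig_moment /cexp cReM cImM /= !mulr0 subr0 add0r /expi.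
by simpc; rewrite mulrA mulrA.
Qed.

(** Differentiation under the expectation by an explicit remainder: exp(hX) - 1 - hX is at most 4
    |hX|^2 exp(|hX|), and [B] dominates the product for |h| < 1. *)
Lemma Fk_cdiff k z : cdiff (Fk k) z (Fk k.+1 z).
Proof.
pose B w := `|X w| ^+ k.+2 * expR ((cmod z + 1) * `|X w|).
have iB : Pint B by exact: poly_exp_Pint.
have B0 : 0 <= Ex B.
  by apply: Rintegral_ge0 => w _; rewrite mulr_ge0 ?exprn_ge0 ?expR_ge0.
(* The constant 4 once for the real and once for the imaginary part; the 1 keeps [K] positive. *)
pose K := 8 * Ex B + 1.
have K0 : 0 < K by rewrite ltr_wpDl// mulr_ge0.
move=> e e0; exists (Num.min 1 (e / K)); first by rewrite lt_min ltr01 divr_gt0.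
move=> h; rewrite lt_min => /andP[h1 he].
pose D w := (X w ^+ k)%:C * cexp (z * (X w)%:C) * (cexp (h * (X w)%:C) - 1 - h * (X w)%:C).
have DE w : D w = (trig_moment cos k (z + h) w +i* trig_moment sin k (z + h) w)
    - (trig_moment cos k z w +i* trig_moment sin k z w)
    - h * (trig_moment cos k.+1 z w +i* trig_moment sin k.+1 z w).
  by rewrite !trig_momentE mulrDl cexpD exprS rmorphM /= /D; ring.
have DB w : cmod (D w) <= 4 * cmod h ^+ 2 * B w.
  rewrite /D 2!cmodM cmodR normrX cmod_cexp /B.
  have E1 : expR (complex.Re (z * (X w)%:C)) <= expR (cmod z * `|X w|).
    rewrite ler_expR (le_trans (ler_norm _))// (le_trans (Re_le_cmod _))//.
    by rewrite cmodM cmodR.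
  have := cexpB1z_bound (h * (X w)%:C); rewrite cmodM cmodR => E2.
  have E3 : expR (cmod h * `|X w|) <= expR `|X w|.
    by rewrite ler_expR ler_piMl// ltW.
  have x0 := normr_ge0 (X w).
  apply: (le_trans (ler_pM _ _ (ler_wpM2l (exprn_ge0 k x0) E1) E2)).
  - by rewrite mulr_ge0 ?exprn_ge0 ?expR_ge0.
  - exact: cmod_ge0.
  have -> : `|X w| ^+ k * expR (cmod z * `|X w|) *
      (4 * (cmod h * `|X w|) ^+ 2 * expR (cmod h * `|X w|)) =
    (4 * cmod h ^+ 2 * (`|X w| ^+ k.+2 * expR (cmod z * `|X w|))) * expR (cmod h * `|X w|).
    by rewrite !exprS; ring.
  rewrite -[X in X <= _]mulrA; apply: ler_wpM2l.
    by apply: mulr_ge0 => //; rewrite exprn_ge0// cmod_ge0.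
  rewrite -mulrA; apply: ler_wpM2l; first exact: exprn_ge0.
  rewrite (mulrDl (cmod z)) mul1r expRD; apply: ler_wpM2l => //; exact: expR_ge0.
have ReD w : complex.Re (D w) = trig_moment cos k (z + h) w - trig_moment cos k z w
   - (complex.Re h * trig_moment cos k.+1 z w - complex.Im h * trig_moment sin k.+1 z w).
  by rewrite DE !(cReD, cReN, cReM).
have ImD w : complex.Im (D w) = trig_moment sin k (z + h) w - trig_moment sin k z w
   - (complex.Re h * trig_moment sin k.+1 z w + complex.Im h * trig_moment cos k.+1 z w).
  by rewrite DE !(cImD, cImN, cImM).
have iR : Pint (fun w => complex.Re (D w)).
  rewrite (funext ReD).
  by apply: PintB; apply: PintB; try exact: cosP; apply: PintZ; [exact: cosP|exact: sinP].
have iI : Pint (fun w => complex.Im (D w)).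
  rewrite (funext ImD).
  apply: PintB; first by apply: PintB; exact: sinP.
  by apply: PintD; apply: PintZ; [exact: sinP|exact: cosP].
have -> : Fk k (z + h) - Fk k z - Fk k.+1 z * h =
    Ex (fun w => complex.Re (D w)) +i* Ex (fun w => complex.Im (D w)).
  rewrite (funext ReD).
  rewrite (funext ImD).
  rewrite ExB; [|by apply: PintB; exact: cosP|by apply: PintB; apply: PintZ; [exact: cosP|exact: sinP]].
  rewrite ExB; [|exact: cosP|exact: cosP].
  rewrite ExB; [|by apply: PintZ; exact: cosP|by apply: PintZ; exact: sinP].
  rewrite ExZ; last exact: cosP.
  rewrite ExZ; last exact: sinP.
  rewrite ExB; [|by apply: PintB; exact: sinP|by apply: PintD; apply: PintZ; [exact: sinP|exact: cosP]].
  rewrite ExB; [|exact: sinP|exact: sinP].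
  rewrite ExD; [|by apply: PintZ; exact: sinP|by apply: PintZ; exact: cosP].
  rewrite ExZ; last exact: sinP.
  rewrite ExZ; last exact: cosP.
  rewrite /Fk; case: (h) => a b; simpc => /=; congr (_ +i* _); ring.
rewrite (le_trans (cmod_le_ReIm _))//=.
have i4 : Pint (fun w => 4 * cmod h ^+ 2 * B w) by exact: PintZ.
have bR : `|Ex (fun w => complex.Re (D w))| <= 4 * cmod h ^+ 2 * Ex B.
  rewrite -ExZ// (le_trans (Ex_norm_le iR))//; apply: Ex_le => //; first exact: Pint_norm.
  by move=> w; rewrite (le_trans (Re_le_cmod _)).
have bI : `|Ex (fun w => complex.Im (D w))| <= 4 * cmod h ^+ 2 * Ex B.
  rewrite -ExZ// (le_trans (Ex_norm_le iI))//; apply: Ex_le => //; first exact: Pint_norm.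
  by move=> w; rewrite (le_trans (Im_le_cmod _)).
rewrite (le_trans (lerD bR bI))//.
have -> : 4 * cmod h ^+ 2 * Ex B + 4 * cmod h ^+ 2 * Ex B = (8 * Ex B * cmod h) * cmod h by ring.
rewrite ler_wpM2r ?cmod_ge0//.
have := ltW he; rewrite ler_pdivlMr// => hK.
rewrite (le_trans _ hK)// mulrC ler_wpM2l ?cmod_ge0// /K lerDl//.
Qed.

Lemma Fk_conj k z : Fk k (conjc z) = conjc (Fk k z).
Proof.
rewrite /Fk [RHS]/=; congr (_ +i* _).
  by apply: eq_Rintegral => w _; rewrite /trig_moment cReJ cImJ mulNr cosN.
rewrite -mulN1r -ExZ; last exact: sinP.
by apply: eq_Rintegral => w _; rewrite /trig_moment cReJ cImJ mulNr sinN; ring.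
Qed.

Definition mgf x := Ex (fun w => expR (x * X w)).

Lemma expX_Pint x : Pint (fun w => expR (x * X w)).
Proof.
have := cosP 0 x%:C; congr Pint; apply/funext => w.
by rewrite /trig_moment /= mul0r cos0 expr0 mul1r mulr1.
Qed.

Lemma F0_real x : Fk 0 x%:C = (mgf x)%:C.
Proof.
rewrite /Fk; congr (_ +i* _).
  by apply: eq_Rintegral => w _; rewrite /trig_moment /= mul0r cos0 expr0 mul1r mulr1.
rewrite -[RHS](Ex_cst 0).
by apply: eq_Rintegral => w _; rewrite /trig_moment /= mul0r sin0 mulr0.
Qed.

Lemma Fk_0 k : Fk k 0 = (Ex (fun w => X w ^+ k))%:C.
Proof.
rewrite /Fk; congr (_ +i* _).
  by apply: eq_Rintegral => w _; rewrite /trig_moment /= !mul0r cos0 expR0 !mulr1.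
rewrite -[RHS](Ex_cst 0).
by apply: eq_Rintegral => w _; rewrite /trig_moment /= !mul0r sin0 mulr0.
Qed.

Lemma mgf0 : mgf 0 = 1.
Proof.
rewrite -[RHS](Ex_cst 1); apply: eq_Rintegral => w _; by rewrite mul0r expR0.
Qed.

Lemma X_Pint : Pint X.
Proof.
have := cosP 1 0; congr Pint; apply/funext => w.
by rewrite /trig_moment /= !mul0r cos0 expr1 expR0 !mulr1.
Qed.

(** Jensen's inequality, obtained by averaging exp(v) >= 1 + v at v = x(X - E X). *)
Lemma mgf_lb x : expR (Ex X * x) <= mgf x.
Proof.
set m := Ex X.
have i1 : Pint (fun w => expR (- (m * x)) * expR (x * X w)) by exact/PintZ/expX_Pint.
have : 1 <= Ex (fun w => expR (- (m * x)) * expR (x * X w)).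
  have i2 : Pint (fun w => (1 - m * x) + x * X w).
    by apply: PintD; [exact: Pint_cst|exact/PintZ/X_Pint].
  apply: le_trans (Ex_le i2 i1 _).
    rewrite ExD; [|exact: Pint_cst|exact/PintZ/X_Pint].
    by rewrite Ex_cst ExZ; [rewrite -/m (mulrC x) subrK|exact: X_Pint].
  move=> w; rewrite -expRD; have := expR_ge1Dx (- (m * x) + x * X w); lra.
rewrite ExZ; last exact: expX_Pint.
by rewrite expRN mulrC ler_pdivlMr ?expR_gt0// mul1r.
Qed.

Lemma mgf_mono x r : `|x| <= r -> mgf x <= mgf r + mgf (- r).
Proof.
move=> xr; rewrite /mgf -ExD; [|exact: expX_Pint|exact: expX_Pint].
apply: Ex_le; first exact: expX_Pint.
  by apply: PintD; exact: expX_Pint.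
move=> w; have := ler_norm (x * X w); rewrite normrM => xX.
have rX : `|x| * `|X w| <= r * `|X w| by rewrite ler_wpM2r.
have [X0|X0] := leP 0 (X w).
  rewrite (ger0_norm X0) in xX rX; apply: ler_wpDr; first exact: expR_ge0.
  by rewrite ler_expR (le_trans xX).
rewrite (ltr0_norm X0) in xX rX; apply: ler_wpDl; first exact: expR_ge0.
by rewrite ler_expR (le_trans xX)// (le_trans rX)// mulrN mulNr.
Qed.

(** Multiply by the conjugate of the value and use Cauchy-Schwarz in the plane under the
    expectation. The constant 1 is essential: a factor 2 from componentwise estimates would destroy
    the sign of Re W on the top line. *)
Lemma F0_ridge z : cmod (Fk 0 z) <= mgf (complex.Re z).
Proof.
set m := cmod (Fk 0 z); have [m0|m0] := leP m 0.
  rewrite (le_trans m0)//; apply: Rintegral_ge0 => w _; exact: expR_ge0.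
rewrite -(ler_pM2l m0) -expr2 /m sqr_cmod -/m.
set a := complex.Re (Fk 0 z); set b := complex.Im (Fk 0 z).
have E : a ^+ 2 + b ^+ 2 = Ex (fun w => a * trig_moment cos 0 z w + b * trig_moment sin 0 z w).
  rewrite ExD; [|exact/PintZ/cosP|exact/PintZ/sinP].
  by rewrite ExZ ?ExZ ?expr2//; [exact: sinP|exact: cosP].
rewrite E -ExZ; last exact: expX_Pint.
apply: Ex_le; first by apply: PintD; apply: PintZ; [exact: cosP|exact: sinP].
  exact/PintZ/expX_Pint.
move=> w; rewrite /trig_moment expr0 !mul1r.
set e := expR _; set y := complex.Im z * X w.
have -> : a * (e * cos y) + b * (e * sin y) = complex.Re (Fk 0 z * expi (- y)) * e.
  by rewrite cReM -/a -/b [complex.Re (expi _)]/= [complex.Im (expi _)]/= cosN sinN; ring.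
rewrite ler_wpM2r ?expR_ge0// (le_trans (ler_norm _))// (le_trans (Re_le_cmod _))//.
by rewrite cmodM cmod_expi mulr1.
Qed.

Lemma F0_imag t : Fk 0 (0 +i* t) =
  Ex (fun w => cos (t * X w)) +i* Ex (fun w => sin (t * X w)).
Proof.
by rewrite /Fk; congr (_ +i* _); apply: eq_Rintegral => w _;
  rewrite /trig_moment /= mul0r expR0 expr0 !mul1r.
Qed.

End exponential_moments.

(** * Moments from central differences *)

Section central_differences.
Variable R : realType.
Implicit Types (g e : R -> R) (p : {poly R}) (h t : R).

Definition cdelta h g t := g (t + h) + g (t - h) - 2 * g t.

(** The shift preserves the leading coefficient, so the difference loses a degree; a second central
    difference loses two. *)
Lemma size_shift_sub p h : (size (p \Po ('X + h%:P) - p)%R <= (size p).-1)%N.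
Proof.
have [->|p0] := eqVneq p 0; first by rewrite comp_poly0 subr0 size_poly0.
have sX := size_XaddC h; have sc := size_comp_poly2 p sX.
apply/leq_sizeP => j; rewrite leq_eqVlt => /predU1P[<-|]; last first.
  rewrite prednK ?lt0n ?size_poly_eq0// => pj.
  by rewrite coefB !nth_default ?subrr// sc.
have := lead_coef_comp p (q := 'X + h%:P); rewrite sX => /(_ isT).
by rewrite lead_coefXaddC expr1n mulr1 /lead_coef sc coefB => ->; rewrite subrr.
Qed.

Lemma cdelta_poly h p : exists2 q : {poly R}, (size q <= (size p).-2)%N &
  cdelta h (horner p) =1 horner q.
Proof.
pose q := p \Po ('X + h%:P) - p.
exists (- (q \Po ('X + (- h)%:P) - q)).
  rewrite size_polyN (leq_trans (size_shift_sub _ _))//.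
  by have := size_shift_sub p h; rewrite -/q; case: (size q) (size p) => [|m] [|[|n]].
move=> t; rewrite /cdelta hornerN /q !(hornerD, hornerN, horner_comp, hornerX, hornerC).
by rewrite subrK; ring.
Qed.

Lemma iter_cdelta_poly h k p t : (size p <= k.*2)%N -> iter k (cdelta h) (horner p) t = 0.
Proof.
elim: k p t => [|k IH] p t.
  by rewrite double0 leqn0 size_poly_eq0 => /eqP ->; rewrite /= horner0.
move=> sp; rewrite iterSr; have [q sq qE] := cdelta_poly h p.
rewrite (funext qE) IH// (leq_trans sq)//.
by case: (size p) sp => [|[|n]]//; rewrite doubleS.
Qed.

Lemma iter_cdeltaD h k g e t :
  iter k (cdelta h) (fun s => g s + e s) t = iter k (cdelta h) g t + iter k (cdelta h) e t.
Proof.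
elim: k t => //= k IH t; rewrite /cdelta !IH; ring.
Qed.

(** Each difference has coefficients of total modulus 1 + 1 + 2 = 4 and widens the window by [h]. *)
Lemma iter_cdelta_bound h k e t B : 0 <= h -> (forall s, `|s - t| <= k%:R * h -> `|e s| <= B) ->
  `|iter k (cdelta h) e t| <= 4 ^+ k * B.
Proof.
move=> h0; elim: k t B => [|k IH] t B eB.
  by rewrite expr0 mul1r; apply: eB; rewrite subrr normr0 mul0r.
have bnd s : `|s - t| <= h -> `|iter k (cdelta h) e s| <= 4 ^+ k * B.
  move=> sh; apply: IH => u us; apply: eB.
  have -> : u - t = (u - s) + (s - t) by ring.
  by rewrite (le_trans (ler_normD _ _))// -natr1 mulrDl mul1r lerD.
have b1 := bnd (t + h); have b2 := bnd (t - h); have b3 := bnd t.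
rewrite /= {1}/cdelta.
move: b1 b2 b3; rewrite [t + h - t]addrC addKr ger0_norm// => /(_ (lexx _)) b1.
rewrite [t - h - t]addrC addKr normrN ger0_norm// => /(_ (lexx _)) b2.
rewrite subrr normr0 => /(_ h0) b3.
rewrite (le_trans (ler_normB _ _))// (le_trans (lerD (ler_normD _ _) (lexx _)))//.
rewrite normrM (ger0_norm (_ : 0 <= 2)) // exprS; lra.
Qed.

End central_differences.

Section moment_bound.
Context d (T : measurableType d) (R : realType) (P : probability T R).
Variable X : {RV P >-> R}.
Implicit Types (h t : R).

Let s h w := 2 * (1 - cos (h * X w)).

Lemma s_bounds h w : 0 <= s h w <= 4.
Proof.
have := cos_le1 (h * X w); have := cos_geN1 (h * X w); rewrite /s => ? ?.
by apply/andP; split; lra.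
Qed.

Lemma mcosX t : measurable_fun setT (fun w => cos (t * X w)).
Proof.
by apply: measurableT_comp; [exact: mcos|exact: measurable_funM].
Qed.

Lemma ms h k : measurable_fun setT (fun w => s h w ^+ k).
Proof.
apply: measurable_funX; apply: measurable_funM => //.
by apply: measurable_funB => //; exact: mcosX.
Qed.

Lemma psi_Pint h k t : Pint P (fun w => s h w ^+ k * cos (t * X w)).
Proof.
apply: (Pint_dom (h := fun=> 4 ^+ k)).
- by apply: measurable_funM; [exact: ms|exact: mcosX].
- exact: Pint_cst.
move=> w; rewrite normrM; have /andP[s0 s4] := s_bounds h w.
rewrite (le_trans (ler_piMr _ (ncos _)))// normrX ger0_norm//.
by rewrite lerXn2r ?nnegrE.
Qed.

(** A second difference multiplies cos(tX) by -2(1 - cos(hX)), a factor of constant sign. At t = 0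
    there is thus no cancellation, and smoothness of the characteristic function bounds a genuine
    moment. *)
Lemma iter_cdelta_char h k t :
  iter k (cdelta h) (fun t => Ex P (fun w => cos (t * X w))) t =
  (-1) ^+ k * Ex P (fun w => s h w ^+ k * cos (t * X w)).
Proof.
elim: k t => [|k IH] t /=.
  by rewrite expr0 mul1r; apply: eq_Rintegral => w _; rewrite expr0 mul1r.
rewrite /cdelta !IH exprS mulN1r mulNr -mulrN.
have -> : forall a b c x : R, x * a + x * b - 2 * (x * c) = x * ((a + b) - 2 * c).
  by move=> *; ring.
congr (_ * _); rewrite -ExD; [|exact: psi_Pint|exact: psi_Pint].
rewrite -ExZ; last exact: psi_Pint.
rewrite -ExB; [|by apply: PintD; exact: psi_Pint|exact/PintZ/psi_Pint].
rewrite -mulN1r -ExZ; last exact: psi_Pint.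
apply: eq_Rintegral => w _.
by rewrite !mulrDl cosD mulNr cosB exprS /s; ring.
Qed.

Variable f : R[i] -> R[i].
Hypothesis fh : forall z, exists d, cdiff f z d.
Hypothesis fE : forall t : R, complex.Re (f t%:C) = Ex P (fun w => cos (t * X w)).

(** The [k]-fold second difference kills the Taylor polynomial of degree below 2k, so only the
    remainder on [-kh, kh] survives. [rho] is at choice because [f] is entire, and [M] is uniform in
    [h] and [k]. *)
Lemma moment_estimate (rho : R) : 0 < rho -> exists2 M : R, 0 <= M &
  forall h k, 0 <= h -> k%:R * h <= rho / 2 ->
  Ex P (fun w => s h w ^+ k) <= M * (4 ^+ k * (k%:R * h / rho) ^+ k.*2).
Proof.
move=> rho0.
have rr : rho < rho + 1 by rewrite ltrDl.
have fholo : holo_disc (rho + 1) f by move=> z _; exact: fh.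
have [a [M [M0 H]]] := taylor_expansion rho0 rr fholo.
exists M => // h k h0 hk.
pose p := \poly_(i < k.*2) complex.Re (a i).
pose e t := Ex P (fun w => cos (t * X w)) - p.[t].
have ReS n (t : R) : complex.Re (\sum_(i < n) a i * t%:C ^+ i) =
    \sum_(i < n) complex.Re (a i) * t ^+ i.
  elim: n => [|n IH]; first by rewrite !big_ord0.
  by rewrite !big_ord_recr /= cReD IH -rmorphXn cReM /= mulr0 subr0.
have eB t : `|t - 0| <= k%:R * h -> `|e t| <= M * (k%:R * h / rho) ^+ k.*2.
  rewrite subr0 => tk; have := H k.*2 t%:C; rewrite cmodR => /(_ (le_trans tk hk)) Ht.
  have -> : e t = complex.Re (f t%:C - \sum_(n < k.*2) a n * t%:C ^+ n).
    by rewrite cReD cReN ReS fE /e horner_poly.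
  rewrite (le_trans (Re_le_cmod _))// (le_trans Ht)// ler_wpM2l//.
  rewrite lerXn2r ?nnegrE ?divr_ge0 ?mulr_ge0 ?(ltW rho0)//.
  by rewrite ler_pM2r// invr_gt0.
have := iter_cdelta_bound h0 eB.
have : iter k (cdelta h) (fun t => p.[t] + e t) 0 =
    (-1) ^+ k * Ex P (fun w => s h w ^+ k).
  have -> : (fun t => p.[t] + e t) = (fun t => Ex P (fun w => cos (t * X w))).
    by apply/funext => t; rewrite /e addrC subrK.
  rewrite iter_cdelta_char; congr (_ * _); apply: eq_Rintegral => w _.
  by rewrite mul0r cos0 mulr1.
rewrite iter_cdeltaD iter_cdelta_poly ?size_poly// add0r => ->.
rewrite normrM normrX normrN1 expr1n mul1r => Hb.
by rewrite (le_trans (ler_norm _))// (le_trans Hb)// mulrCA.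
Qed.

Let c1 : R := cos 1.

(** 1 - cos y = 2 sin^2(y / 2), and the mean value theorem gives sin(y / 2) = cos(c) y / 2 with cos
    c >= cos 1. *)
Lemma one_sub_cos_ge (y : R) : `|y| <= 1 -> c1 ^+ 2 * y ^+ 2 <= 2 * (1 - cos y).
Proof.
wlog y0 : y / 0 <= y.
  move=> W; have [y0|y0] := leP 0 y; first exact: W.
  by rewrite -normrN => yn; rewrite -cosN -(sqrrN y); apply: W => //; rewrite oppr_ge0 ltW.
rewrite ger0_norm// => y1.
have y20 : 0 <= y / 2 by rewrite divr_ge0.
have [|c cI E] := @MVT_segment R sin cos 0 (y / 2) y20 (fun t _ => is_derive_sin t).
  by apply: cont_on_within => t _; exact: continuous_sin.
rewrite sin0 !subr0 in E; rewrite in_itv /= in cI.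
have cc : c1 <= cos c by apply: cos_ge_cos1; apply/andP; case/andP: cI => ? ?; split; lra.
have c10 : 0 < c1 := cos1_gt0 R.
have cosy : cos y = 1 - 2 * sin (y / 2) ^+ 2.
  by rewrite {1}(splitr y) cosD -!expr2 cos2sin2; ring.
rewrite cosy E.
have -> : 2 * (1 - (1 - 2 * (cos c * (y / 2)) ^+ 2)) = cos c ^+ 2 * y ^+ 2 by field.
by rewrite ler_wpM2r ?sqr_ge0// lerXn2r ?nnegrE ?(ltW c10)// (le_trans (ltW c10)).
Qed.

Let ind (n : nat) w : R := ((`|X w| <= n.+1%:R)%R : bool)%:R.

Lemma ind_measurable n : measurable_fun setT (ind n).
Proof.
have mA : measurable [set w | `|X w| <= n.+1%:R].
  have : measurable_fun setT (fun w => `|X w|) by exact: measurableT_comp.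
  move=> /(_ measurableT _ (@measurable_itv _ `]-oo, n.+1%:R])); rewrite setTI.
  by congr measurable; apply/seteqP; split => w /=; rewrite in_itv.
have := @measurable_indic _ _ R setT _ mA; congr (measurable_fun _ _).
apply/funext => w; rewrite /ind indicE; congr (_%:R).
by rewrite mem_setE.
Qed.

(** The truncation makes every moment finite before anything is known about X, while the bound is
    uniform in the truncation level. *)
Lemma truncated_even_moment (rho : R) : 2 <= rho -> exists2 M : R, 0 <= M &
  forall n k, (k <= n)%N -> Ex P (fun w => ind n w * X w ^+ k.*2) <=
    M * (k.*2%:R / (c1 * rho)) ^+ k.*2.
Proof.
move=> rho2; have rho0 : 0 < rho by lra.
have [M M0 H] := moment_estimate rho0; exists M => // n k kn.
(* This makes |hX| <= 1 on the truncation event, while k <= n gives kh <= 1 <= rho / 2. The powers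
   of [h] cancel in the final bound. *)
pose h : R := n.+1%:R^-1.
have n0 : 0 < n.+1%:R :> R by rewrite ltr0n.
have h0 : 0 < h by rewrite invr_gt0.
have kh : k%:R * h <= rho / 2.
  apply: (@le_trans _ _ 1); last by lra.
  by rewrite ler_pdivrMr// mul1r ler_nat (leq_trans kn).
have c10 : 0 < c1 := cos1_gt0 R.
have ch : 0 < (c1 * h) ^+ k.*2 by rewrite exprn_gt0// mulr_gt0.
have pw w : (c1 * h) ^+ k.*2 * (ind n w * X w ^+ k.*2) <= s h w ^+ k.
  rewrite /ind; have [Xn|_] := leP `|X w| n.+1%:R; last first.
    by rewrite mul0r mulr0 exprn_ge0//; have /andP[] := s_bounds h w.
  rewrite mul1r -exprMn -mul2n exprM -mulrA exprMn.
  apply: lerXn2r; rewrite ?nnegrE.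
  - by rewrite mulr_ge0 ?sqr_ge0.
  - by have /andP[] := s_bounds h w.
  apply: one_sub_cos_ge; rewrite normrM (gtr0_norm h0) mulrC.
  by rewrite ler_pdivrMr// mul1r.
have i1 : Pint P (fun w => s h w ^+ k).
  by have := psi_Pint h k 0; congr Pint; apply/funext => w; rewrite mul0r cos0 mulr1.
have i2 : Pint P (fun w => ind n w * X w ^+ k.*2).
  apply: (Pint_dom (h := fun=> n.+1%:R ^+ k.*2)).
  - by apply: measurable_funM; [exact: ind_measurable|exact: measurable_funX].
  - exact: Pint_cst.
  move=> w; rewrite /ind; have [Xn|_] := leP `|X w| n.+1%:R; last first.
    by rewrite mul0r normr0 exprn_ge0// ltW.
  by rewrite mul1r normrX lerXn2r ?nnegrE// ltW.
rewrite -(ler_pM2l ch) -ExZ//.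
apply: le_trans (Ex_le (PintZ _ i2) i1 pw) _.
apply: le_trans (H h k (ltW h0) kh) _.
rewrite le_eqVlt; apply/orP; left; apply/eqP; rewrite [RHS]mulrCA; congr (_ * _).
have dbl (x : R) : x ^+ k.*2 = (x ^+ 2) ^+ k by rewrite -exprM mul2n.
rewrite !dbl -!exprMn; congr (_ ^+ k).
by rewrite -mul2n natrM; field; rewrite !gt_eqF.
Qed.

Lemma exp_series_even (y : R) n :
  series (exp_coeff y) n + series (exp_coeff (- y)) n =
  \sum_(0 <= m < n) (if odd m then 0 else 2 * (y ^+ m / m`!%:R)).
Proof.
rewrite /series /= -big_split /=; apply: eq_bigr => m _.
rewrite /exp_coeff /= -[(- y) ^+ m]mulr1 exprNn -signr_odd; case: (odd m).
  by rewrite expr1; ring.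
by rewrite expr0; ring.
Qed.

(** Truncated partial sums of exp(xX) + exp(-xX) contain even powers only and have expectations
    bounded by a geometric series; Fatou's lemma passes to the limit. *)
Lemma exp_moment_ge0 (x : R) : 0 <= x -> Pint P (fun w => expR (x * `|X w|)).
Proof.
move=> x0; have c10 : 0 < c1 := cos1_gt0 R.
(* Chosen so that x e / (c1 rho) <= 1/2, the ratio of the geometric series. *)
pose rho := 2 + 2 * x * expR 1 / c1.
have rho2 : 2 <= rho by rewrite lerDl divr_ge0 ?mulr_ge0 ?expR_ge0// ltW.
have rho0 : 0 < rho by lra.
have [M M0 H] := truncated_even_moment rho2.
pose term m w : R := if odd m then 0 else 2 * ((x * X w) ^+ m / m`!%:R).
pose g n w := ind n w * (series (exp_coeff (x * X w)) n + series (exp_coeff (- (x * X w))) n).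
have gE n w : g n w = \sum_(0 <= m < n) ind n w * term m w.
  by rewrite /g exp_series_even mulr_sumr.
have tm_ge0 m w : 0 <= term m w.
  rewrite /term; case: ifP => // om; rewrite mulr_ge0// divr_ge0//.
  by rewrite exprn_even_ge0// om.
have ind_ge0 n w : 0 <= ind n w by rewrite /ind ler0n.
have mterm m : measurable_fun setT (term m).
  rewrite /term; case: (odd m) => //; apply: measurable_funM => //.
  by apply: measurable_funM => //; apply: measurable_funX; exact: measurable_funM.
have it n m : Pint P (fun w => ind n w * term m w).
  apply: (Pint_dom (h := fun=> 2 * (x * n.+1%:R) ^+ m / m`!%:R)).
  - by apply: measurable_funM; [exact: ind_measurable|exact: mterm].
  - exact: Pint_cst.
  move=> w; rewrite ger0_norm ?mulr_ge0// /ind; have [Xn|_] := leP `|X w| n.+1%:R; last first.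
    by rewrite mul0r divr_ge0// mulr_ge0// exprn_ge0// mulr_ge0.
  rewrite mul1r /term; case: ifP => om.
    by rewrite divr_ge0// mulr_ge0// exprn_ge0// mulr_ge0.
  rewrite -mulrA ler_wpM2l// ler_wpM2r ?invr_ge0//.
  rewrite (le_trans (ler_norm _))// normrX lerXn2r ?nnegrE ?mulr_ge0//.
  by rewrite normrM (ger0_norm x0) ler_wpM2l.
have Eterm n m : (m <= n)%N -> Ex P (fun w => ind n w * term m w) <= 2 * M * (1 / 2) ^+ m.
  move=> mn; have [om|om] := boolP (odd m).
    rewrite /term om (_ : Ex P _ = 0); first by rewrite !mulr_ge0// exprn_ge0.
    by rewrite -[RHS](Ex_cst P 0); apply: eq_Rintegral => w _; rewrite mulr0.
  have [k mk] : exists k, m = k.*2 by exists m./2; rewrite even_halfK.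
  have kn : (k <= n)%N by rewrite (leq_trans _ mn)// mk -addnn leq_addr.
  have fm : 0 < m`!%:R :> R by rewrite ltr0n fact_gt0.
  have i0 : Pint P (fun w => ind n w * X w ^+ m).
    apply: (Pint_dom (h := fun=> n.+1%:R ^+ m)).
    - by apply: measurable_funM; [exact: ind_measurable|exact: measurable_funX].
    - exact: Pint_cst.
    move=> w; rewrite /ind; have [Xn|_] := leP `|X w| n.+1%:R; last first.
      by rewrite mul0r normr0 exprn_ge0.
    by rewrite mul1r normrX lerXn2r ?nnegrE.
  have -> : Ex P (fun w => ind n w * term m w) =
      2 * x ^+ m / m`!%:R * Ex P (fun w => ind n w * X w ^+ m).
    rewrite -ExZ//; apply: eq_Rintegral => w _.
    by rewrite /term (negbTE om) exprMn; ring.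
  have c0 : 0 <= 2 * x ^+ m / m`!%:R by rewrite divr_ge0// mulr_ge0// exprn_ge0.
  have Hk := H n k kn; rewrite -mk in Hk.
  rewrite (le_trans (ler_wpM2l c0 Hk))//.
  (* At y = m this reads m^m <= m! e^m, which serves as Stirling's bound. *)
  have Q := power_le_expR m (ler0n R m).
  have Em : expR m%:R = expR 1 ^+ m :> R by rewrite -expRM_natl mulr1.
  rewrite Em in Q.
  have cr : 0 < c1 * rho by rewrite mulr_gt0.
  have ratio : x * expR 1 / (c1 * rho) <= 1 / 2.
    rewrite ler_pdivrMr// /rho mulrDr.
    have -> : 1 / 2 * (c1 * 2 + c1 * (2 * x * expR 1 / c1)) = c1 + x * expR 1.
      by field; rewrite gt_eqF.
    by rewrite lerDr ltW.
  have -> : 2 * x ^+ m / m`!%:R * (M * (m%:R / (c1 * rho)) ^+ m) =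
      2 * M * ((x / (c1 * rho)) ^+ m * (m%:R ^+ m / m`!%:R)).
    by rewrite !expr_div_n; ring.
  rewrite ler_wpM2l ?mulr_ge0//.
  apply: (@le_trans _ _ ((x / (c1 * rho)) ^+ m * expR 1 ^+ m)).
    rewrite ler_wpM2l//; first by rewrite exprn_ge0// divr_ge0// ltW.
    by rewrite ler_pdivrMr// mulrC.
  rewrite -exprMn; apply: lerXn2r; rewrite ?nnegrE.
  - by apply: mulr_ge0; [apply: divr_ge0 => //; exact: ltW|exact: expR_ge0].
  - by rewrite divr_ge0.
  by rewrite mulrAC.
have ig n : Pint P (g n).
  rewrite (funext (gE n)).
  elim: {1}n => [|m IH].
    have := Pint_cst P 0; congr Pint; apply/funext => w; by rewrite big_geq.
  have := PintD IH (it n m); congr Pint; apply/funext => w.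
  by rewrite [RHS]big_nat_recr.
have Eg n : Ex P (g n) <= 4 * M.
  have geo m : \sum_(0 <= i < m) 2 * M * (1 / 2) ^+ i = 4 * M * (1 - (1 / 2) ^+ m).
    elim: m => [|m IH]; first by rewrite big_geq// expr0 subrr mulr0.
    by rewrite big_nat_recr//= IH exprS; field.
  apply: (@le_trans _ _ (\sum_(0 <= i < n) 2 * M * (1 / 2) ^+ i)); last first.
    rewrite geo ler_piMr ?mulr_ge0// lerBlDr lerDl exprn_ge0//.
  rewrite (funext (gE n)).
  suff HS m : (m <= n)%N -> Pint P (fun w => \sum_(0 <= i < m) ind n w * term i w) /\
      Ex P (fun w => \sum_(0 <= i < m) ind n w * term i w) <=
      \sum_(0 <= i < m) 2 * M * (1 / 2) ^+ i by have [] := HS n (leqnn n).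
  elim: m => [_|m IH mn].
    have z : (fun w => \sum_(0 <= i < 0) ind n w * term i w) = (fun=> 0).
      by apply/funext => w; rewrite big_geq.
    rewrite z big_geq// Ex_cst; split => //; exact: Pint_cst.
  have [I1 I2] := IH (ltnW mn).
  have z : (fun w => \sum_(0 <= i < m.+1) ind n w * term i w) =
      (fun w => \sum_(0 <= i < m) ind n w * term i w + ind n w * term m w).
    by apply/funext => w; rewrite big_nat_recr.
  rewrite z; split; first exact: PintD I1 (it n m).
  by rewrite ExD// big_nat_recr//= lerD// Eterm// ltnW.
have gcv w : (g n w)%:E @[n --> \oo] --> (expR (x * X w) + expR (- (x * X w)))%:E.
  apply: cvg_EFin; first exact: nearW.
  have h1 : series (exp_coeff (x * X w)) n + series (exp_coeff (- (x * X w))) n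
      @[n --> \oo] --> expR (x * X w) + expR (- (x * X w)).
    by apply: cvgD; exact: is_cvg_series_exp_coeff.
  apply: cvg_trans h1; apply: near_eq_cvg.
  near=> N; rewrite /= /g /ind (_ : (_ <= _)%R = true) ?mul1r//.
  have : (Num.bound `|X w| <= N)%N by near: N; exact: nbhs_infty_ge.
  move=> nb; apply: ltW; apply: (lt_le_trans (archi_boundP (normr_ge0 _))).
  by rewrite ler_nat (leq_trans nb).
have mexp : measurable_fun setT (fun w => expR (x * `|X w|)).
  apply: measurableT_comp => //; apply: measurable_funM => //.
  exact: measurableT_comp.
rewrite /Pint; apply/integrableP; split; first exact/measurable_EFinP.
apply: (@le_lt_trans _ _ (4 * M)%:E); last by rewrite ltry.
have -> : (\int[P]_w `|(EFin \o (fun w => expR (x * `|X w|)%R)) w| =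
    \int[P]_w (expR (x * `|X w|)%R)%:E)%E.
  by apply: eq_integral => w _ /=; rewrite ger0_norm ?expR_ge0.
have Fat := @fatou _ _ _ P setT measurableT (fun n w => (g n w)%:E) _ _.
apply: le_trans (le_trans (Fat _ _) _).
- apply: ge0_le_integral => //.
  + exact/measurable_EFinP.
  + rewrite (_ : (fun w => _) = fun w => (expR (x * X w) + expR (- (x * X w)))%:E); last first.
      by apply/funext => w; rewrite (cvg_limn_einf_sup (gcv w)).1.
    apply/measurable_EFinP; apply: measurable_funD.
      by apply: measurableT_comp => //; exact: measurable_funM.
    by apply: measurableT_comp => //; apply: measurableT_comp => //; exact: measurable_funM.
  + move=> w _; rewrite (cvg_limn_einf_sup (gcv w)).1 /= lee_fin.
    have [X0|X0] := leP 0 (X w).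
      by rewrite (ger0_norm X0) lerDl expR_ge0.
    by rewrite (ltr0_norm X0) mulrN lerDr expR_ge0.
- by move=> n; apply/measurable_EFinP; have /measurable_EFinP := measurable_int _ (ig n).
- by move=> n w _; rewrite lee_fin gE sumr_ge0// => i _; rewrite mulr_ge0.
have Ibound n : (\int[P]_w (g n w)%:E <= (4 * M)%:E)%E.
  by rewrite -(fineK (integrable_fin_num measurableT (ig n))) lee_fin; exact: Eg.
rewrite limn_einf_lim; apply: lime_le; first exact: is_cvg_einfs.
near=> N; apply: le_trans (Ibound N); apply: ereal_inf_lbound; exists N => //=.
Unshelve. all: by end_near. Qed.

Lemma exp_moment (x : R) : Pint P (fun w => expR (x * `|X w|)).
Proof.
apply: (Pint_dom (h := fun w => expR (`|x| * `|X w|))).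
- by apply: measurableT_comp => //; apply: measurable_funM => //; exact: measurableT_comp.
- exact: exp_moment_ge0.
by move=> w; rewrite ger0_norm ?expR_ge0// ler_expR ler_wpM2r// ler_norm.
Qed.

End moment_bound.

(** * The normal law *)

Section normal_law.
Variable R : realType.
Local Notation mu := (@lebesgue_measure R).
Local Notation Q := (normal_prob (0 : R) 1).

Definition normal_var (x : measurableTypeR R) : R := x.

Lemma measurable_normal_var : measurable_fun setT normal_var.
Proof. exact: measurable_id. Qed.

HB.instance Definition _ := isMeasurableFun.Build _ _ _ _ normal_var measurable_normal_var.

Local Notation N := (normal_var : {RV Q >-> R}).

(** The Radon-Nikodym derivative agrees almost everywhere with [normal_pdf], since both have the
    same integral over every measurable set. *)
Lemma integral_normal_prob (f : R -> \bar R) : (forall x, (0 <= f x)%E) ->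
  measurable_fun setT f ->
  (\int[Q]_x f x = \int[mu]_x (f x * (normal_pdf 0 1 x)%:E))%E.
Proof.
move=> f0 mf.
have dom := normal_prob_dominates (0 : R) 1.
rewrite -(Radon_Nikodym_SigmaFinite.change_of_variables dom f0 measurableT mf).
have mg := measurable_int _ (Radon_Nikodym_SigmaFinite.f_integrable dom).
have mp : measurable_fun setT (fun x => (normal_pdf 0 1 x)%:E : \bar R).
  by apply/measurable_EFinP; exact: measurable_normal_pdf.
apply: ae_eq_integral => //.
- exact: emeasurable_funM.
- exact: emeasurable_funM.
apply: (filterS _ (integral_ae_eq measurableT
  (Radon_Nikodym_SigmaFinite.f_integrable dom) mp _)).
  by move=> x H Dx; rewrite H.
move=> E _ mE; rewrite -Radon_Nikodym_SigmaFinite.f_integral//.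
Qed.

(** Completing the square: the tilted density is a shifted normal density, whose total mass is 1. *)
Lemma normal_pdf_tilt (x y : R) :
  expR (x * y) * normal_pdf 0 1 y = expR (x ^+ 2 / 2) * normal_pdf x 1 y.
Proof.
rewrite !normal_pdfE ?oner_eq0// /= /normal_fun.
rewrite mulrCA [RHS]mulrCA; congr (_ * _); rewrite -!expRD; congr expR.
by rewrite expr1n; field.
Qed.

Lemma normal_exp_integral (x : R) :
  (\int[Q]_y (expR (x * y))%:E = (expR (x ^+ 2 / 2))%:E)%E.
Proof.
have mE : measurable_fun setT (fun y : R => (expR (x * y))%:E).
  by apply/measurable_EFinP; apply: measurableT_comp => //; exact: measurable_funM.
rewrite integral_normal_prob//.
transitivity (\int[mu]_y ((expR (x ^+ 2 / 2))%:E * (normal_pdf x 1 y)%:E))%E.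
  by apply: eq_integral => y _; rewrite -EFinM normal_pdf_tilt EFinM.
rewrite ge0_integralZl//.
- by rewrite integral_normal_pdf mule1.
- by apply/measurable_EFinP; exact: measurable_normal_pdf.
- by move=> y _; rewrite lee_fin normal_pdf_ge0.
Qed.

Lemma normal_exp_Pint (x : R) : Pint Q (fun w => expR (x * N w)).
Proof.
rewrite /Pint; apply/integrableP; split.
  by apply/measurable_EFinP; apply: measurableT_comp => //; exact: measurable_funM.
have -> : (\int[Q]_w `|(EFin \o (fun w => expR (x * N w)%R)) w| =
    \int[Q]_w (expR (x * w)%R)%:E)%E.
  by apply: eq_integral => w _ /=; rewrite ger0_norm ?expR_ge0.
by rewrite normal_exp_integral ltry.
Qed.

Lemma normal_exp_moment (x : R) : Pint Q (fun w => expR (x * `|N w|)).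
Proof.
apply: (Pint_dom (h := fun w => expR (x * N w) + expR (- x * N w))).
- by apply: measurableT_comp => //; apply: measurable_funM => //; exact: measurableT_comp.
- by apply: PintD; exact: normal_exp_Pint.
move=> w; rewrite ger0_norm ?expR_ge0//.
have [X0|X0] := leP 0 (N w).
  by rewrite (ger0_norm X0) lerDl expR_ge0.
by rewrite (ltr0_norm X0) mulrN mulNr lerDr expR_ge0.
Qed.

Lemma normal_mgf (x : R) : mgf N x = expR (x ^+ 2 / 2).
Proof. by rewrite /mgf /Ex /Rintegral normal_exp_integral. Qed.

(** Both sides are entire and agree on the real axis, where the left one is the moment generating
    function; no contour has to be shifted. *)
Lemma normal_char (z : R[i]) : Fk N 0 z = cexp (z ^+ 2 / 2%:R).
Proof.
apply/eqP; rewrite -subr_eq0; apply/eqP.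
apply: (@entire_eq0 R (fun z => Fk N 0 z - cexp (z ^+ 2 / 2%:R))).
  move=> rho y _; eexists; apply: tdiffB.
    exact: (Fk_cdiff normal_exp_moment).
  apply: (tdiff_comp (f := @cexp R)); first exact: cdiff_cexp.
  apply: tdiffM; [exact: cdiff_sqr|exact: tdiff_cst].
move=> t; rewrite F0_real normal_mgf.
have -> : t%:C ^+ 2 / 2%:R = (t ^+ 2 / 2)%:C :> R[i].
  by rewrite rmorphM rmorphXn fmorphV rmorph_nat.
by rewrite cexpR subrr.
Qed.

Lemma normal_char_imag (t : R) :
  Ex Q (fun w => cos (t * N w)) +i* Ex Q (fun w => sin (t * N w)) =
  (expR (- (t ^+ 2 / 2)))%:C.
Proof.
rewrite -F0_imag normal_char.
have -> : (0 +i* t) ^+ 2 / 2%:R = (- (t ^+ 2 / 2))%:C :> R[i].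
  have -> : (0 +i* t) ^+ 2 = (- t ^+ 2)%:C :> R[i].
    by rewrite expr2; simpc; congr (_ +i* _); ring.
  by rewrite -[- (_ / _)]mulNr [RHS]rmorphM /= fmorphV rmorph_nat.
by rewrite cexpR.
Qed.

End normal_law.

(** * Kernels with compactly supported Fourier transform *)

Section kernel.
Variable R : realType.
Implicit Types (x y h s u v : R).

Lemma cos_lipschitz x y : `|cos x - cos y| <= `|x - y|.
Proof.
wlog xy : x y / y <= x.
  by move=> W; have [|/ltW] := leP y x; [exact: W|rewrite distrC (distrC x); exact: W].
rewrite [X in _ <= X]ger0_norm ?subr_ge0// -[X in _ <= X]mul1r.
apply: (derive_bound xy (fun t _ => is_derive_cos t)) => t _.
by rewrite normrN ler_norml sin_geN1 sin_le1.
Qed.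

Lemma sin_lipschitz x y : `|sin x - sin y| <= `|x - y|.
Proof. by rewrite -!cosBpihalf (le_trans (cos_lipschitz _ _))// opprB addrA subrK. Qed.

Lemma sin_taylor1 x h : `|sin (x + h) - sin x - h * cos x| <= h ^+ 2.
Proof.
have D (t : R) : is_derive t 1 (fun t => sin t - t * cos x) (cos t - cos x).
  by apply: is_derive_eq; rewrite /GRing.scale /=; ring.
have E : sin (x + h) - sin x - h * cos x =
    (sin (x + h) - (x + h) * cos x) - (sin x - x * cos x) by ring.
have [h0|h0] := leP 0 h.
  have xh : x <= x + h by rewrite lerDl.
  have -> : h ^+ 2 = h * (x + h - x) by ring.
  rewrite E; apply: (derive_bound xh (fun t _ => D t)) => t /andP[t1 t2].
  rewrite (le_trans (cos_lipschitz _ _))// ger0_norm ?subr_ge0//; lra.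
have xh : x + h <= x by rewrite gerDl ltW.
have -> : h ^+ 2 = (- h) * (x - (x + h)) by ring.
rewrite E distrC; apply: (derive_bound xh (fun t _ => D t)) => t /andP[t1 t2].
rewrite (le_trans (cos_lipschitz _ _))// ler0_norm ?subr_le0//; lra.
Qed.

Lemma lipschitz_continuous (g : R -> R) (C : R) t :
  (forall s, `|g s - g t| <= C * `|s - t|) -> {for t, continuous g}.
Proof.
move=> H; apply/continuous_epsP => e e0.
have C0 : 0 < `|C| + 1 by rewrite ltr_wpDl.
exists (e / (`|C| + 1)); first by rewrite divr_gt0.
move=> h; rewrite ltr_pdivlMr// => hC; rewrite (le_trans (H _))// addrC addKr.
rewrite (le_trans _ (ltW hC))// mulrC ler_wpM2l//.
by rewrite (le_trans (ler_norm C))// lerDl.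
Qed.

Lemma cos_lin_cont (x : R) : cont_on 0 1 (fun v => cos (x * v)).
Proof.
move=> t _; apply: (@lipschitz_continuous _ `|x|) => s.
by rewrite (le_trans (cos_lipschitz _ _))// -mulrBr normrM.
Qed.

Lemma is_derive_cos_lin (c t : R) : is_derive t 1 (fun s => cos (c * s)) (- (c * sin (c * t))).
Proof.
have := is_derive1_comp (is_derive_cos _) (is_derive_affine c 0 t).
rewrite addr0 mulNr mulrC; congr (is_derive _ _ _ _); apply/funext => v /=.
by rewrite addr0.
Qed.

Lemma is_derive_sin_lin (c t : R) : is_derive t 1 (fun s => sin (c * s)) (c * cos (c * t)).
Proof.
have := is_derive1_comp (is_derive_sin _) (is_derive_affine c 0 t).
rewrite addr0 mulrC; congr (is_derive _ _ _ _); apply/funext => v /=.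
by rewrite addr0.
Qed.

(** The function sin(u) / u as an integral: no case distinction at 0, and bounds and Lipschitz
    constants come from those of the cosine. *)
Definition sinc u := integ 0 1 (fun v => cos (u * v)).

Lemma sincE u : u * sinc u = sin u.
Proof.
rewrite /sinc -integZ; last exact: cos_lin_cont.
have c : cont_on 0 1 (fun v => u * cos (u * v)).
  by apply: cont_onM; [exact: cont_on_cst|exact: cos_lin_cont].
rewrite (integ_FTC ler01 (fun t _ => is_derive_sin_lin u t) c).
by rewrite mulr1 mulr0 sin0 subr0.
Qed.

Lemma integ01_bound (g : R -> R) M : cont_on 0 1 g ->
  (forall t, 0 <= t <= 1 -> `|g t| <= M) -> `|integ 0 1 g| <= M.
Proof. by move=> gc gM; have := integ_bound ler01 gc gM; rewrite subr0 mulr1. Qed.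

Lemma integB a b (f g : R -> R) : cont_on a b f -> cont_on a b g ->
  integ a b (fun t => f t - g t) = integ a b f - integ a b g.
Proof.
move=> fc gc.
have -> : (fun t => f t - g t) = (fun t => f t + -1 * g t).
  by apply/funext => t; rewrite mulN1r.
rewrite integD//; last by apply: cont_onM => //; exact: cont_on_cst.
by rewrite integZ// mulN1r.
Qed.

Lemma cont_onB a b (f g : R -> R) : cont_on a b f -> cont_on a b g ->
  cont_on a b (fun t => f t - g t).
Proof. by move=> fc gc; apply: cont_onD => //; exact: cont_onN. Qed.

Lemma sinc_le1 u : `|sinc u| <= 1.
Proof.
apply: integ01_bound; first exact: cos_lin_cont.
by move=> t _; rewrite ler_norml cos_geN1 cos_le1.
Qed.

Lemma sinc_lipschitz u v : `|sinc u - sinc v| <= `|u - v|.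
Proof.
rewrite /sinc -integB; [|exact: cos_lin_cont|exact: cos_lin_cont].
apply: integ01_bound; first by apply: cont_onB; exact: cos_lin_cont.
move=> t /andP[t0 t1]; rewrite (le_trans (cos_lipschitz _ _))// -mulrBl normrM.
by rewrite ler_piMr// ger0_norm.
Qed.

Lemma sincN u : sinc (- u) = sinc u.
Proof. by apply: eq_integ => v _; rewrite mulNr cosN. Qed.

(* [xi s x] is sin (s x) / s, extended continuously by x at s = 0. *)
Definition xi s x := x * sinc (s * x).

Lemma xiE s x : s * xi s x = sin (s * x).
Proof. by rewrite /xi mulrA sincE. Qed.

Lemma xi_le s x : `|xi s x| <= `|x|.
Proof. by rewrite /xi normrM ler_piMr// sinc_le1. Qed.

Lemma xi_lipschitz s s' x : `|xi s x - xi s' x| <= x ^+ 2 * `|s - s'|.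
Proof.
rewrite /xi -mulrBr normrM (le_trans (ler_wpM2l _ (sinc_lipschitz _ _)))//.
by rewrite -mulrBl normrM mulrCA -expr2 real_normK ?num_real// mulrC.
Qed.

Lemma xi_taylor s x h : 0 <= s <= 1 -> `|xi s (x + h) - xi s x - h * cos (s * x)| <= h ^+ 2.
Proof.
move=> /andP[]; rewrite le_eqVlt => /predU1P[<- _|s0 s1].
  have s00 : sinc 0 = 1.
    rewrite /sinc (@eq_integ _ 0 1 _ (fun=> 1)); last by move=> t _; rewrite mul0r cos0.
    by rewrite integ_cst ?ler01// subr0 mulr1.
  rewrite /xi !mul0r cos0 s00 !mulr1 (_ : x + h - x - h = 0) ?normr0 ?sqr_ge0//; ring.
rewrite -(ler_pM2l s0) -{1}(gtr0_norm s0) -normrM.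
have -> : s * (xi s (x + h) - xi s x - h * cos (s * x)) =
    sin (s * x + s * h) - sin (s * x) - (s * h) * cos (s * x).
  by rewrite !mulrBr !xiE mulrDr; ring.
rewrite (le_trans (sin_taylor1 _ _))// exprMn expr2 -mulrA.
by rewrite (ler_wpM2l (ltW s0))// ler_piMl ?sqr_ge0.
Qed.

(* Chosen so that the kernel [kap] below equals
   4 pi^2 (1 + cos x) / (pi^2 - x^2)^2, nonnegative and O(x^-4). *)
Definition wt s : R := (1 - s) * cos (pi * s) + sin (pi * s) / pi.

Lemma pi_neq0 : pi != 0 :> R.
Proof. by rewrite gt_eqF// pi_gt0. Qed.

Lemma pi_ge1 : 1 <= pi :> R.
Proof. by rewrite (le_trans _ (@pi_ge2 R))// ler1n. Qed.

Lemma wt_le2 s : 0 <= s <= 1 -> `|wt s| <= 2.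
Proof.
move=> /andP[s0 s1]; rewrite (le_trans (ler_normD _ _))// -[2]/(1 + 1) lerD//.
  rewrite normrM mulr_ile1 ?normr_ge0//; last by rewrite ler_norml cos_geN1 cos_le1.
  by rewrite ger0_norm ?subr_ge0//; lra.
rewrite normrM mulr_ile1 ?normr_ge0//; first by rewrite ler_norml sin_geN1 sin_le1.
by rewrite normfV ger0_norm ?pi_ge0// invf_le1 ?pi_gt0// pi_ge1.
Qed.

Lemma is_derive_wt (t : R) : is_derive t 1 wt (- (pi * (1 - t) * sin (pi * t))).
Proof.
have D1 : is_derive t 1 (fun s : R => 1 - s) (-1).
  by apply: is_derive_eq; ring.
have D2 := is_deriveM D1 (is_derive_cos_lin pi t).
have D3 := is_deriveZ pi^-1 (is_derive_sin_lin pi t).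
have := is_deriveD D2 D3; congr (is_derive _ _ _ _).
  apply/funext => s; rewrite [LHS](_ : _ = (1 - s) * cos (pi * s) + pi^-1 * sin (pi * s))//.
  by rewrite /wt; ring.
rewrite [LHS](_ : _ = (1 - t) * - (pi * sin (pi * t)) + cos (pi * t) * (-1) +
  pi^-1 * (pi * cos (pi * t)))//.
by rewrite mulKf ?pi_neq0//; ring.
Qed.

Lemma wt_lipschitz s t : 0 <= s <= 1 -> 0 <= t <= 1 -> `|wt s - wt t| <= pi * `|s - t|.
Proof.
wlog st : s t / t <= s.
  move=> W s1 t1; have [ts|/ltW ts] := leP t s; first exact: W.
  by rewrite distrC (distrC s); exact: W.
move=> /andP[s0 s1] /andP[t0 t1]; rewrite [X in _ <= _ * X]ger0_norm ?subr_ge0//.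
apply: (derive_bound st (fun u _ => is_derive_wt u)) => u /andP[u0 u1].
rewrite normrN -mulrA normrM (ger0_norm (pi_ge0 _)) ler_piMr ?pi_ge0//.
rewrite normrM mulr_ile1 ?normr_ge0//; last by rewrite ler_norml sin_geN1 sin_le1.
by rewrite ger0_norm; lra.
Qed.

End kernel.

Section smoothing_kernel.
Variable R : realType.
Implicit Types (x y h s u v t : R).
Local Notation p := (pi : R).

Lemma is_deriveM_fun (f g : R -> R) t a b : is_derive t 1 f a -> is_derive t 1 g b ->
  is_derive t 1 (fun s => f s * g s) (f t * b + g t * a).
Proof. by move=> fa gb; exact: (is_deriveM fa gb). Qed.

Lemma is_deriveD_fun (f g : R -> R) t a b : is_derive t 1 f a -> is_derive t 1 g b ->
  is_derive t 1 (fun s => f s + g s) (a + b).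
Proof. by move=> fa gb; exact: (is_deriveD fa gb). Qed.

Lemma is_deriveZ_fun (f : R -> R) t a c : is_derive t 1 f a ->
  is_derive t 1 (fun s => c * f s) (c * a).
Proof. by move=> fa; exact: (is_deriveZ c fa). Qed.

Lemma is_derive_1B (t : R) : is_derive t 1 (fun s : R => 1 - s) (-1).
Proof. by apply: is_derive_eq; ring. Qed.

(** Fourier transform of the even extension of [wt], the Bohman window, supported in [-1, 1].
    Expectations of it involve a characteristic function on that interval only. *)
Definition kap x := 2 * integ 0 1 (fun s => wt s * cos (s * x)).
(** The odd primitive of [kap]. Divided by 2 [Klim] it increases from -1/2 to 1/2 and imitates the
    unit step minus 1/2. *)
Definition Kern x := 2 * integ 0 1 (fun s => wt s * xi s x).

Lemma wt_cont a b : cont_on a b (@wt R).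
Proof. by move=> t _; exact: is_derive_continuous (is_derive_wt t). Qed.

Lemma cos_cont a b x : cont_on a b (fun s => cos (s * x)).
Proof.
move=> t _; apply: (@lipschitz_continuous _ _ `|x|) => s.
by rewrite (le_trans (cos_lipschitz _ _))// -mulrBl normrM mulrC.
Qed.

Lemma xi_cont a b x : cont_on a b (fun s => xi s x).
Proof.
by move=> t _; apply: (@lipschitz_continuous _ _ (x ^+ 2)) => s; exact: xi_lipschitz.
Qed.

Lemma wcos_cont a b x : cont_on a b (fun s => wt s * cos (s * x)).
Proof. by apply: cont_onM; [exact: wt_cont|exact: cos_cont]. Qed.

Lemma wxi_cont a b x : cont_on a b (fun s => wt s * xi s x).
Proof. by apply: cont_onM; [exact: wt_cont|exact: xi_cont]. Qed.

Lemma Kern_taylor x h : `|Kern (x + h) - Kern x - h * kap x| <= 4 * h ^+ 2.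
Proof.
have -> : Kern (x + h) - Kern x - h * kap x =
    2 * integ 0 1 (fun s => wt s * xi s (x + h) - wt s * xi s x - h * (wt s * cos (s * x))).
  rewrite integB; last 2 first.
  - by apply: cont_onB; exact: wxi_cont.
  - by apply: cont_onM; [exact: cont_on_cst|exact: wcos_cont].
  rewrite integB; [|exact: wxi_cont|exact: wxi_cont].
  by rewrite integZ; [rewrite /Kern /kap; ring|exact: wcos_cont].
have -> : 4 * h ^+ 2 = 2 * (2 * h ^+ 2) by ring.
rewrite normrM ger0_norm// ler_wpM2l//; apply: integ01_bound.
  apply: cont_onB; first by apply: cont_onB; exact: wxi_cont.
  by apply: cont_onM; [exact: cont_on_cst|exact: wcos_cont].
move=> t t01; have -> : wt t * xi t (x + h) - wt t * xi t x - h * (wt t * cos (t * x)) =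
  wt t * (xi t (x + h) - xi t x - h * cos (t * x)) by ring.
by rewrite normrM ler_pM// ?wt_le2 ?xi_taylor.
Qed.

Lemma is_derive_Kern x : is_derive x 1 Kern (kap x).
Proof.
apply/is_derive_epsP => e e0; exists (e / 4); first by rewrite divr_gt0.
move=> h; rewrite ltr_pdivlMr// => he.
rewrite (mulrC (kap x)) (le_trans (Kern_taylor _ _))// -real_normK ?num_real//.
rewrite expr2 mulrA ler_wpM2r// mulrC; exact: ltW.
Qed.

Lemma kap_lipschitz x y : `|kap x - kap y| <= 4 * `|x - y|.
Proof.
have -> : kap x - kap y = 2 * integ 0 1 (fun s => wt s * cos (s * x) - wt s * cos (s * y)).
  by rewrite integB; [rewrite /kap; ring|exact: wcos_cont|exact: wcos_cont].
have -> : 4 * `|x - y| = 2 * (2 * `|x - y|) by ring.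
rewrite normrM ger0_norm// ler_wpM2l//; apply: integ01_bound.
  by apply: cont_onB; exact: wcos_cont.
move=> t t01; rewrite -mulrBr normrM ler_pM// ?wt_le2//.
rewrite (le_trans (cos_lipschitz _ _))// -mulrBr normrM ler_piMl//.
by case/andP: t01 => t0 t1; rewrite ger0_norm.
Qed.

(** Primitive in [s] of wt(s) cos(sx) found by repeated integration by parts, multiplied by (pi^2 -
    x^2)^2 to avoid dividing by 0 at x = pi or -pi. *)
Definition anti x s : R :=
  (1 - s) * (p * (p ^+ 2 - x ^+ 2) * (sin (p * s) * cos (x * s))
             + - (x * (p ^+ 2 - x ^+ 2)) * (cos (p * s) * sin (x * s)))
  + (- (2 * p ^+ 2) * (cos (p * s) * cos (x * s))
     + x * (x ^+ 2 - 3 * p ^+ 2) / p * (sin (p * s) * sin (x * s))).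

Lemma is_derive_anti x s :
  is_derive s 1 (anti x) ((p ^+ 2 - x ^+ 2) ^+ 2 * (wt s * cos (s * x))).
Proof.
have Sp := is_derive_sin_lin p s; have Cp := is_derive_cos_lin p s.
have Sx := is_derive_sin_lin x s; have Cx := is_derive_cos_lin x s.
have := is_deriveD_fun
  (is_deriveM_fun (is_derive_1B s)
     (is_deriveD_fun (is_deriveZ_fun (p * (p ^+ 2 - x ^+ 2)) (is_deriveM_fun Sp Cx))
        (is_deriveZ_fun (- (x * (p ^+ 2 - x ^+ 2))) (is_deriveM_fun Cp Sx))))
  (is_deriveD_fun (is_deriveZ_fun (- (2 * p ^+ 2)) (is_deriveM_fun Cp Cx))
        (is_deriveZ_fun (x * (x ^+ 2 - 3 * p ^+ 2) / p) (is_deriveM_fun Sp Sx))).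
congr (is_derive _ _ _ _); rewrite /wt (mulrC s x).
move: (@pi_neq0 R); move: (pi : R) => q q0 {Sp Cp Sx Cx}; by field; exact: q0.
Qed.

Lemma kapE x : kap x * (p ^+ 2 - x ^+ 2) ^+ 2 = 4 * p ^+ 2 * (1 + cos x).
Proof.
have c : cont_on 0 1 (fun s => (p ^+ 2 - x ^+ 2) ^+ 2 * (wt s * cos (s * x))).
  by apply: cont_onM; [exact: cont_on_cst|exact: wcos_cont].
have := integ_FTC ler01 (fun t _ => is_derive_anti x t) c.
rewrite integZ; last exact: wcos_cont.
rewrite /anti !mulr1 !mulr0 cospi sinpi !sin0 !cos0 => E.
rewrite (_ : kap x * _ = 2 * ((p ^+ 2 - x ^+ 2) ^+ 2 * integ 0 1 (fun s => wt s * cos (s * x)))).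
  by rewrite E; move: (@pi_neq0 R); move: (pi : R) => q q0; field; exact: q0.
by rewrite /kap; ring.
Qed.

Lemma kap_ge0_off x : x ^+ 2 != p ^+ 2 -> 0 <= kap x.
Proof.
move=> xp; have q0 : 0 < (p ^+ 2 - x ^+ 2) ^+ 2.
  by rewrite lt_def sqr_ge0 andbT sqrf_eq0 subr_eq0 eq_sym.
by rewrite -(pmulr_lge0 _ q0) kapE mulr_ge0 ?(mulr_ge0 _ (sqr_ge0 _))//; have := cos_geN1 x; lra.
Qed.

(** At x^2 = pi^2 the identity [kapE] reads 0 = 0. There the sign is inherited from nearby points
    through the Lipschitz bound. *)
Lemma kap_ge0 x : 0 <= kap x.
Proof.
have [xp|] := eqVneq (x ^+ 2) (p ^+ 2); last exact: kap_ge0_off.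
rewrite leNgt; apply/negP => k0.
pose h := Num.min 1 (- kap x / 8).
have h0 : 0 < h by rewrite lt_min ltr01 divr_gt0// oppr_gt0.
have h1 : h <= 1 by rewrite ge_min lexx.
have h8 : h <= - kap x / 8 by rewrite ge_min lexx orbT.
have : 0 <= kap (x + h).
  apply: kap_ge0_off; rewrite -xp; apply/negP => /eqP E.
  have hE : h * (2 * x + h) = (x + h) ^+ 2 - x ^+ 2 by ring.
  have /eqP : h * (2 * x + h) = 0 by rewrite hE E subrr.
  rewrite mulf_eq0 gt_eqF//= => /eqP xh.
  have /eqP : (x - p) * (x + p) = 0 by rewrite -subr_sqr xp subrr.
  have := @pi_ge2 R; rewrite mulf_eq0 subr_eq0 addr_eq0 => p2 /orP[] /eqP xE; subst x; lra.
have := kap_lipschitz (x + h) x; rewrite addrAC subrr add0r (gtr0_norm h0) => /ler_normlP[].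
lra.
Qed.

Lemma Kern_mono x y : x <= y -> Kern x <= Kern y.
Proof.
move=> xy; rewrite -lerN2; apply: (derive_le0 (f := fun t => - Kern t) xy).
  by move=> t _; exact: is_deriveN (is_derive_Kern t).
by move=> t _; rewrite oppr_le0 kap_ge0.
Qed.

Lemma KernN x : Kern (- x) = - Kern x.
Proof.
have c := @wxi_cont 0 1 x.
rewrite /Kern (_ : integ 0 1 (fun s => wt s * xi s (- x)) =
  -1 * integ 0 1 (fun s => wt s * xi s x)); first by ring.
rewrite -integZ//; apply: eq_integ => t _.
by rewrite /xi mulrN sincN; ring.
Qed.

Lemma Kern0 : Kern 0 = 0.
Proof. have := KernN 0; rewrite oppr0; lra. Qed.

Lemma pi_le4 : p <= 4.
Proof. have /andP[_] := @pihalf_02 R; lra. Qed.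

Lemma kap0_ge : 1 / 2 <= kap 0.
Proof.
have := kapE 0; rewrite expr0n subr0 cos0 -[in X in _ = X -> _]/(p ^+ 2) => E.
have p0 : 0 < p ^+ 2 by rewrite exprn_gt0 ?pi_gt0.
have p16 : p ^+ 2 <= 16.
  have -> : (16 : R) = 4 ^+ 2 by ring.
  by rewrite lerXn2r ?nnegrE ?pi_ge0// pi_le4.
have : (kap 0 * p ^+ 2) * p ^+ 2 = 8 * p ^+ 2.
  by rewrite -mulrA -expr2 E; ring.
move/(mulIf (lt0r_neq0 p0)) => E2.
have k0 := kap_ge0 0.
have : kap 0 * p ^+ 2 <= kap 0 * 16 by rewrite ler_wpM2l.
rewrite E2; lra.
Qed.

(** To first order this is kap(0) / 16 >= 1/32, with an error of at most 4 / 256 = 1/64. It makes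
    the normalisation by [Klim] legitimate. *)
Lemma Kern_gt0 : 0 < Kern (1 / 16).
Proof.
have := Kern_taylor 0 (1 / 16); rewrite add0r Kern0 subr0 => /ler_normlP[+ _].
have := kap0_ge; rewrite expr2; lra.
Qed.

Lemma kap_decay x : 2 * p <= x -> kap x <= 16 * p ^+ 2 / x ^+ 4.
Proof.
move=> px; have p1 := @pi_ge1 R; have p0 : 0 <= p by exact: pi_ge0.
have x0 : 0 < x by lra.
rewrite ler_pdivlMr ?exprn_gt0//.
have H : 9 / 16 * x ^+ 4 <= (p ^+ 2 - x ^+ 2) ^+ 2.
  have P1 : p ^+ 2 <= x ^+ 2 / 4.
    have : (2 * p) ^+ 2 <= x ^+ 2 by rewrite lerXn2r ?nnegrE ?mulr_ge0// ltW.
    by rewrite exprMn; lra.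
  have -> : (p ^+ 2 - x ^+ 2) ^+ 2 = (x ^+ 2 - p ^+ 2) ^+ 2 by ring.
  have -> : 9 / 16 * x ^+ 4 = (3 / 4 * x ^+ 2) ^+ 2 by field.
  have x2 := sqr_ge0 x.
  by rewrite lerXn2r ?nnegrE ?mulr_ge0//; lra.
have := ler_wpM2l (kap_ge0 x) H; rewrite kapE => E.
have : 4 * p ^+ 2 * (1 + cos x) <= 4 * p ^+ 2 * 2.
  rewrite ler_wpM2l//; first by rewrite mulr_ge0// sqr_ge0.
  have := cos_le1 x; lra.
have := sqr_ge0 p; lra.
Qed.

Lemma is_derive_cube x : 0 < x -> is_derive x 1 (fun t => t ^- 3) (- 3 / x ^+ 4).
Proof.
move=> x0; have xn : x ^+ 3 != 0 by rewrite expf_neq0// gt_eqF.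
have D3 : is_derive x 1 (fun t => t ^+ 3) (3 * x ^+ 2).
  have I : is_derive x 1 (fun t : R => t) 1 by exact: is_derive_id.
  have := is_deriveM_fun I (is_deriveM_fun I I).
  congr (is_derive _ _ _ _); ring.
have := @is_deriveV _ (fun t => t ^+ 3) x _ 1 xn D3; congr (is_derive _ _ _ _).
rewrite /GRing.scale /=; field; exact: lt0r_neq0.
Qed.

(** Kern(t) + 16 pi^2 t^(-3) is decreasing, because its second term has derivative -48 pi^2 / t^4
    and [kap] is at most 16 pi^2 / t^4. *)
Lemma Kern_tail x y : 2 * p <= x -> x <= y -> Kern y <= Kern x + 16 * p ^+ 2 / x ^+ 3.
Proof.
move=> px xy; have p1 := @pi_ge1 R.
have c0 : 0 <= 16 * p ^+ 2 by rewrite mulr_ge0// sqr_ge0.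
have : Kern y + 16 * p ^+ 2 * y ^- 3 <= Kern x + 16 * p ^+ 2 * x ^- 3.
  apply: (derive_le0 (f := fun t => Kern t + 16 * p ^+ 2 * t ^- 3)
    (f' := fun t => kap t + 16 * p ^+ 2 * (- 3 / t ^+ 4)) xy) => t /andP[xt ty].
    apply: is_deriveD_fun; first exact: is_derive_Kern.
    by apply: is_deriveZ_fun; apply: is_derive_cube; lra.
  have := @kap_decay t (le_trans px xt).
  have : 0 <= 16 * p ^+ 2 / t ^+ 4 by rewrite divr_ge0// exprn_ge0; lra.
  lra.
apply: le_trans; rewrite lerDl mulr_ge0// invr_ge0 exprn_ge0; lra.
Qed.

Definition Klim := sup (range Kern).

Lemma has_sup_Kern : has_sup (range Kern).
Proof.
split; first by exists (Kern 0), 0.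
exists (Kern (2 * p) + 16 * p ^+ 2 / (2 * p) ^+ 3) => _ [y _ <-].
have [yp|/ltW yp] := leP y (2 * p); last exact: Kern_tail.
rewrite (le_trans (Kern_mono yp))// lerDl divr_ge0 ?exprn_ge0 ?mulr_ge0 ?pi_ge0//.
Qed.

Lemma Kern_le_lim x : Kern x <= Klim.
Proof. by apply: ub_le_sup; [exact: has_sup_Kern.2|exists x]. Qed.

Lemma Klim_gt0 : 0 < Klim.
Proof. exact: lt_le_trans Kern_gt0 (Kern_le_lim _). Qed.

Lemma lim_sub_Kern x : 2 * p <= x -> Klim - Kern x <= 16 * p ^+ 2 / x ^+ 3.
Proof.
move=> px; rewrite lerBlDl; apply: ge_sup; first exact: has_sup_Kern.1.
move=> _ [y _ <-]; have [xy|/ltW yx] := leP x y; first exact: Kern_tail.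
have p1 := @pi_ge1 R; rewrite (le_trans (Kern_mono yx))// lerDl divr_ge0 ?exprn_ge0//.
  by rewrite mulr_ge0// sqr_ge0.
lra.
Qed.

End smoothing_kernel.

Section fejer_kernel.
Variable R : realType.
Implicit Types (x y h s u v t : R).
Local Notation p := (pi : R).

Definition fejer x := 2 * integ 0 1 (fun s => (1 - s) * cos (s * x)).

Lemma lin_cont a b : cont_on a b (fun s : R => 1 - s).
Proof. by move=> t _; exact: is_derive_continuous (is_derive_1B t). Qed.

Lemma fejer_cont a b x : cont_on a b (fun s => (1 - s) * cos (s * x)).
Proof. by apply: cont_onM; [exact: lin_cont|exact: cos_cont]. Qed.

Lemma fejerE x : x ^+ 2 * fejer x = 2 * (1 - cos x).
Proof.
have c : cont_on 0 1 (fun s => x ^+ 2 * ((1 - s) * cos (s * x))).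
  by apply: cont_onM; [exact: cont_on_cst|exact: fejer_cont].
have D t : is_derive t 1 (fun s => x * ((1 - s) * sin (x * s)) + -1 * cos (x * s))
    (x ^+ 2 * ((1 - t) * cos (t * x))).
  have := is_deriveD_fun
    (is_deriveZ_fun x (is_deriveM_fun (is_derive_1B t) (is_derive_sin_lin x t)))
    (is_deriveZ_fun (-1) (is_derive_cos_lin x t)).
  by congr (is_derive _ _ _ _); rewrite (mulrC t); ring.
have := integ_FTC ler01 (fun t _ => D t) c.
rewrite integZ; last exact: fejer_cont.
rewrite !mulr0 sin0 cos0 mulr1 => E.
by rewrite /fejer mulrCA E; ring.
Qed.

Lemma fejer_ge0 x : 0 <= fejer x.
Proof.
have [->|x0] := eqVneq x 0.
  rewrite mulr_ge0// integ_ge0// => t /andP[t0 t1].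
  by rewrite mulr0 cos0 mulr1 subr_ge0.
have q0 : 0 < x ^+ 2 by rewrite lt_def sqr_ge0 sqrf_eq0 x0.
rewrite -(pmulr_rge0 _ q0) fejerE; have := cos_le1 x; lra.
Qed.

(** The numerators 2(1 - cos x) and 2(1 + cos x) of the two kernels add up to 4, whatever x is. *)
Lemma fejer_sum_ge x : 4 <= (fejer x + fejer (x + p)) * (2 * x ^+ 2 + 2 * p ^+ 2).
Proof.
have f1 := fejer_ge0 x; have f2 := fejer_ge0 (x + p).
have E1 := fejerE x; have E2 := fejerE (x + p); rewrite cosDpi in E2.
have : fejer x * x ^+ 2 <= fejer x * (2 * x ^+ 2 + 2 * p ^+ 2).
  by rewrite ler_wpM2l//; move: (sqr_ge0 p) (sqr_ge0 x); lra.
have : fejer (x + p) * (x + p) ^+ 2 <= fejer (x + p) * (2 * x ^+ 2 + 2 * p ^+ 2).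
  have H (q : R) : (x + q) ^+ 2 <= 2 * x ^+ 2 + 2 * q ^+ 2.
    by rewrite -subr_ge0 (_ : _ - _ = (x - q) ^+ 2) ?sqr_ge0//; ring.
  by rewrite ler_wpM2l.
rewrite mulrDl; lra.
Qed.

(** The first term serves x > 2 pi, where [Kern] approaches its limit like x^(-3); the second serves
    [0, 2 pi], where an error of 1/2 meets a weight of at most 10 pi^2. *)
Definition step_constant : R := 8 * p ^+ 2 / Klim R + 10 * p ^+ 2 / 8.

Lemma step_constant_ge0 : 0 <= step_constant.
Proof.
have p2 := sqr_ge0 p; have L0 := Klim_gt0 R.
have : 0 <= 8 * p ^+ 2 / Klim R by rewrite divr_ge0 ?(ltW L0)//; lra.
rewrite /step_constant; lra.
Qed.

Lemma abs_approx x : 0 <= x ->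
  `|1 / 2 - Kern x / (2 * Klim R)| * (2 * x ^+ 2 + 2 * p ^+ 2) <= 4 * step_constant.
Proof.
move=> x0; have L0 := Klim_gt0 R; have p1 := @pi_ge1 R.
have p2 := sqr_ge0 p; have x2 := sqr_ge0 x.
have -> : 1 / 2 - Kern x / (2 * Klim R) = (Klim R - Kern x) / (2 * Klim R).
  by field; exact: lt0r_neq0.
rewrite ger0_norm; last by rewrite divr_ge0 ?mulr_ge0 ?subr_ge0 ?Kern_le_lim// ltW.
have c1 : 0 <= 8 * p ^+ 2 / Klim R by rewrite divr_ge0 ?(ltW L0)//; lra.
have [xp|px] := leP x (2 * p).
  have K0 : 0 <= Kern x by rewrite -(Kern0 R) Kern_mono.
  have d2 : (Klim R - Kern x) / (2 * Klim R) <= 1 / 2.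
    by rewrite ler_pdivrMr ?mulr_gt0//; lra.
  have m2 : 2 * x ^+ 2 + 2 * p ^+ 2 <= 10 * p ^+ 2.
    have : x ^+ 2 <= (2 * p) ^+ 2 by rewrite lerXn2r ?nnegrE//; lra.
    by rewrite exprMn; lra.
  apply: (le_trans (ler_pM _ _ d2 m2)).
  - by rewrite divr_ge0 ?mulr_ge0 ?subr_ge0 ?Kern_le_lim// ltW.
  - lra.
  by rewrite /step_constant; lra.
have x1 : 1 <= x by lra.
have d2 : (Klim R - Kern x) / (2 * Klim R) <= 8 * p ^+ 2 / Klim R / x ^+ 3.
  rewrite (_ : 8 * p ^+ 2 / Klim R / x ^+ 3 = 16 * p ^+ 2 / x ^+ 3 / (2 * Klim R)).
    by rewrite ler_pM2r ?invr_gt0 ?mulr_gt0//; exact/lim_sub_Kern/ltW.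
  move: (Klim R) L0 => L L0; move: (p ^+ 2) => q.
  by field; rewrite !lt0r_neq0//; lra.
have m2 : 2 * x ^+ 2 + 2 * p ^+ 2 <= 4 * x ^+ 3.
  have : p ^+ 2 <= x ^+ 2 by rewrite lerXn2r ?nnegrE//; lra.
  have : x ^+ 2 <= x ^+ 3 by rewrite [leRHS]exprS ler_peMl.
  lra.
apply: (le_trans (ler_pM _ _ d2 m2)).
- by rewrite divr_ge0 ?mulr_ge0 ?subr_ge0 ?Kern_le_lim// ltW.
- lra.
have x3 : 0 < x ^+ 3 by rewrite exprn_gt0//; lra.
rewrite mulrCA divfK ?lt0r_neq0// ler_wpM2l// /step_constant.
lra.
Qed.

(* The Fejer kernel vanishes at nonzero multiples of 2 pi; adding its
   translate by pi removes these zeros. *)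
Lemma step_approx x : `|((0 <= x)%R)%:R - 1 / 2 - Kern x / (2 * Klim R)| <=
  step_constant * (fejer x + fejer (x + p)).
Proof.
have p1 := @pi_ge1 R.
have m0 : 0 < 2 * x ^+ 2 + 2 * p ^+ 2.
  have : 1 <= p ^+ 2 by rewrite exprn_ege1.
  have := sqr_ge0 x; lra.
rewrite -(ler_pM2r m0); apply: (@le_trans _ _ (4 * step_constant)); last first.
  by rewrite [leLHS]mulrC -[leRHS]mulrA ler_wpM2l ?step_constant_ge0// fejer_sum_ge.
have [x0|x0] := leP 0 x.
  by rewrite (_ : _ - 1 / 2 = 1 / 2) ?abs_approx//=; lra.
have := @abs_approx (- x) ltac:(lra).
rewrite KernN sqrrN; congr (_ * _ <= _).
rewrite -normrN /=; congr `|_|; rewrite mulNr; lra.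
Qed.

End fejer_kernel.

(** * The smoothing inequality *)

Section riemann_sums.
Variable R : realType.
Implicit Types (phi : R -> R) (M : R).

(** On each cell of length 1 / (n + 1) the Lipschitz bound gives an error of M / (n + 1)^2. *)
Lemma riemann_sum_bound phi M n : cont_on 0 1 phi -> 0 <= M ->
  (forall s u, 0 <= s <= 1 -> 0 <= u <= 1 -> `|phi s - phi u| <= M * `|s - u|) ->
  `|integ 0 1 phi - n.+1%:R^-1 * \sum_(i < n.+1) phi (i%:R / n.+1%:R)| <= M / n.+1%:R.
Proof.
move=> phic M0 philip; set N : R := n.+1%:R.
have N0 : 0 < N by rewrite ltr0n.
have N1 : N^-1 >= 0 by rewrite invr_ge0 ltW.
suff H k : (k <= n.+1)%N ->
    `|integ 0 (k%:R / N) phi - N^-1 * \sum_(i < k) phi (i%:R / N)| <= k%:R * (M / N / N).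
  have := H n.+1 (leqnn _); rewrite -/N divff ?lt0r_neq0//.
  by rewrite mulrA (mulrC N) divfK ?lt0r_neq0.
elim: k => [_|k IH kn].
  rewrite mul0r big_ord0 mulr0 subr0 mul0r (_ : integ 0 0 phi = 0) ?normr0//.
  by rewrite /integ set_itv1 Rintegral_set1.
have k0 : 0 <= k%:R / N by rewrite mulr_ge0.
have kk : k%:R / N <= k.+1%:R / N by rewrite ler_wpM2r// ler_nat.
have k1 : k.+1%:R / N <= 1 by rewrite ler_pdivrMr// mul1r ler_nat.
have dk : k.+1%:R / N - k%:R / N = N^-1 by rewrite -mulrBl -natrB// subSnn mul1r.
have c1 : cont_on 0 (k.+1%:R / N) phi by apply: cont_onW phic.
have c2 : cont_on (k%:R / N) (k.+1%:R / N) phi by apply: cont_onW phic.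
rewrite (integ_cat k0 kk c1) big_ord_recr /= mulrDr.
have -> : integ 0 (k%:R / N) phi + integ (k%:R / N) (k.+1%:R / N) phi -
   (N^-1 * \sum_(i < k) phi (i%:R / N) + N^-1 * phi (k%:R / N)) =
  (integ 0 (k%:R / N) phi - N^-1 * \sum_(i < k) phi (i%:R / N)) +
  integ (k%:R / N) (k.+1%:R / N) (fun s => phi s - phi (k%:R / N)).
  rewrite integB//; last exact: cont_on_cst.
  by rewrite integ_cst// dk; ring.
rewrite (_ : k.+1%:R * (M / N / N) = k%:R * (M / N / N) + M / N / N); last first.
  by rewrite -natr1; ring.
rewrite (le_trans (ler_normD _ _))// lerD//; first exact/IH/ltnW.
rewrite -[X in _ <= _ * X]dk; apply: integ_bound => //.
  by apply: cont_onB => //; exact: cont_on_cst.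
move=> t /andP[t0 t1].
have t01 : 0 <= t <= 1 by rewrite (le_trans k0 t0) (le_trans t1 k1).
have k01 : 0 <= k%:R / N <= 1 by rewrite k0 (le_trans kk k1).
rewrite (le_trans (philip _ _ t01 k01))//.
by rewrite ler_wpM2l// ger0_norm ?subr_ge0// -[leRHS]dk lerB.
Qed.

End riemann_sums.

Section expectation_of_integral.
Context d (T : measurableType d) (R : realType) (P : probability T R).
Implicit Types (g : R -> T -> R) (B : T -> R).

Lemma Pint_sum (I : Type) (r : seq I) (g : I -> T -> R) : (forall i, Pint P (g i)) ->
  Pint P (fun w => \sum_(i <- r) g i w).
Proof.
move=> ig; elim: r => [|i r IH].
  by have := Pint_cst P 0; congr Pint; apply/funext => w; rewrite big_nil.
by have := PintD (ig i) IH; congr Pint; apply/funext => w; rewrite big_cons.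
Qed.

Lemma Ex_sum (I : Type) (r : seq I) (g : I -> T -> R) : (forall i, Pint P (g i)) ->
  Ex P (fun w => \sum_(i <- r) g i w) = \sum_(i <- r) Ex P (g i).
Proof.
move=> ig; elim: r => [|i r IH].
  by rewrite big_nil -[RHS](Ex_cst P 0); apply: eq_Rintegral => w _; rewrite big_nil.
rewrite big_cons -IH -ExD//; last exact: Pint_sum.
by apply: eq_Rintegral => w _; rewrite big_cons.
Qed.

(** Fubini for Lipschitz integrands: expectation commutes with Riemann sums, and both sides are
    within E B / (n + 1) of the same expected sum. *)
Lemma Ex_integ g B : Pint P (fun w => integ 0 1 (g^~ w)) ->
  (forall s, 0 <= s <= 1 -> Pint P (g s)) -> Pint P B -> (forall w, 0 <= B w) ->
  (forall w, cont_on 0 1 (g^~ w)) -> cont_on 0 1 (fun s => Ex P (g s)) ->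
  (forall w s u, 0 <= s <= 1 -> 0 <= u <= 1 -> `|g s w - g u w| <= B w * `|s - u|) ->
  Ex P (fun w => integ 0 1 (g^~ w)) = integ 0 1 (fun s => Ex P (g s)).
Proof.
move=> iG ig iB B0 gc gEc glip.
have EB0 : 0 <= Ex P B by apply: Rintegral_ge0.
have Elip s u : 0 <= s <= 1 -> 0 <= u <= 1 ->
    `|Ex P (g s) - Ex P (g u)| <= Ex P B * `|s - u|.
  move=> s1 u1; have := PintB (ig s s1) (ig u u1) => isu.
  rewrite -ExB; [|exact: ig|exact: ig].
  rewrite (le_trans (Ex_norm_le isu))// mulrC -ExZ//.
  apply: Ex_le; [exact: Pint_norm|exact: PintZ|move=> w; rewrite mulrC; exact: glip].
apply/eqP; rewrite -subr_eq0 -normr_le0; apply/ler_addgt0Pl => e e0; rewrite addr0.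
pose n := Num.trunc (2 * Ex P B / e).
have nP : 2 * Ex P B / e <= n.+1%:R by apply/ltW/truncnS_gt.
have n0 : 0 < n.+1%:R :> R by rewrite ltr0n.
pose S w := n.+1%:R^-1 * \sum_(i < n.+1) g (i%:R / n.+1%:R) w.
have i1 (i : 'I_n.+1) : 0 <= (i%:R / n.+1%:R : R) <= 1.
  by rewrite divr_ge0//= ler_pdivrMr// mul1r ler_nat ltnW.
have iS : Pint P S by apply: PintZ; apply: Pint_sum => i; exact: ig.
have ES : Ex P S = n.+1%:R^-1 * \sum_(i < n.+1) Ex P (g (i%:R / n.+1%:R)).
  by rewrite /S ExZ ?Ex_sum//; [|apply: Pint_sum] => i; exact: ig.
have b1 : `|Ex P (fun w => integ 0 1 (g^~ w)) - Ex P S| <= Ex P B / n.+1%:R.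
  have iD := PintB iG iS.
  rewrite -ExB// (le_trans (Ex_norm_le iD))// mulrC -ExZ//.
  apply: Ex_le; [exact: Pint_norm|exact: PintZ|move=> w].
  rewrite mulrC; apply: riemann_sum_bound => // s u; exact: glip.
have b2 := riemann_sum_bound n gEc EB0 Elip; rewrite -ES in b2.
rewrite (le_trans (ler_distD (Ex P S) _ _))// (distrC (Ex P S)).
have b3 : Ex P B / n.+1%:R <= e / 2.
  move: nP; rewrite ler_pdivrMr// => nP; rewrite ler_pdivrMr//.
  by rewrite -mulrA (mulrC 2^-1) mulrA ler_pdivlMr// mulrC (mulrC e).
by rewrite (le_trans (lerD b1 b2))// (le_trans (lerD b3 b3))// -splitr.
Qed.

End expectation_of_integral.

Section kernel_expectations.
Context d (T : measurableType d) (R : realType) (P : probability T R).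
Variable Z : T -> R.
Hypothesis mZ : measurable_fun setT Z.
Hypothesis iZ2 : Pint P (fun w => Z w ^+ 2).

Lemma Pint_first_moment : Pint P (fun w => `|Z w|).
Proof.
apply: (Pint_dom (h := fun w => 1 + Z w ^+ 2)).
- exact: measurableT_comp.
- by apply: PintD; [exact: Pint_cst|].
move=> w; rewrite normr_id; have [z1|/ltW z1] := leP `|Z w| 1.
  by rewrite ler_wpDr ?sqr_ge0.
by rewrite ler_wpDl// -real_normK ?num_real// expr2 ler_peMl.
Qed.

Lemma Pint_comp_bounded (g : R -> R) M : continuous g -> (forall x, `|g x| <= M) ->
  Pint P (fun w => g (Z w)).
Proof.
move=> gc gM; apply: (Pint_dom (h := fun=> M)).
- by apply: measurableT_comp mZ; exact: continuous_measurable_fun.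
- exact: Pint_cst.
- by move=> w; exact: gM.
Qed.

Lemma Kern_continuous : continuous (@Kern R).
Proof. by move=> x; exact: is_derive_continuous (is_derive_Kern x). Qed.

Lemma Pint_Kern : Pint P (fun w => Kern (Z w)).
Proof.
apply: (Pint_comp_bounded (M := Klim R)); first exact: Kern_continuous.
move=> x; rewrite ler_norml Kern_le_lim andbT lerNl -KernN; exact: Kern_le_lim.
Qed.

Lemma Pint_cos s : Pint P (fun w => cos (s * Z w)).
Proof.
apply: (Pint_comp_bounded (g := fun x => cos (s * x)) (M := 1)); last by move=> x; exact: ncos.
move=> x; apply: (@lipschitz_continuous _ _ `|s|) => y.
by rewrite (le_trans (cos_lipschitz _ _))// -mulrBr normrM.
Qed.

Lemma Pint_sin s : Pint P (fun w => sin (s * Z w)).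
Proof.
apply: (Pint_comp_bounded (g := fun x => sin (s * x)) (M := 1)); last by move=> x; exact: nsin.
move=> x; apply: (@lipschitz_continuous _ _ `|s|) => y.
by rewrite (le_trans (sin_lipschitz _ _))// -mulrBr normrM.
Qed.

Lemma fejer_lipschitz (x y : R) : `|fejer x - fejer y| <= 2 * `|x - y|.
Proof.
have -> : fejer x - fejer y = 2 * integ 0 1 (fun s => (1 - s) * cos (s * x) - (1 - s) * cos (s * y)).
  by rewrite integB; [rewrite /fejer; ring|exact: fejer_cont|exact: fejer_cont].
rewrite normrM ger0_norm// ler_wpM2l//; apply: integ01_bound.
  by apply: cont_onB; exact: fejer_cont.
move=> t /andP[t0 t1]; rewrite -mulrBr normrM.
have t1' : `|1 - t| <= 1 by rewrite ger0_norm; lra.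
rewrite (le_trans (ler_piMl (normr_ge0 _) t1'))// (le_trans (cos_lipschitz _ _))//.
by rewrite -mulrBr normrM ler_piMl// ger0_norm.
Qed.

Lemma Pint_xi s : Pint P (fun w => xi s (Z w)).
Proof.
apply: (Pint_dom _ Pint_first_moment) => [|w]; last exact: xi_le.
apply: measurable_funM => //.
apply: (@measurableT_comp _ _ _ _ _ _ (fun x => sinc (s * x))) mZ.
apply: continuous_measurable_fun => x; apply: (@lipschitz_continuous _ _ `|s|) => y.
by rewrite (le_trans (sinc_lipschitz _ _))// -mulrBr normrM.
Qed.

Lemma Ex_xi_lipschitz s u : `|Ex P (fun w => xi s (Z w)) - Ex P (fun w => xi u (Z w))| <=
  Ex P (fun w => Z w ^+ 2) * `|s - u|.
Proof.
have isu := PintB (Pint_xi s) (Pint_xi u).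
rewrite -ExB; [|exact: Pint_xi|exact: Pint_xi].
rewrite (le_trans (Ex_norm_le isu))// mulrC -ExZ//.
apply: Ex_le; [exact: Pint_norm|exact: PintZ|move=> w; rewrite mulrC; exact: xi_lipschitz].
Qed.

Lemma Ex_xi_cont a b : cont_on a b (fun s => Ex P (fun w => xi s (Z w))).
Proof. by move=> t _; apply: lipschitz_continuous => s; exact: Ex_xi_lipschitz. Qed.

Lemma Ex_Kern : Ex P (fun w => Kern (Z w)) =
  2 * integ 0 1 (fun s => wt s * Ex P (fun w => xi s (Z w))).
Proof.
have iK : Pint P (fun w => integ 0 1 (fun s => wt s * xi s (Z w))).
  have := PintZ 2^-1 Pint_Kern; congr Pint; apply/funext => w.
  by rewrite /Kern mulrA mulVf// mul1r.
rewrite {1}/Kern ExZ//; congr (_ * _).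
(* Product rule for Lipschitz constants: |wt| <= 2 with constant Z^2 for [xi], and |xi| <= |Z| with
   constant pi for [wt]. *)
rewrite (Ex_integ (B := fun w => 2 * Z w ^+ 2 + pi * `|Z w|) iK).
- by apply: eq_integ => t _; rewrite ExZ//; exact: Pint_xi.
- by move=> s _; apply: PintZ; exact: Pint_xi.
- by apply: PintD; apply: PintZ => //; exact: Pint_first_moment.
- by move=> w; apply: addr_ge0; apply: mulr_ge0; rewrite ?sqr_ge0 ?pi_ge0.
- by move=> w; exact: wxi_cont.
- apply: (@eq_ind _ (fun s => wt s * Ex P (fun w => xi s (Z w))) (cont_on 0 1)).
    by apply: cont_onM; [exact: wt_cont|exact: Ex_xi_cont].
  by apply/funext => s; rewrite ExZ//; exact: Pint_xi.
move=> w s u s1 u1.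
have -> : wt s * xi s (Z w) - wt u * xi u (Z w) =
  wt s * (xi s (Z w) - xi u (Z w)) + (wt s - wt u) * xi u (Z w) by ring.
rewrite (le_trans (ler_normD _ _))// (normrM (wt s)) (normrM (wt s - _)) [leRHS]mulrDl lerD//.
  by rewrite -[leRHS]mulrA ler_pM ?wt_le2//; exact: xi_lipschitz.
by rewrite [leRHS]mulrAC ler_pM ?wt_lipschitz ?xi_le.
Qed.

Lemma Ex_cos_lipschitz s u : `|Ex P (fun w => cos (s * Z w)) - Ex P (fun w => cos (u * Z w))| <=
  Ex P (fun w => `|Z w|) * `|s - u|.
Proof.
have isu := PintB (Pint_cos s) (Pint_cos u); have i1 := Pint_first_moment.
rewrite -ExB; [|exact: Pint_cos|exact: Pint_cos].
rewrite (le_trans (Ex_norm_le isu))// mulrC -ExZ//.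
apply: Ex_le; [exact: Pint_norm|exact: PintZ|move=> w].
by rewrite (le_trans (cos_lipschitz _ _))// -mulrBl normrM.
Qed.

Lemma fejer_le2 (x : R) : `|fejer x| <= 2.
Proof.
rewrite normrM ger0_norm// ler_piMr//; apply: integ01_bound; first exact: fejer_cont.
move=> t /andP[t0 t1]; rewrite normrM mulr_ile1 ?normr_ge0 ?ncos//.
by rewrite ger0_norm; lra.
Qed.

Lemma Pint_fejer : Pint P (fun w => fejer (Z w)).
Proof.
apply: (Pint_comp_bounded _ fejer_le2) => x.
by apply: (@lipschitz_continuous _ _ 2) => y; exact: fejer_lipschitz.
Qed.

Lemma Ex_fejer : Ex P (fun w => fejer (Z w)) =
  2 * integ 0 1 (fun s => (1 - s) * Ex P (fun w => cos (s * Z w))).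
Proof.
have iF : Pint P (fun w => integ 0 1 (fun s => (1 - s) * cos (s * Z w))).
  have := PintZ 2^-1 Pint_fejer; congr Pint; apply/funext => w.
  by rewrite /fejer mulrA mulVf// mul1r.
rewrite {1}/fejer ExZ//; congr (_ * _).
rewrite (Ex_integ (B := fun w => `|Z w| + 1) iF).
- by apply: eq_integ => t _; rewrite ExZ//; exact: Pint_cos.
- by move=> s _; apply: PintZ; exact: Pint_cos.
- by apply: PintD; [exact: Pint_first_moment|exact: Pint_cst].
- by move=> w; rewrite addr_ge0.
- by move=> w; exact: fejer_cont.
- apply: (@eq_ind _ (fun s => (1 - s) * Ex P (fun w => cos (s * Z w))) (cont_on 0 1)).
    apply: cont_onM; first exact: lin_cont.
    by move=> t _; apply: lipschitz_continuous => s; exact: Ex_cos_lipschitz.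
  by apply/funext => s; rewrite ExZ//; exact: Pint_cos.
move=> w s u /andP[s0 s1] u1.
have -> : (1 - s) * cos (s * Z w) - (1 - u) * cos (u * Z w) =
  (1 - s) * (cos (s * Z w) - cos (u * Z w)) - (s - u) * cos (u * Z w) by ring.
have s1' : `|1 - s| <= 1 by rewrite ger0_norm; lra.
rewrite (le_trans (ler_normB _ _))// !normrM mulrDl mul1r lerD//.
  rewrite (le_trans (ler_piMl (normr_ge0 _) s1'))// (le_trans (cos_lipschitz _ _))//.
  by rewrite -mulrBl normrM mulrC.
by rewrite ler_piMr// ncos.
Qed.

End kernel_expectations.

Section step_expectation.
Context (R : realType).
Implicit Types a s t u x : R.

Lemma is_derive_expR_lin (c t : R) : is_derive t 1 (fun s => expR (c * s)) (c * expR (c * t)).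
Proof.
have := is_derive1_comp (is_derive_expR _) (is_derive_affine c 0 t).
rewrite addr0 mulrC; congr (is_derive _ _ _ _); apply/funext => v /=.
by rewrite addr0.
Qed.

Lemma integ_exp_decay a : 0 < a -> integ 0 1 (fun s => expR (- a * s)) <= a^-1.
Proof.
move=> a0; have D t : is_derive t 1 (fun s => - a^-1 * expR (- a * s)) (expR (- a * t)).
  have := is_deriveZ_fun (- a^-1) (is_derive_expR_lin (- a) t).
  by rewrite mulrA mulrNN mulVf ?mul1r// gt_eqF.
have c : cont_on 0 1 (fun s => expR (- a * s)).
  by move=> t _; exact: is_derive_continuous (is_derive_expR_lin (- a) t).
rewrite (integ_FTC ler01 (fun t _ => D t) c) (_ : expR (- a * 0) = 1) ?mulr0 ?expR0//.
have : 0 <= a^-1 * expR (- a * 1) by rewrite mulr_ge0 ?expR_ge0// invr_ge0 ltW.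
lra.
Qed.

Lemma exp_decay_cont a c : cont_on 0 1 (fun s => c * expR (- a * s)).
Proof.
apply: cont_onM; first exact: cont_on_cst.
by move=> t _; exact: is_derive_continuous (is_derive_expR_lin (- a) t).
Qed.

(** Equivalent to (u - 2)^2 >= 0; exponentials have an elementary integral, which supplies the
    factor 1 / a. *)
Lemma gauss_le_exp u : expR (- (u ^+ 2 / 4)) <= expR 1 * expR (- u).
Proof.
rewrite -expRD ler_expR; have := sqr_ge0 (u - 2); rewrite sqrrB; lra.
Qed.

Lemma sqr_gauss_le_exp u : 0 <= u -> u ^+ 2 * expR (- (u ^+ 2 / 4)) <= 2 * expR 4 * expR (- u).
Proof.
move=> u0; have := power_le_expR 2 u0; rewrite (_ : 2`!%:R = 2 :> R)// => u2.
apply: (le_trans (ler_wpM2r (expR_ge0 _) u2)); rewrite -!mulrA ler_wpM2l//.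
rewrite -!expRD ler_expR; have := sqr_ge0 (u - 4); rewrite sqrrB; lra.
Qed.

Context d (T : measurableType d) (P : probability T R).

Lemma step_expectation (Z : T -> R) (mZ : measurable_fun setT Z) :
  Pint P (fun w => ((0 <= Z w)%R)%:R : R) /\
  `|Ex P (fun w => ((0 <= Z w)%R)%:R) - 1 / 2 - Ex P (fun w => Kern (Z w)) / (2 * Klim R)| <=
  step_constant R * (Ex P (fun w => fejer (Z w)) + Ex P (fun w => fejer (Z w + pi))).
Proof.
have iS : Pint P (fun w => ((0 <= Z w)%R)%:R : R).
  apply: (Pint_dom (h := fun=> 1)); last 2 first.
  - exact: Pint_cst.
  - by move=> w; case: (0 <= Z w)%R; rewrite ?normr1 ?normr0.
  have -> : (fun w => ((0 <= Z w)%R)%:R : R) = (fun w => \1_(Z @^-1` `[0, +oo[) w).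
    apply/funext => w; rewrite indicE (_ : (w \in _) = (0 <= Z w)%R)//.
    by apply/idP/idP; rewrite inE /= in_itv /= andbT.
  apply: measurable_indic; rewrite -[X in measurable X]setTI; exact: mZ.
split=> //.
have iK := Pint_Kern P mZ.
have iF1 := Pint_fejer P mZ.
have mZp : measurable_fun setT (fun w => Z w + pi) by exact: measurable_funD.
have iF2 := Pint_fejer P mZp.
have iA : Pint P (fun w => ((0 <= Z w)%R)%:R - 1 / 2 - (2 * Klim R)^-1 * Kern (Z w)).
  by apply: PintB; [apply: PintB => //; exact: Pint_cst|exact: PintZ].
have -> : Ex P (fun w => ((0 <= Z w)%R)%:R) - 1 / 2 - Ex P (fun w => Kern (Z w)) / (2 * Klim R) =
    Ex P (fun w => ((0 <= Z w)%R)%:R - 1 / 2 - (2 * Klim R)^-1 * Kern (Z w)).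
  rewrite ExB; [|by apply: PintB => //; exact: Pint_cst|exact: PintZ].
  rewrite ExB ?Ex_cst//; last exact: Pint_cst.
  by rewrite (ExZ (2 * Klim R)^-1 iK) [in RHS](mulrC _^-1).
rewrite (le_trans (Ex_norm_le iA))// -(ExD iF1 iF2) -(ExZ _ (PintD iF1 iF2)).
apply: Ex_le; [exact: Pint_norm|by apply: PintZ; exact: PintD|].
by move=> w; rewrite (mulrC _^-1); exact: step_approx.
Qed.

Variable Y : T -> R.
Hypothesis mY : measurable_fun setT Y.
Hypothesis iY2 : Pint P (fun w => Y w ^+ 2).

Definition charf u : R[i] := Ex P (fun w => cos (u * Y w)) +i* Ex P (fun w => sin (u * Y w)).

Lemma measurable_shift a t : measurable_fun setT (fun w => a * (t - Y w)).
Proof. by apply: measurable_funM => //; exact: measurable_funB. Qed.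

Lemma Pint_shift a t : Pint P (fun w => (a * (t - Y w)) ^+ 2).
Proof.
apply: (Pint_dom (h := fun w => 2 * a ^+ 2 * t ^+ 2 + 2 * a ^+ 2 * Y w ^+ 2)).
- by apply: measurable_funX; exact: measurable_shift.
- by apply: PintD; [exact: Pint_cst|exact: PintZ].
move=> w; rewrite ger0_norm ?sqr_ge0// -subr_ge0.
rewrite (_ : _ - _ = (a * (t + Y w)) ^+ 2) ?sqr_ge0//; ring.
Qed.

(** Multiplying by [s] turns [xi] into a sine, whose expectation is the characteristic function at
    sa with a phase depending on t. This is Fourier inversion in the form used here. *)
Lemma Ex_xi_shift a t s : s * Ex P (fun w => xi s (a * (t - Y w))) =
  complex.Im (expi (s * a * t) * conjc (charf (s * a))).
Proof.
rewrite -ExZ; last exact: Pint_xi (measurable_shift a t) (Pint_shift a t) s.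
rewrite cImM [complex.Re (expi _)]/= [complex.Im (expi _)]/= /charf /=.
rewrite mulrN addrC -[X in _ = _ - X]ExZ; last exact: (Pint_sin P mY).
rewrite -[X in _ = X - _]ExZ; last exact: (Pint_cos P mY).
rewrite -ExB; last 2 first.
- by apply: PintZ; exact: (Pint_cos P mY).
- by apply: PintZ; exact: (Pint_sin P mY).
apply: eq_Rintegral => w _; rewrite xiE -sinB; congr sin; ring.
Qed.

Lemma Ex_cos_shift a t s : Ex P (fun w => cos (s * (a * (t - Y w)))) =
  complex.Re (expi (s * a * t) * conjc (charf (s * a))).
Proof.
rewrite cReM [complex.Re (expi _)]/= [complex.Im (expi _)]/= /charf /=.
rewrite mulrN opprK -[X in _ = _ + X]ExZ; last exact: (Pint_sin P mY).
rewrite -[X in _ = X + _]ExZ; last exact: (Pint_cos P mY).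
rewrite -ExD; last 2 first.
- by apply: PintZ; exact: (Pint_cos P mY).
- by apply: PintZ; exact: (Pint_sin P mY).
apply: eq_Rintegral => w _; rewrite -cosB; congr cos; ring.
Qed.

(** A concentration bound at scale 1 / a, uniform in [t], from the decay of the characteristic
    function on [0, a]. It replaces the density bound of Esseen's inequality. *)
Lemma Ex_fejer_bound a t : 0 < a ->
  (forall u, 0 <= u <= a -> cmod (charf u) <= expR (- (u ^+ 2 / 4))) ->
  Ex P (fun w => fejer (a * (t - Y w))) <= 2 * expR 1 / a.
Proof.
move=> a0 H; rewrite (Ex_fejer (measurable_shift a t) (Pint_shift a t)).
rewrite -mulrA ler_wpM2l// (@le_trans _ _ (expR 1 * integ 0 1 (fun s => expR (- a * s))))//; last first.
  by rewrite ler_wpM2l ?expR_ge0// integ_exp_decay.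
rewrite -integZ; last by have := @exp_decay_cont a 1; congr cont_on; apply/funext => s; rewrite mul1r.
apply: integ_le; last 1 first.
- move=> s /andP[s0 s1]; rewrite (le_trans (ler_norm _))// normrM.
  rewrite (le_trans (ler_piMl (normr_ge0 _) _))//; first by rewrite ger0_norm; lra.
  rewrite Ex_cos_shift (le_trans (Re_le_cmod _))// cmodM cmod_expi mul1r cmodJ.
  rewrite (le_trans (H _ _))//; first by rewrite mulr_ge0 ?(ltW a0)//= ler_piMl// ltW.
  by rewrite mulNr (mulrC a) gauss_le_exp.
- apply: cont_onM; first exact: lin_cont.
  by move=> s _; apply: lipschitz_continuous => u;
    exact: Ex_cos_lipschitz (measurable_shift a t) (Pint_shift a t) _ _.
- exact: exp_decay_cont.
Qed.

End step_expectation.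

(** The first term collects four Fejer expectations of at most 2e / a each; the second, with a
    factor 2 to spare, is the difference of the [Kern] terms over 2 [Klim]. *)
Definition smoothing_constant (R : realType) : R :=
  8 * step_constant R * expR 1 + 8 * expR 4 / Klim R.

Section smoothing_inequality.
Context (R : realType).
Context d (T : measurableType d) (P : probability T R).
Context d' (T' : measurableType d') (Q : probability T' R).
Variables (Y : T -> R) (N : T' -> R) (a : R).
Hypothesis mY : measurable_fun setT Y.
Hypothesis mN : measurable_fun setT N.
Hypothesis iY2 : Pint P (fun w => Y w ^+ 2).
Hypothesis iN2 : Pint Q (fun w => N w ^+ 2).
Hypothesis a0 : 0 < a.
Hypothesis YN : forall u, 0 <= u <= a ->
  cmod (charf P Y u - charf Q N u) <= u ^+ 3 * expR (- (u ^+ 2 / 4)) / a.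
Hypothesis cY : forall u, 0 <= u <= a -> cmod (charf P Y u) <= expR (- (u ^+ 2 / 4)).
Hypothesis cN : forall u, 0 <= u <= a -> cmod (charf Q N u) <= expR (- (u ^+ 2 / 4)).

Let dxi t s := Ex P (fun w => xi s (a * (t - Y w))) - Ex Q (fun w => xi s (a * (t - N w))).

(** At u = sa the hypothesis on the characteristic functions contains a factor s that cancels the
    one from [Ex_xi_shift]; what remains is (sa)^2 times a Gaussian. *)
Lemma dxi_bound_gt0 t s : 0 < s <= 1 -> `|dxi t s| <= 2 * expR 4 * expR (- a * s).
Proof.
move=> /andP[s0 s1]; have a0' := a0.
have sa : 0 <= s * a <= a by rewrite mulr_ge0 ?ler_piMl// ltW.
have : s * `|dxi t s| <= (s * a) ^+ 3 * expR (- ((s * a) ^+ 2 / 4)) / a.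
  rewrite -{1}(gtr0_norm s0) -normrM mulrBr !(Ex_xi_shift mY iY2, Ex_xi_shift mN iN2).
  rewrite -cImN -cImD -mulrN -mulrDr -conjcB (le_trans (Im_le_cmod _))//.
  by rewrite cmodM cmod_expi mul1r cmodJ YN.
have -> : (s * a) ^+ 3 * expR (- ((s * a) ^+ 2 / 4)) / a =
    s * ((s * a) ^+ 2 * expR (- ((s * a) ^+ 2 / 4))).
  by rewrite exprS -!mulrA [X in s * (a * X)]mulrA [X in s * (a * X)]mulrC mulrA; field; exact: lt0r_neq0.
rewrite (ler_pM2l s0) => H; rewrite (le_trans H)// mulNr (mulrC a).
by apply: sqr_gauss_le_exp; case/andP: sa.
Qed.

Lemma dxi_lipschitz t s u : `|dxi t s - dxi t u| <=
  (Ex P (fun w => (a * (t - Y w)) ^+ 2) + Ex Q (fun w => (a * (t - N w)) ^+ 2)) * `|s - u|.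
Proof.
have -> : dxi t s - dxi t u =
  (Ex P (fun w => xi s (a * (t - Y w))) - Ex P (fun w => xi u (a * (t - Y w)))) -
  (Ex Q (fun w => xi s (a * (t - N w))) - Ex Q (fun w => xi u (a * (t - N w)))).
  have H (p q r v : R) : p - q - (r - v) = p - r - (q - v) by ring.
  exact: H.
rewrite (le_trans (ler_normB _ _))// [leRHS]mulrDl lerD//.
  exact: Ex_xi_lipschitz (measurable_shift mY a t) (Pint_shift mY iY2 a t) s u.
exact: Ex_xi_lipschitz (measurable_shift mN a t) (Pint_shift mN iN2 a t) s u.
Qed.

(** At s = 0 nothing can be cancelled; the bound extends there by Lipschitz continuity in [s]. *)
Lemma dxi_bound t s : 0 <= s <= 1 -> `|dxi t s| <= 2 * expR 4 * expR (- a * s).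
Proof.
move=> /andP[]; rewrite le_eqVlt => /predU1P[<- _ {s}|s0 s1]; last by rewrite dxi_bound_gt0 ?s0.
rewrite mulr0 expR0 mulr1; apply/ler_addgt0Pl => e e0.
set C := Ex P (fun w => (a * (t - Y w)) ^+ 2) + Ex Q (fun w => (a * (t - N w)) ^+ 2).
have C0 : 0 <= C by rewrite addr_ge0//; apply: Rintegral_ge0 => w _; exact: sqr_ge0.
have C1 : 0 < C + 1 by lra.
pose s := Num.min 1 (e / (C + 1)).
have s0 : 0 < s by rewrite lt_min ltr01 divr_gt0.
have s1 : s <= 1 by rewrite ge_min lexx.
have se : s * (C + 1) <= e by rewrite -ler_pdivlMr// ge_min lexx orbT.
have := dxi_lipschitz t 0 s; rewrite -/C sub0r normrN (gtr0_norm s0) => H1.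
have := @dxi_bound_gt0 t s; rewrite s0 s1 => /(_ isT) H2.
have E1 : expR (- a * s) <= 1.
  by rewrite -expR0 ler_expR mulNr oppr_le0 mulr_ge0// ltW.
have H4 : 2 * expR 4 * expR (- a * s) <= 2 * expR 4.
  by rewrite ler_piMr// mulr_ge0// expR_ge0.
have H3 : `|dxi t 0| <= `|dxi t 0 - dxi t s| + `|dxi t s|.
  by rewrite -{1}(subrK (dxi t s) (dxi t 0)) ler_normD.
apply: (le_trans H3); apply: lerD; last exact: le_trans H2 H4.
rewrite (le_trans H1)// (le_trans _ se)// mulrC ler_wpM2l ?(ltW s0)//.
by rewrite lerDl.
Qed.

Lemma Kern_difference t :
  `|Ex P (fun w => Kern (a * (t - Y w))) - Ex Q (fun w => Kern (a * (t - N w)))| <=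
  8 * expR 4 / a.
Proof.
rewrite (Ex_Kern (measurable_shift mY a t) (Pint_shift mY iY2 a t)).
rewrite (Ex_Kern (measurable_shift mN a t) (Pint_shift mN iN2 a t)).
have c1 := Ex_xi_cont (measurable_shift mY a t) (Pint_shift mY iY2 a t) (a := 0) (b := 1).
have c2 := Ex_xi_cont (measurable_shift mN a t) (Pint_shift mN iN2 a t) (a := 0) (b := 1).
have w1 := @wt_cont R 0 1.
rewrite -mulrBr -integB; [|exact: cont_onM|exact: cont_onM].
have cI := cont_onB (cont_onM w1 c1) (cont_onM w1 c2).
have cE := @exp_decay_cont R a (4 * expR 4).
have -> : 8 * expR 4 / a = 2 * (4 * expR 4 * a^-1) by ring.
rewrite normrM ger0_norm// ler_wpM2l// (le_trans (integ_norm_le cI))//.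
apply: (@le_trans _ _ (4 * expR 4 * integ 0 1 (fun s => expR (- a * s)))); last first.
  by rewrite ler_wpM2l ?mulr_ge0 ?expR_ge0// integ_exp_decay.
rewrite -integZ; last first.
  by have := @exp_decay_cont R a 1; congr cont_on; apply/funext => s; rewrite mul1r.
apply: integ_le => //; first exact: cont_on_norm.
move=> s s01; rewrite -mulrBr normrM.
have -> : 4 * expR 4 * expR (- a * s) = 2 * (2 * expR 4 * expR (- a * s)) by ring.
by rewrite ler_pM ?wt_le2//; exact: dxi_bound.
Qed.

(** Both distribution functions are replaced by expectations of [Kern], with errors paid by Fejer
    kernels centred at t and at t + pi / a. *)
Lemma smoothing_inequality t :
  `|Ex P (fun w => ((Y w <= t)%R)%:R) - Ex Q (fun w => ((N w <= t)%R)%:R)| <=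
  smoothing_constant R / a.
Proof.
have [_] := step_expectation P (measurable_shift mY a t).
have [_] := step_expectation Q (measurable_shift mN a t).
have stepE d1 (T1 : measurableType d1) (P1 : probability T1 R) (Z : T1 -> R) :
    Ex P1 (fun w => ((0 <= a * (t - Z w))%R)%:R) = Ex P1 (fun w => ((Z w <= t)%R)%:R).
  by apply: eq_Rintegral => w _; rewrite pmulr_rge0// subr_ge0.
rewrite (stepE _ _ P Y) (stepE _ _ Q N).
have shiftE d1 (T1 : measurableType d1) (P1 : probability T1 R) (Z : T1 -> R) :
    Ex P1 (fun w => fejer (a * (t - Z w) + pi)) =
    Ex P1 (fun w => fejer (a * (t + pi / a - Z w))).
  apply: eq_Rintegral => w _; congr fejer.
  have H (q : R) : a * (t - Z w) + q = a * (t + q / a - Z w).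
    by field; exact: lt0r_neq0.
  exact: H.
rewrite (shiftE _ _ P Y) (shiftE _ _ Q N).
have L0 := Klim_gt0 R; have s0 := step_constant_ge0 R.
have := Ex_fejer_bound mY iY2 t a0 cY.
have := Ex_fejer_bound mY iY2 (t + pi / a) a0 cY.
have := Ex_fejer_bound mN iN2 t a0 cN.
have := Ex_fejer_bound mN iN2 (t + pi / a) a0 cN.
set f1 := Ex Q (fun w => fejer (a * (t + pi / a - N w))).
set f2 := Ex Q (fun w => fejer (a * (t - N w))).
set f3 := Ex P (fun w => fejer (a * (t + pi / a - Y w))).
set f4 := Ex P (fun w => fejer (a * (t - Y w))).
move=> b1 b2 b3 b4.
have B1 : step_constant R * (f2 + f1) <= step_constant R * (4 * expR 1 / a).
  by rewrite ler_wpM2l//; lra.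
have B2 : step_constant R * (f4 + f3) <= step_constant R * (4 * expR 1 / a).
  by rewrite ler_wpM2l//; lra.
have B3 : `|Ex P (fun w => Kern (a * (t - Y w))) / (2 * Klim R) -
     Ex Q (fun w => Kern (a * (t - N w))) / (2 * Klim R)| <= 4 * expR 4 / Klim R / a.
  rewrite -mulrBl normrM [X in _ * X]gtr0_norm ?invr_gt0 ?mulr_gt0//.
  rewrite ler_pdivrMr ?mulr_gt0// (le_trans (Kern_difference t))//.
  rewrite (_ : _ * (2 * Klim R) = 8 * expR 4 / a)//.
  by field; rewrite !lt0r_neq0.
move: B3.
set k1 := Ex P (fun w => Kern (a * (t - Y w))) / (2 * Klim R).
set k2 := Ex Q (fun w => Kern (a * (t - N w))) / (2 * Klim R).
set x1 := Ex Q (fun w => ((N w <= t)%R)%:R); set x2 := Ex P (fun w => ((Y w <= t)%R)%:R).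
move=> B3 B4 B5.
have -> : x2 - x1 = (x2 - 1 / 2 - k1) - (x1 - 1 / 2 - k2) + (k1 - k2) by ring.
rewrite (le_trans (ler_normD _ _))// (le_trans (lerD (ler_normB _ _) B3))//.
have -> : smoothing_constant R / a = step_constant R * (4 * expR 1 / a) +
   step_constant R * (4 * expR 1 / a) + 8 * expR 4 / Klim R / a.
  by rewrite /smoothing_constant; field; rewrite !lt0r_neq0.
have q0 : 0 <= expR 4 / Klim R / a by rewrite !divr_ge0 ?expR_ge0// ltW.
have := le_trans B4 B1; have := le_trans B5 B2; lra.
Qed.

End smoothing_inequality.

(** * Proof of the theorem *)

Section entire_characteristic_function.
Variable R : realType.
Local Notation C := R[i].

(** Translates complex derivability into [cdiff]; the library's norm and radii live in R[i], so the
    radius [k] has to be brought back to a real number. *)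
Lemma entire_cdiff (f : C -> C) z : entire f -> exists d, cdiff f z d.
Proof.
move=> /(_ z) fz; pose D := 'D_1 (f : C^o -> C^o) z; exists D => e e0.
have e0' : 0 < e%:C by rewrite ltcR.
move: fz => /cvgrPdist_le/(_ _ e0').
rewrite near_withinE => /nbhs_ballP[k /= k0 Hk].
have kE : k = (cmod k)%:C by rewrite cmod_normE gtr0_norm.
exists (cmod k); first by rewrite cmod_gt0 gt_eqF.
move=> h hk; have [->|h0] := eqVneq h 0.
  by rewrite addr0 subrr mulr0 subr0 cmod0 mulr0.
have hk' : `|h| < k by rewrite kE -cmod_normE ltcR.
have := Hk h; rewrite /ball /= sub0r normrN => /(_ hk' h0).
rewrite (_ : h *: (1 : C^o) = h); last exact: mulr1.
rewrite (addrC h z) -[lim _]/D => Hd.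
have -> : f (z + h) - f z - D * h = - (D - h^-1 * (f (z + h) - f z)) * h.
  by field.
rewrite cmodM cmodN ler_wpM2r ?cmod_ge0// -lecR cmod_normE; exact: Hd.
Qed.

Context d (T : measurableType d) (P : probability T R) (X : {RV P >-> R}).

Lemma ExE (g : T -> R) : fine 'E_P[g] = Ex P g.
Proof. by rewrite unlock. Qed.

Lemma char_funE t : char_fun X t =
  Ex P (fun w => cos (t * X w)) +i* Ex P (fun w => sin (t * X w)).
Proof. by rewrite /char_fun /complex_expectation !ExE. Qed.

Variable f : C -> C.
Hypothesis f_entire : entire f.
Hypothesis fX : forall t : R, f t%:C = char_fun X t.

Lemma entire_char_exp_moment x : Pint P (fun w => expR (x * `|X w|)).
Proof.
apply: (@exp_moment _ _ _ _ X f) => [z|t]; first exact: entire_cdiff.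
by rewrite fX char_funE.
Qed.

(** Both sides are entire, the right one by the exponential moments, and they agree on the real
    line. *)
Lemma entire_charE z : f z = Fk X 0 (ii * z).
Proof.
apply/eqP; rewrite -subr_eq0; apply/eqP; move: z.
apply: entire_eq0 => [rho z _|t].
  have [d1 fd] := entire_cdiff z f_entire.
  exists (d1 - Fk X 1 (ii * z) * (ii * 1)); apply: tdiffB => //.
  apply: (tdiff_comp (g := fun x => ii * x)); first exact: Fk_cdiff entire_char_exp_moment _ _.
  by apply: tdiffZ; exact: cdiff_id.
rewrite (_ : ii * t%:C = 0 +i* t); last by simpc.
by rewrite F0_imag fX char_funE subrr.
Qed.

(** The maximum of |f| on |z| = r dominates f at ir and -ir, that is mgf(-r) and mgf(r). A liminf
    equal to 0 yields one good radius beyond any [x0]. *)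
Lemma entire_char_growth :
  limf_einf (fun r : R => (logplus (ln (max_modulus r f)) / r)%:E) +oo%R = 0%E ->
  forall eta x0 : R, 0 < eta ->
  exists2 r : R, x0 < r & ln (mgf X r + mgf X (- r)) <= 1 + expR (eta * r).
Proof.
rewrite limf_einfE => L eta x0 eta0.
pose V := [set r : R | Num.max x0 0 < r].
have FV : +oo%R V by exists (Num.max x0 0); split => //; exact: num_real.
have : (ereal_inf [set (logplus (ln (max_modulus r f)) / r)%:E | r in V] < eta%:E)%E.
  apply: (@le_lt_trans _ _ 0%E); last by rewrite lte_fin.
  by rewrite -L; apply: ereal_sup_ubound; exists V.
move=> /ereal_inf_lt[_ [r Vr <-]]; rewrite lte_fin => H.
move: Vr; rewrite /V /= gt_max => /andP[xr r0].
exists r => //; move: H; rewrite ltr_pdivrMr// => H.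
set M := max_modulus r f in H.
have lnM : ln M <= expR (eta * r).
  have [l0|l0] := leP (ln M) 0; first exact: le_trans l0 (expR_ge0 _).
  rewrite -[leLHS]lnK ?posrE// ler_expR (le_trans _ (ltW H))//.
  by rewrite /logplus le_max lexx.
have MF z : cmod z = r -> cmod (f z) <= M.
  move=> zr; apply: ub_le_sup; last by exists z.
  (* The supremum [M] dominates the values on the circle only because these are bounded above; the
     ridge property gives such a bound. *)
  exists (mgf X r + mgf X (- r)) => _ [y yr <-].
  rewrite entire_charE (le_trans (F0_ridge entire_char_exp_moment _))//.
  apply: (mgf_mono entire_char_exp_moment).
  by rewrite (le_trans (Re_le_cmod _))// cmodM cmodi mul1r yr.
have mgfE x : cmod (f (- ii * x%:C)) = mgf X x.
  rewrite entire_charE (_ : ii * (- ii * x%:C) = x%:C); last by simpc.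
  by rewrite F0_real cmodR ger0_norm//; apply: Rintegral_ge0 => w _; exact: expR_ge0.
have m1 : mgf X r <= M.
  by rewrite -mgfE MF// cmodM cmodN cmodi mul1r cmodR gtr0_norm.
have m2 : mgf X (- r) <= M.
  by rewrite -mgfE MF// cmodM cmodN cmodi mul1r cmodR normrN gtr0_norm.
have p1 : 0 < mgf X r by exact: lt_le_trans (expR_gt0 _) (mgf_lb entire_char_exp_moment _).
have p2 : 0 < mgf X (- r) by exact: lt_le_trans (expR_gt0 _) (mgf_lb entire_char_exp_moment _).
have M0 : 0 < M by lra.
(* The summand 1 in the conclusion pays for the factor 2 in mgf(r) + mgf(-r) <= 2 M. *)
have e2 : 2 <= expR 1 :> R by have := expR_ge1Dx (1 : R); lra.
rewrite -[leRHS]expRK ler_ln ?posrE ?expR_gt0 ?addr_gt0// expRD.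
apply: (@le_trans _ _ (2 * M)); first lra.
apply: ler_pM => //; first exact: ltW.
by rewrite -[leLHS]lnK ?posrE// ler_expR.
Qed.

End entire_characteristic_function.

Lemma smoothing_constant_gt0 (R : realType) : 0 < smoothing_constant R.
Proof.
rewrite ltr_wpDl//; first by rewrite !mulr_ge0 ?expR_ge0 ?step_constant_ge0.
by rewrite divr_gt0 ?mulr_gt0 ?expR_gt0 ?Klim_gt0.
Qed.

Lemma Ex_cdf d (T : measurableType d) (R : realType) (P : probability T R) (Y : T -> R) t :
  measurable_fun setT Y ->
  P (Y @^-1` `]-oo, t]) = (Ex P (fun w => ((Y w <= t)%R)%:R))%:E.
Proof.
move=> mY; have mA : measurable (Y @^-1` `]-oo, t]).
  by rewrite -[X in measurable X]setTI; exact: mY.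
have -> : (fun w => ((Y w <= t)%R)%:R : R) = \1_(Y @^-1` `]-oo, t]).
  apply/funext => w; rewrite indicE (_ : (w \in _) = (Y w <= t)%R)//.
  by apply/idP/idP; rewrite inE /= in_itv /=.
rewrite /Ex /Rintegral integral_indic// setIT fineK//; exact: fin_num_measure.
Qed.

Section standardized.
Context d (T : measurableType d) (R : realType) (P : probability T R).
Variables (X : {RV P >-> R}) (mu sigma delta : R) (f : R[i] -> R[i]).
Hypothesis X2 : (X : T -> R) \in Lfun P 2%:E.
Hypothesis Xmu : ('E_P[X] = mu%:E)%E.
Hypothesis Xvar : ('V_P[X] = (sigma ^+ 2)%R%:E)%E.
Hypothesis sigma0 : 0 < sigma.
Hypothesis delta0 : 0 < delta.
Hypothesis f_entire : entire f.
Hypothesis fX : forall t : R, f t%:C = char_fun X t.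
Hypothesis f_growth :
  limf_einf (fun r : R => (logplus (ln (max_modulus r f)) / r)%:E) +oo%R = 0%E.
Hypothesis f_nz : forall z : R[i], `|complex.Re z| < delta -> f z != 0.

Let Y := standardize X mu sigma.

Let Xexp := entire_char_exp_moment f_entire fX.

Lemma Ex_X : Ex P X = mu.
Proof. by rewrite -ExE Xmu. Qed.

Lemma Ex_X2 : Ex P (fun w => X w ^+ 2) = sigma ^+ 2 + mu ^+ 2.
Proof.
have := varianceE X2; rewrite Xvar Xmu => H.
have iX2 := Lfun2_integrable_sqr X2.
have E : ('E_P[X ^+ 2] = (Ex P (fun w => X w ^+ 2))%:E)%E.
  rewrite -ExE fineK; last by rewrite unlock; exact: integrable_fin_num iX2.
  by congr expectation.
by move: H; rewrite E -EFin_expe -EFinB => -[->]; rewrite subrK.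
Qed.

Lemma charf_standardize u : charf P Y u = expi (- (mu * (u / sigma))) * Fk X 0 (0 +i* (u / sigma)).
Proof.
have mX : measurable_fun setT X by [].
have ic := Pint_cos P mX (u / sigma); have is_ := Pint_sin P mX (u / sigma).
rewrite F0_imag /charf /expi; simpc; congr (_ +i* _).
  rewrite -(ExZ _ ic) -(ExZ _ is_) -ExB; [|exact: PintZ|exact: PintZ].
  by apply: eq_Rintegral => w _; rewrite -cosD /Y /standardize; congr cos; ring.
rewrite -(ExZ _ ic) -(ExZ _ is_) -ExD; [|exact: PintZ|exact: PintZ].
apply: eq_Rintegral => w _.
rewrite (_ : u * Y w = - (mu * (u / sigma)) + u / sigma * X w); first by rewrite sinD; ring.
by rewrite /Y /standardize; ring.
Qed.

(** [zero_free_strip_normal] at t = u / sigma; the phase of the standardization cancels i mu t, and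
    sigma^2 (u / sigma)^3 / delta becomes u^3 / (sigma delta). *)
Lemma charf_expansion u : 0 <= u -> u <= sigma * delta / 8 ->
  exists rem : R[i], charf P Y u = cexp ((- (u ^+ 2 / 2))%:C + rem) /\
    cmod rem <= 160 * u ^+ 3 / (sigma * delta).
Proof.
move=> u0 u1.
have := @zero_free_strip_normal R (Fk X 0) (Fk X 1) (Fk X 2) (mgf X) mu (sigma ^+ 2) delta
  (Fk_cdiff Xexp 0) (Fk_cdiff Xexp 1) (F0_real X) (mgf0 X).
have lb x : expR (mu * x) <= mgf X x by rewrite -Ex_X; exact: mgf_lb Xexp x.
move=> /(_ lb (mgf_mono Xexp) (F0_ridge Xexp) (Fk_conj Xexp 0) (Fk_conj Xexp 1)).
have F1 : Fk X 1 0 = mu%:C.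
  by rewrite Fk_0 -Ex_X; congr (_%:C); apply: eq_Rintegral => w _; rewrite expr1.
have F2 : Fk X 2 0 = (sigma ^+ 2 + mu ^+ 2)%:C by rewrite Fk_0 Ex_X2.
move=> /(_ F1 F2 delta0).
(* F(z) = f(-iz) turns the vertical zero-free strip of [f] into a horizontal one. *)
have nz (z : R[i]) : `|complex.Im z| < delta -> Fk X 0 z != 0.
  move=> zd; have -> : z = ii * (- ii * z) by case: (z) => x y; simpc.
  rewrite -(entire_charE f_entire fX); apply: f_nz.
  by case: (z) zd => x y; simpc.
move=> /(_ nz (entire_char_growth f_entire fX f_growth)) H.
have t0 : 0 <= u / sigma by rewrite divr_ge0// ltW.
have t1 : u / sigma <= delta / 8.
  by rewrite ler_pdivrMr// (le_trans u1)//; lra.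
have [rem [FE remb]] := H _ t0 t1; exists rem; split.
  rewrite charf_standardize FE.
  have -> : expi (- (mu * (u / sigma))) = cexp (0 +i* (- (mu * (u / sigma)))).
    by rewrite /cexp /= expR0 mul1r.
  rewrite -[LHS]cexpD addrA; congr (cexp (_ + rem)).
  have E1 : 0 - sigma ^+ 2 * (u / sigma) ^+ 2 / 2 = - (u ^+ 2 / 2).
    by field; exact: lt0r_neq0.
  have E2 : - (mu * (u / sigma)) + mu * (u / sigma) = 0 by rewrite addNr.
  by apply/eqP; rewrite eq_complex cReD cImD /= E2 add0r -E1 add0r !eqxx.
rewrite (le_trans remb)// le_eqVlt; apply/orP; left; apply/eqP.
by field; rewrite !lt0r_neq0.
Qed.

(* With this scale the remainder is at most u^2 / 4 for 0 <= u <= a. *)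
Variable a : R.
Hypothesis a0 : 0 < a.
Hypothesis aE : sigma * delta = 640 * a.

Lemma charf_expansion_small u : 0 <= u <= a ->
  exists rem : R[i], charf P Y u = cexp ((- (u ^+ 2 / 2))%:C + rem) /\
    cmod rem <= u ^+ 3 / (4 * a) /\ cmod rem <= u ^+ 2 / 4.
Proof.
move=> /andP[u0 ua]; have a0' := a0.
have [||rem [E remb]] := @charf_expansion u => //; first by rewrite aE; lra.
exists rem; split => //.
have b1 : cmod rem <= u ^+ 3 / (4 * a).
  rewrite (le_trans remb)// aE le_eqVlt; apply/orP; left; apply/eqP.
  by field; exact: lt0r_neq0.
split => //; rewrite (le_trans b1)// ler_pdivrMr ?mulr_gt0//.
rewrite (_ : u ^+ 2 / 4 * (4 * a) = a * u ^+ 2); last by field.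
by rewrite exprS ler_wpM2r// sqr_ge0.
Qed.

Lemma charf_normal u : charf (normal_prob (0 : R) 1) (@normal_var R) u = (expR (- (u ^+ 2 / 2)))%:C.
Proof. exact: normal_char_imag. Qed.

Lemma charf_le u : 0 <= u <= a -> cmod (charf P Y u) <= expR (- (u ^+ 2 / 4)).
Proof.
move=> /charf_expansion_small[rem [-> [_ b]]].
rewrite cmod_cexp cReD ler_expR /=.
have := le_trans (ler_norm _) (le_trans (Re_le_cmod rem) b); lra.
Qed.

(** Of the Gaussian factor exp(-u^2 / 2) one half absorbs exp(|rem|) <= exp(u^2 / 4); the other half
    remains for the integration in [u]. *)
Lemma charf_close u : 0 <= u <= a ->
  cmod (charf P Y u - charf (normal_prob (0 : R) 1) (@normal_var R) u) <=
  u ^+ 3 * expR (- (u ^+ 2 / 4)) / a.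
Proof.
move=> ua; have /andP[u0 _] := ua; have a0' := a0.
have [rem [-> [b1 b2]]] := charf_expansion_small ua.
rewrite charf_normal cexpD cexpR -[X in _ - X]mulr1 -mulrBr cmodM cmodR ger0_norm ?expR_ge0//.
rewrite (le_trans (ler_wpM2l (expR_ge0 _) (cexpB1_bound rem)))//.
have e1 : expR (cmod rem) <= expR (u ^+ 2 / 4) by rewrite ler_expR.
have b3 : 2 * cmod rem <= u ^+ 3 / a.
  apply: (@le_trans _ _ (2 * (u ^+ 3 / (4 * a)))); first by rewrite ler_wpM2l.
  rewrite (_ : 2 * _ = u ^+ 3 / a / 2); last by field; exact: lt0r_neq0.
  by rewrite ler_pdivrMr// ler_peMr ?divr_ge0 ?exprn_ge0 ?(ltW a0)//; lra.
have c0 := cmod_ge0 rem.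
apply: (@le_trans _ _ (expR (- (u ^+ 2 / 2)) * (u ^+ 3 / a * expR (u ^+ 2 / 4)))).
  by rewrite ler_wpM2l ?expR_ge0// ler_pM ?mulr_ge0 ?expR_ge0.
rewrite mulrCA -expRD (_ : - (u ^+ 2 / 2) + u ^+ 2 / 4 = - (u ^+ 2 / 4)); last by field.
by rewrite mulrAC.
Qed.

Lemma standardized_cdf_bound t :
  (`| cdf (standardize X mu sigma : {RV P >-> R}) t - std_normal_cdf t |
   <= (smoothing_constant R / a)%:E)%E.
Proof.
have mY : measurable_fun setT Y by exact: measurable_standardize.
have mN : measurable_fun setT (@normal_var R) by [].
have iY2 : Pint P (fun w => Y w ^+ 2).
  have i1 : Pint P (fun w => X w ^+ 2).
    exact: (Lfun2_integrable_sqr X2).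
  apply: (Pint_dom (h := fun w => 2 / sigma ^+ 2 * X w ^+ 2 + 2 / sigma ^+ 2 * mu ^+ 2)).
  - exact: measurable_funX.
  - by apply: PintD; [exact: PintZ|exact: Pint_cst].
  move=> w; rewrite ger0_norm ?sqr_ge0// -subr_ge0.
  rewrite (_ : _ - _ = ((X w + mu) / sigma) ^+ 2) ?sqr_ge0// /Y /standardize.
  by field; exact: lt0r_neq0.
have iN2 : Pint (normal_prob (0 : R) 1) (fun w => normal_var w ^+ 2).
  have := poly_exp_Pint (@normal_exp_moment R) 2 0; congr Pint; apply/funext => w.
  by rewrite mul0r expR0 mulr1 real_normK ?num_real.
have cN u : 0 <= u <= a ->
    cmod (charf (normal_prob (0 : R) 1) (@normal_var R) u) <= expR (- (u ^+ 2 / 4)).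
  move=> _; rewrite charf_normal cmodR ger0_norm ?expR_ge0// ler_expR.
  have := sqr_ge0 u; lra.
have := smoothing_inequality mY mN iY2 iN2 a0 charf_close charf_le cN t.
have -> : cdf (standardize X mu sigma : {RV P >-> R}) t =
    (Ex P (fun w => ((Y w <= t)%R)%:R))%:E.
  exact: (Ex_cdf P t mY).
have -> : std_normal_cdf t =
    (Ex (normal_prob (0 : R) 1) (fun w => ((normal_var w <= t)%R)%:R))%:E.
  exact: (Ex_cdf (normal_prob (0 : R) 1) t mN).
by rewrite -EFinB abse_EFin lee_fin.
Qed.

End standardized.

Theorem theorem2 (R : realType) :
  exists c1 : R, 0 < c1 /\
    forall (d : measure_display) (T : measurableType d) (P : probability T R)
      (X : {RV P >-> R}) (mu sigma delta : R) (f : R[i] -> R[i]),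
      (X : T -> R) \in Lfun P 2%:E ->
      ('E_P[X] = mu%:E)%E ->
      ('V_P[X] = (sigma ^+ 2)%R%:E)%E ->
      0 < sigma ->
      0 < delta ->
      entire f ->
      (forall t : R, f t%:C = char_fun X t) ->
      limf_einf (fun r : R => (logplus (ln (max_modulus r f)) / r)%:E) +oo%R
        = 0%E ->
      (forall z : R[i], `|complex.Re z| < delta -> f z != 0) ->
      (ereal_sup (range (fun t : R =>
         `| cdf (standardize X mu sigma : {RV P >-> R}) t - std_normal_cdf t |))
       <= (c1 / (sigma * delta))%R%:E)%E.
Proof.
(* The smoothing inequality costs [smoothing_constant R / a] with a = sigma delta / 640; the number
   640 = 4 * 160 makes the remainder 160 u^3 / (sigma delta) equal to u^3 / (4a). *)
exists (640 * smoothing_constant R); split.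
  by apply: mulr_gt0; [rewrite ltr0n|exact: smoothing_constant_gt0].
move=> d T P X mu sigma delta f X2 Xmu Xvar s0 d0 fe fX fg fnz.
apply: ge_ereal_sup => _ [t _ <-].
have sd : 0 < sigma * delta by exact: mulr_gt0.
have a0 : 0 < sigma * delta / 640 by apply: divr_gt0; [exact: sd|rewrite ltr0n].
have aE : sigma * delta = 640 * (sigma * delta / 640) by rewrite [RHS]mulrC divfK ?pnatr_eq0.
have := standardized_cdf_bound X2 Xmu Xvar s0 d0 fe fX fg fnz a0 aE t.
by rewrite invf_div mulrA (mulrC _ 640).
Qed.
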